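(* Let $(Z,\Omega,\mathcal L)$ be a generalized Kähler structure of symplectic type, viewed as a holomorphic symplectic Morita equivalence with brane bisection between holomorphic Poisson structures $(I_\pm,\sigma_\pm)$. Let $M$ be the smooth manifold underlying $X_+$, let $\alpha\in\Omega^{1,cl}(M)$ be a real closed 1-form, and let $(Q(\alpha),d^c\alpha)\in\mathfrak{aut}_{\mathcal C}(I_+,\sigma_+)$ be the infinitesimal Courant symmetry that it determines (with $d^c$ taken with respect to $I_+$). Exponentiating this symmetry gives a 1-parameter family of Courant automorphisms $$\Big(\psi_t,\ F_t=\int_0^t\psi_s^*(d^c\alpha)\,ds\Big)\in\mathrm{Aut}_{\mathcal C}(I_+,\sigma_+),$$ $\psi_t$ being the flow of $Q(\alpha)$ (for the times at which it is defined), which act on $(Z,\Omega,\mathcal L)$ to produce a family of degenerate generalized Kähler structures of symplectic type deforming the given one. This family has the form $$[(Z,\Omega,\mathcal L_t=\eta_t(\mathcal L))],$$ with the original maps $\pi_\pm$, where $\eta_t$ is the flow of the vector field $V_{\pi_+^*\alpha}=(\mathrm{Im}\,\Omega)^{-1}(\pi_+^*\alpha)$ on $Z$, and $\mathcal L_t=\eta_t(\mathcal L)$ is the result of applying this flow to the brane bisection $\mathcal L$.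
   Context: Conventions. 2-forms are maps $TM\to T^*M$, $X\mapsto\iota_XF$; bivectors are maps $T^*M\to TM$. A holomorphic Poisson structure on $X=(M,I)$ is written $\sigma=-\tfrac14(IQ+iQ)$, with $Q=-4\,\mathrm{Im}\,\sigma$. For a holomorphic symplectic form $\Omega=B+i\omega$, $B=\omega I$ and $Q=\omega^{-1}$. $d^c=i(\bar\partial-\partial)$. All Poisson manifolds are assumed integrable. Holomorphic symplectic Morita equivalence from $(X_-,\sigma_-)$ to $(X_+,\sigma_+)$: a holomorphic symplectic manifold $(Z,\Omega)$ with holomorphic surjective submersions $\pi_\pm:Z\to X_\pm$ with connected, simply connected fibres such that $\pi_+$ is Poisson, $\pi_-$ is anti-Poisson, $\ker d\pi_+$ and $\ker d\pi_-$ are symplectic orthogonals of each other, and $\pi_\pm$ are complete (pullbacks of complete Hamiltonian vector fields are complete). Brane bisection: a smooth submanifold $\mathcal L\subset Z$, Lagrangian for $\mathrm{Im}(\Omega)$, which is a section of both $\pi_+$ and $\pi_-$ (i.e. $\pi_\pm|_{\mathcal L}$ are diffeomorphisms onto $X_\pm$). Brackets $[\cdot]$ denote isomorphism classes: isomorphisms are holomorphic symplectomorphisms commuting with $\pi_\pm$ and carrying brane to brane. Such data $(Z,\Omega,\mathcal L)$ correspond to degenerate generalized Kähler structures of symplectic type $(I_+,I_-,Q,F)$: identify $X_+\cong\mathcal L\cong X_-$ via $\pi_\pm|_{\mathcal L}$, let $I_\pm$ be the complex structures of $X_\pm$, $Q=-4\,\mathrm{Im}\,\sigma_\pm$ (these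 agree) and $F=\Omega|_{\mathcal L}$; the defining equations are $I_+-I_-=QF$, $FI_++I_-^*F=0$, with $F$ closed and $\sigma_\pm$ holomorphic Poisson. It is a (non-degenerate) generalized Kähler structure when $g=-\tfrac12F(I_++I_-)$ is positive definite. For a holomorphic Poisson structure $(I,\sigma)$ on $M$, with $Q=-4\,\mathrm{Im}\,\sigma$ and $I^F:=I+QF$: $$\mathrm{Aut}_{\mathcal C}(I,\sigma)=\{(\phi,F)\in\mathrm{Diff}_Q(M)\times\Omega^{2,cl}(M): FI+I^*F+FQF=0,\ \phi_*(I^F)=I\},$$ with product $(\phi_1,F_1)*(\phi_2,F_2)=(\phi_1\circ\phi_2,\phi_2^*F_1+F_2)$, where $\mathrm{Diff}_Q(M)$ is the group of diffeomorphisms preserving $Q$. Its Lie algebra is $$\mathfrak{aut}_{\mathcal C}(I,\sigma)=\{(V,\omega)\in\mathfrak X_Q(M)\times\Omega^{2,cl}(M): \omega I+I^*\omega=0,\ \mathcal L_VI=Q\omega\},$$ $\mathfrak X_Q(M)$ being the vector fields preserving $Q$; a pair $(V,\omega)$ integrates to $(\phi_t,\int_0^t\phi_s^*\omega\,ds)$ with $\phi_t$ the flow of $V$. A closed real 1-form $\alpha$ determines the element $(Q(\alpha),d^c\alpha)$. The action of $(\phi,F)\in\mathrm{Aut}_{\mathcal C}(I_+,\sigma_+)$ on $(Z,\Omega,\mathcal L)$ with maps $\pi_\pm$ yields $(Z,\Omega+\pi_+^*F,\mathcal L)$, with maps $\phi\circ\pi_+:Z\to X_+$ and $\pi_-:Z\to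 X_-$, again a holomorphic symplectic Morita equivalence with brane bisection from $(X_-,\sigma_-)$ to $(X_+,\sigma_+)$ (the complex structure on $Z$ being the one determined by the new form). *)

(* Defs.v *)
From HB Require Import structures.
From mathcomp Require Import all_boot all_order all_algebra.
From mathcomp Require Import all_classical all_reals all_analysis.
From mathcomp Require Import complex.
Set Implicit Arguments.
Unset Strict Implicit.
Unset Printing Implicit Defensive.
Import Order.TTheory GRing.Theory Num.Theory.
Import numFieldNormedType.Exports.
Local Open Scope classical_set_scope.
Local Open Scope ring_scope.
Local Open Scope complex_scope.

(** * Smooth manifolds *)

Section Euclidean.
Variables (R : realType) (n : nat).
Implicit Types (U : set 'rV[R]_n) (f : 'rV[R]_n -> R).

Fixpoint Ck_on (k : nat) U f : Prop :=
  (forall x, U x -> {for x, continuous f}) /\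
  if k is k'.+1 then
    forall i : 'I_n, (forall x, U x -> derivable f x (delta_mx 0 i)) /\
                     Ck_on k' U (fun x => 'D_(delta_mx 0 i) f x)
  else True.

Definition smooth_on U f : Prop := forall k, Ck_on k U f.

End Euclidean.

(* The values of [cmap] outside [cdom], and of [cinv] outside the image of
   [cdom], are irrelevant. *)
Record chart (R : realType) (T : topologicalType) (n : nat) := Chart {
  cdom : set T;
  cmap : T -> 'rV[R]_n;
  cinv : 'rV[R]_n -> T }.

Definition is_chart (R : realType) (T : topologicalType) (n : nat)
    (c : chart R T n) : Prop :=
  [/\ open (cdom c), open (cmap c @` cdom c),
      (forall p, cdom c p -> cinv c (cmap c p) = p),
      {within cdom c, continuous (cmap c)} &
      {within cmap c @` cdom c, continuous (cinv c)}].

(* Real manifolds without boundary; the atlas need not be maximal. *)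
Record manifold (R : realType) := Manifold {
  pts :> topologicalType;
  mdim : nat;
  atlas : set (chart R pts mdim);
  atlas_chart : forall c, atlas c -> is_chart c;
  atlas_cover : forall p, exists2 c, atlas c & cdom c p;
  atlas_compat : forall c d, atlas c -> atlas d -> forall j,
    smooth_on (cmap c @` (cdom c `&` cdom d)) (fun x => cmap d (cinv c x) 0 j);
  mfd_hausdorff : hausdorff_space pts;
  mfd_second_countable : @second_countable pts }.

Section SmoothMaps.
Variable R : realType.

Definition smooth (M : manifold R) (f : M -> R) : Prop :=
  forall c, atlas c -> smooth_on (cmap c @` cdom c) (f \o cinv c).

Definition smooth_map (M N : manifold R) (phi : M -> N) : Prop :=
  continuous phi /\
  forall (c : chart R M (mdim M)) (d : chart R N (mdim N)),
    atlas c -> atlas d -> forall j,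
    smooth_on (cmap c @` (cdom c `&` phi @^-1` cdom d))
              (fun x => cmap d (phi (cinv c x)) 0 j).

Definition diffeo (M N : manifold R) (phi : M -> N) : Prop :=
  smooth_map phi /\
  exists psi : N -> M, [/\ smooth_map psi, cancel phi psi & cancel psi phi].

End SmoothMaps.

(** * Tangent vectors *)

Section Tangent.
Variables (R : realType) (M : manifold R).

(* A tangent vector at p is a derivation at p of the algebra of smooth
   functions.  It is stored as a functional on all functions; the last clause
   fixes its value on the non-smooth ones, so that two tangent vectors agreeing
   on smooth functions are equal. *)
Definition derivation_at (p : M) (v : (M -> R) -> R^o) : Prop :=
  [/\ (forall (a : R) f g, smooth f -> smooth g ->
         v (fun q => a * f q + g q) = a * v f + v g),
      (forall f g, smooth f -> smooth g ->
         v (fun q => f q * g q) = f p * v g + g p * v f) &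
      (forall f, ~ smooth f -> v f = 0)].

Definition derivations (p : M) : {pred (M -> R) -> R^o} :=
  [pred v | `[< derivation_at p v >]].

Lemma derivations_submod_closed (p : M) : submod_closed (derivations p).
Proof.
split=> [|b u v]; rewrite !unfold_in /=.
  by apply/asboolP; split=> * //=; rewrite !mulr0 ?addr0.
move=> /asboolP [lu Lu zu] /asboolP [lv Lv zv]; apply/asboolP; split.
- move=> a f g sf sg; change (b * u (fun q => a * f q + g q) + v (fun q => a * f q + g q)
    = a * (b * u f + v f) + (b * u g + v g)).
  rewrite lu // lv // !mulrDr !mulrA [b * a]mulrC -!addrA; congr (_ + _).
  by rewrite addrCA.
- move=> f g sf sg; change (b * u (fun q => f q * g q) + v (fun q => f q * g q)
    = f p * (b * u g + v g) + g p * (b * u f + v f)).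
  rewrite Lu // Lv // !mulrDr !mulrA [b * f p]mulrC [b * g p]mulrC -!addrA.
  by congr (_ + _); rewrite addrCA.
- move=> f sf; change (b * u f + v f = 0).
  by rewrite zu // zv // mulr0 addr0.
Qed.

HB.instance Definition _ (p : M) :=
  GRing.isSubmodClosed.Build R ((M -> R) -> R^o) (derivations p)
    (derivations_submod_closed p).

Record tangent (p : M) := Tangent {
  tan_val :> (M -> R) -> R^o;
  tan_valP : tan_val \in derivations p }.

HB.instance Definition _ (p : M) := [isSub for @tan_val p].
HB.instance Definition _ (p : M) := [Choice of tangent p by <:].
HB.instance Definition _ (p : M) := [SubChoice_isSubLmodule of tangent p by <:].

End Tangent.

(* For a smooth phi, the functional below is a derivation at phi p. *)
Definition push (R : realType) (M N : manifold R) (phi : M -> N) (p : M)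
    (u : tangent p) : tangent (phi p) :=
  insubd (0 : tangent (phi p))
    (fun g : N -> R => if `[< smooth g >] then u (g \o phi) else 0).
Arguments push {R M N} phi {p} u.

(** * Tensor fields on a manifold *)

Section Tensors.
Variables (R : realType) (M : manifold R).

Definition covector (p : M) := tangent p -> R.
Definition vfield := forall p : M, tangent p.
Definition endo := forall p : M, tangent p -> tangent p.
Definition form1 := forall p : M, covector p.
(* [F p u] is the covector iota_u F. *)
Definition form2 := forall p : M, tangent p -> covector p.
Definition form3 := forall p : M, tangent p -> tangent p -> covector p.
Definition bivector := forall p : M, covector p -> tangent p.
Definition cform2 := forall p : M, tangent p -> tangent p -> R[i].

Definition covec_linear (p : M) (xi : covector p) : Prop :=
  forall (a : R) (u v : tangent p), xi (a *: u + v) = a * xi u + xi v.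

Definition is_vfield (X : vfield) : Prop :=
  forall f : M -> R, smooth f -> smooth (fun p => X p f).

Definition is_form1 (al : form1) : Prop :=
  (forall p, covec_linear (al p)) /\
  (forall X, is_vfield X -> smooth (fun p => al p (X p))).

Definition is_form2 (F : form2) : Prop :=
  [/\ (forall p u, covec_linear (F p u)),
      (forall p u v, F p u v = - F p v u) &
      (forall X Y, is_vfield X -> is_vfield Y -> smooth (fun p => F p (X p) (Y p)))].

Definition is_endo (A : endo) : Prop :=
  (forall p (a : R) (u v : tangent p), A p (a *: u + v) = a *: A p u + A p v) /\
  (forall X, is_vfield X -> is_vfield (fun p => A p (X p))).

Definition is_bivector (Q : bivector) : Prop :=
  [/\ (forall p (a : R) (xi et : covector p), covec_linear xi -> covec_linear et ->
         Q p (fun u => a * xi u + et u) = a *: Q p xi + Q p et),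
      (forall p (xi et : covector p), covec_linear xi -> covec_linear et ->
         et (Q p xi) = - xi (Q p et)) &
      (forall al, is_form1 al -> is_vfield (fun p => Q p (al p)))].

Definition dfun (f : M -> R) : form1 := fun p u => u f.
Arguments dfun f p u : clear implicits.

(* For vector fields X, Y the functional below is a derivation at p. *)
Definition bracket (X Y : vfield) : vfield := fun p =>
  insubd (0 : tangent p)
    (fun f : M -> R => if `[< smooth f >]
       then X p (fun q => Y q f) - Y p (fun q => X q f) else 0).

(* A smooth vector field through a given tangent vector.  The expressions below
   in which it is used are tensorial, so they do not depend on the choice. *)
Definition extend (p : M) (u : tangent p) : vfield :=
  xget ((fun q => 0) : vfield) [set X : vfield | is_vfield X /\ X p = u].

Definition ext_d1 (al : form1) : form2 := fun p u v =>
  let X := extend u in let Y := extend v in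
  X p (fun q => al q (Y q)) - Y p (fun q => al q (X q)) - al p (bracket X Y p).
Arguments ext_d1 al p u v : clear implicits.

Definition ext_d2 (F : form2) : form3 := fun p u v w =>
  let X := extend u in let Y := extend v in let Z := extend w in
  X p (fun q => F q (Y q) (Z q)) - Y p (fun q => F q (X q) (Z q))
  + Z p (fun q => F q (X q) (Y q))
  - F p (bracket X Y p) (Z p) + F p (bracket X Z p) (Y p)
  - F p (bracket Y Z p) (X p).
Arguments ext_d2 F p u v w : clear implicits.

Definition closed1 (al : form1) : Prop := forall p u v, ext_d1 al p u v = 0.
Definition closed2 (F : form2) : Prop := forall p u v w, ext_d2 F p u v w = 0.

Definition reF (Om : cform2) : form2 := fun p u v => complex.Re (Om p u v).
Arguments reF Om p u v : clear implicits.
Definition imF (Om : cform2) : form2 := fun p u v => complex.Im (Om p u v).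
Arguments imF Om p u v : clear implicits.

(** ** Complex structures *)

(* The last clause is the vanishing of the Nijenhuis tensor. *)
Definition complex_structure (I : endo) : Prop :=
  [/\ is_endo I,
      (forall p u, I p (I p u) = - u) &
      (forall X Y, is_vfield X -> is_vfield Y -> forall p,
         bracket (fun q => I q (X q)) (fun q => I q (Y q)) p
         - I p (bracket (fun q => I q (X q)) Y p)
         - I p (bracket X (fun q => I q (Y q)) p)
         - bracket X Y p = 0)].

(* Let J act on k-forms by (J b)(u1, .., uk) = b(I u1, .., I uk), that is, by
   the scalar i^(p-q) on forms of type (p,q).  Since d = del + delbar,
   d^c = i (delbar - del) is J^-1 d J.  This is J^-1 d J on 1-forms; on 2-forms
   J is an involution. *)
Definition dc1 (I : endo) (al : form1) : form2 := fun p u v =>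
  ext_d1 (fun q w => al q (I q w)) p (I p u) (I p v).
Arguments dc1 I al p u v : clear implicits.

(* The differential of a complex function. *)
Definition cdfun (f : M -> R[i]) (p : M) (u : tangent p) : R[i] :=
  u (fun q => complex.Re (f q)) +i* u (fun q => complex.Im (f q)).

Definition csmooth (f : M -> R[i]) : Prop :=
  smooth (fun q => complex.Re (f q)) /\ smooth (fun q => complex.Im (f q)).

(* Every germ of a holomorphic function is the germ of such an f. *)
Definition holomorphic_on (I : endo) (U : set M) (f : M -> R[i]) : Prop :=
  csmooth f /\
  forall p, U p -> forall u : tangent p, cdfun f (I p u) = 'i * cdfun f u.

(** ** Holomorphic Poisson structures *)

(* The real and imaginary parts of sigma = -1/4 (I Q + i Q). *)
Definition sigma_re (I : endo) (Q : bivector) : bivector := fun p xi =>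
  - (4%:R^-1 *: I p (Q p xi)).
Arguments sigma_re I Q p xi : clear implicits.
Definition sigma_im (Q : bivector) : bivector := fun p xi =>
  - (4%:R^-1 *: Q p xi).
Arguments sigma_im Q p xi : clear implicits.

(* dg (sigma (df)) for real f and g, and its C-bilinear extension *)
Definition sigma_rr (I : endo) (Q : bivector) (f g : M -> R) (p : M) : R[i] :=
  sigma_re I Q p (dfun f p) g +i* sigma_im Q p (dfun f p) g.
Definition sigma_bracket (I : endo) (Q : bivector) (f g : M -> R[i]) (p : M) : R[i] :=
  let f1 := fun q => complex.Re (f q) in let f2 := fun q => complex.Im (f q) in
  let g1 := fun q => complex.Re (g q) in let g2 := fun q => complex.Im (g q) in
  sigma_rr I Q f1 g1 p - sigma_rr I Q f2 g2 p
  + 'i * (sigma_rr I Q f1 g2 p + sigma_rr I Q f2 g1 p).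

(* I sigma = i sigma holds by the shape of sigma, so that sigma is of type (2,0)
   as soon as it is skew.  The fourth clause says that sigma is holomorphic and
   the last one that [sigma, sigma] = 0. *)
Definition holomorphic_poisson (I : endo) (Q : bivector) : Prop :=
  [/\ complex_structure I,
      is_bivector (sigma_re I Q),
      is_bivector Q,
      (forall U f g, open U -> holomorphic_on I U f -> holomorphic_on I U g ->
         holomorphic_on I U (sigma_bracket I Q f g)) &
      (forall f g h, csmooth f -> csmooth g -> csmooth h -> forall p,
         sigma_bracket I Q f (sigma_bracket I Q g h) p
         + sigma_bracket I Q g (sigma_bracket I Q h f) p
         + sigma_bracket I Q h (sigma_bracket I Q f g) p = 0)].

(* The Hamiltonian vector field of a real function for Q = -4 Im sigma. *)
Definition hamiltonian (Q : bivector) (f : M -> R) : vfield := fun p => Q p (dfun f p).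

(** ** Symplectic forms *)

Definition nondegenerate (om : form2) : Prop :=
  forall p (u : tangent p), (forall v, om p u v = 0) -> u = 0.

Definition inv_form (om : form2) : bivector := fun p xi =>
  xget (0 : tangent p) [set v | forall w, om p v w = xi w].
Arguments inv_form om p xi : clear implicits.

(* A holomorphic symplectic form Om = B + i om determines the complex structure,
   by B = om I. *)
Definition cplx_of (Om : cform2) : endo := fun p u =>
  inv_form (imF Om) p (reF Om p u).
Arguments cplx_of Om p u : clear implicits.

Definition holomorphic_symplectic (Om : cform2) : Prop :=
  [/\ is_form2 (reF Om) /\ closed2 (reF Om),
      is_form2 (imF Om) /\ closed2 (imF Om),
      nondegenerate (imF Om),
      complex_structure (cplx_of Om) &
      (forall p u v, Om p (cplx_of Om p u) v = 'i * Om p u v)].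

(** ** Flows *)

Definition integral_curve (J : set R) (X : vfield) (g : R -> M) : Prop :=
  forall t, J t -> forall f : M -> R, smooth f ->
    is_derive (t : R^o) (1 : R^o) (fun s : R^o => f (g s) : R^o) (X (g t) f).

Definition complete (X : vfield) : Prop :=
  forall p, exists2 g, integral_curve setT X g & g 0 = p.

(* J is the interval of times under consideration. *)
Definition is_flow (J : set R) (X : vfield) (phi : R -> M -> M) : Prop :=
  [/\ (forall p, phi 0 p = p),
      (forall t, J t -> diffeo (phi t)) &
      (forall p, integral_curve J X (fun t => phi t p))].

(** ** Submanifolds *)

(* Embedded submanifolds (of codimension m), by local equations with linearly
   independent differentials. *)
Definition submanifold (L : set M) : Prop :=
  exists m : nat, forall p, L p ->
    exists (U : set M) (f : 'I_m -> M -> R),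
      [/\ open U, U p, (forall i, smooth (f i)),
          (forall c : 'I_m -> R, exists u : tangent p, forall i, u (f i) = c i) &
          (forall q, U q -> (L q <-> forall i, f i q = 0))].

Definition tangent_to (L : set M) (p : M) (u : tangent p) : Prop :=
  forall f : M -> R, smooth f -> (forall q, L q -> f q = 0) -> u f = 0.

Definition lagrangian (om : form2) (L : set M) : Prop :=
  forall p, L p -> forall u : tangent p,
    tangent_to L u <-> (forall v : tangent p, tangent_to L v -> om p u v = 0).

(** ** Generalized Kähler structures of symplectic type *)

Definition degenerate_gk (Jp Jm : endo) (Q : bivector) (F : form2) : Prop :=
  [/\ holomorphic_poisson Jp Q,
      holomorphic_poisson Jm Q,
      is_form2 F /\ closed2 F,
      (forall p u, Jp p u - Jm p u = Q p (F p u)) &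
      (forall p u v, F p (Jp p u) v + F p u (Jm p v) = 0)].

Definition gk_metric (Jp Jm : endo) (F : form2) : form2 := fun p u v =>
  - (2%:R^-1 * F p (Jp p u + Jm p u) v).
Arguments gk_metric Jp Jm F p u v : clear implicits.

Definition gk (Jp Jm : endo) (Q : bivector) (F : form2) : Prop :=
  degenerate_gk Jp Jm Q F /\
  forall p (u : tangent p), u != 0 -> 0 < gk_metric Jp Jm F p u u.

(** ** Infinitesimal Courant symmetries *)

Definition preserves_bivector (V : vfield) (Q : bivector) : Prop :=
  forall f g, smooth f -> smooth g -> forall p,
    V p (fun q => Q q (dfun f q) g)
    = Q p (dfun (fun q => V q f) p) g + Q p (dfun f p) (fun q => V q g).

(* The last clause is L_V I = Q om. *)
Definition aut_C_alg (I : endo) (Q : bivector) (V : vfield) (om : form2) : Prop :=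
  [/\ is_vfield V /\ preserves_bivector V Q,
      is_form2 om /\ closed2 om,
      (forall p u v, om p (I p u) v + om p u (I p v) = 0) &
      (forall X, is_vfield X -> forall p,
         bracket V (fun q => I q (X q)) p - I p (bracket V X p)
         = Q p (om p (X p)))].

End Tensors.
Arguments dfun {R M} f p u.
Arguments ext_d1 {R M} al p u v.
Arguments ext_d2 {R M} F p u v w.
Arguments reF {R M} Om p u v.
Arguments imF {R M} Om p u v.
Arguments dc1 {R M} I al p u v.
Arguments sigma_re {R M} I Q p xi.
Arguments sigma_im {R M} Q p xi.
Arguments inv_form {R M} om p xi.
Arguments cplx_of {R M} Om p u.
Arguments gk_metric {R M} Jp Jm F p u v.

(** * Maps and tensor fields *)

Section Maps.
Variables (R : realType) (M N : manifold R).
Implicit Types phi : M -> N.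

Definition pullback1 phi (al : form1 N) : form1 M := fun p u => al (phi p) (push phi u).
Arguments pullback1 phi al p u : clear implicits.
Definition pullback2 phi (F : form2 N) : form2 M := fun p u v =>
  F (phi p) (push phi u) (push phi v).
Arguments pullback2 phi F p u v : clear implicits.

Definition submersion phi : Prop :=
  smooth_map phi /\ forall p (w : tangent (phi p)), exists u : tangent p, push phi u = w.

(* phi intertwines I and J: phi is holomorphic when these are complex structures *)
Definition holomorphic_map (I : endo M) (J : endo N) phi : Prop :=
  smooth_map phi /\ forall p (u : tangent p), push phi (I p u) = J (phi p) (push phi u).

Definition related_bivectors phi (Q : bivector M) (Q' : bivector N) : Prop :=
  forall p (xi : covector (phi p)), covec_linear xi ->
    push phi (Q p (fun u => xi (push phi u))) = Q' (phi p) xi.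

Definition poisson_map (I : endo M) (Q : bivector M) (I' : endo N) (Q' : bivector N)
    phi : Prop :=
  related_bivectors phi (sigma_re I Q) (sigma_re I' Q') /\
  related_bivectors phi (sigma_im Q) (sigma_im Q').

Definition antipoisson_map (I : endo M) (Q : bivector M) (I' : endo N) (Q' : bivector N)
    phi : Prop :=
  related_bivectors phi (sigma_re I Q) (fun p xi => - sigma_re I' Q' p xi) /\
  related_bivectors phi (sigma_im Q) (fun p xi => - sigma_im Q' p xi).

Definition complete_map (Q : bivector M) (Q' : bivector N) phi : Prop :=
  forall f : N -> R, smooth f -> complete (hamiltonian Q' f) ->
    complete (hamiltonian Q (f \o phi)).

(* For a diffeomorphism phi, this is the conjugate of J by the differential of phi. *)
Definition pullback_endo phi (J : endo N) : endo M := fun p u =>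
  xget (0 : tangent p) [set w | push phi w = J (phi p) (push phi u)].
Arguments pullback_endo phi J p u : clear implicits.

(* phi restricts to a diffeomorphism of L onto N, with inverse s *)
Definition section_onto phi (L : set M) (s : N -> M) : Prop :=
  [/\ smooth_map s, (forall x, L (s x)), (forall x, phi (s x) = x) &
      (forall z, L z -> s (phi z) = z)].

End Maps.
Arguments pullback1 {R M N} phi al p u.
Arguments pullback2 {R M N} phi F p u v.
Arguments pullback_endo {R M N} phi J p u.

Definition simply_connected (R : realType) (T : topologicalType) (A : set T) : Prop :=
  forall g : R -> T, {within `[0, 1], continuous g} ->
    (forall t : R, `[0, 1]%classic t -> A (g t)) -> g 0 = g 1 ->
  exists H : R * R -> T,
    [/\ {within `[0, 1] `*` `[0, 1], continuous H},
        (forall s t : R, `[0, 1]%classic s -> `[0, 1]%classic t -> A (H (s, t))),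
        (forall t : R, `[0, 1]%classic t -> H (0, t) = g t /\ H (1, t) = g 0) &
        (forall s : R, `[0, 1]%classic s -> H (s, 0) = g 0 /\ H (s, 1) = g 0)].

(** * Courant automorphisms *)

Definition preserves (R : realType) (M : manifold R) (Q : bivector M) (phi : M -> M) :=
  related_bivectors phi Q Q.

Definition gauge (R : realType) (M : manifold R) (I : endo M) (Q : bivector M)
    (F : form2 M) : endo M := fun p u => I p u + Q p (F p u).
Arguments gauge {R M} I Q F p u.

Definition Aut_C (R : realType) (M : manifold R) (I : endo M) (Q : bivector M)
    (phi : M -> M) (F : form2 M) : Prop :=
  [/\ diffeo phi /\ preserves Q phi,
      is_form2 F /\ closed2 F,
      (forall p u v, F p (I p u) v + F p u (I p v) + F p (Q p (F p u)) v = 0) &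
      (forall p (u : tangent p), push phi (gauge I Q F p u) = I (phi p) (push phi u))].

Definition oriented_integral (R : realType) (a b : R) (f : R -> R) : R :=
  if a <= b then (\int[lebesgue_measure]_(s in `[a, b]) f s)%R
  else - (\int[lebesgue_measure]_(s in `[b, a]) f s)%R.

Definition flow_form (R : realType) (M : manifold R) (phi : R -> M -> M) (F : form2 M)
    (t : R) : form2 M := fun p u v =>
  oriented_integral 0 t (fun s => pullback2 (phi s) F p u v).
Arguments flow_form {R M} phi F t p u v.

(** * Morita equivalences with brane bisection *)

Record brane_data (R : realType) (Xm Xp : manifold R) := BraneData {
  tot : manifold R;
  Omega : cform2 tot;
  pim : tot -> Xm;
  pip : tot -> Xp;
  brane : set tot }.
Arguments tot {R Xm Xp} D : rename.
Arguments Omega {R Xm Xp} D p u v : rename.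
Arguments pim {R Xm Xp} D z : rename.
Arguments pip {R Xm Xp} D z : rename.
Arguments brane {R Xm Xp} D z : rename.

Section Morita.
Variables (R : realType) (Xm Xp : manifold R).
Implicit Types D : brane_data Xm Xp.

Definition morita (Jm : endo Xm) (Qm : bivector Xm) (Jp : endo Xp) (Qp : bivector Xp)
    D : Prop :=
  let Q := inv_form (imF (Omega D)) in
  let I := cplx_of (Omega D) in
  [/\ holomorphic_poisson Jm Qm /\ holomorphic_poisson Jp Qp,
      holomorphic_symplectic (Omega D),
      [/\ holomorphic_map I Jm (pim D), submersion (pim D),
          set_surj setT setT (pim D),
          (forall x, connected (pim D @^-1` [set x]) /\
                     simply_connected R (pim D @^-1` [set x])) &
          antipoisson_map I Q Jm Qm (pim D) /\ complete_map Q Qm (pim D)],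
      [/\ holomorphic_map I Jp (pip D), submersion (pip D),
          set_surj setT setT (pip D),
          (forall x, connected (pip D @^-1` [set x]) /\
                     simply_connected R (pip D @^-1` [set x])) &
          poisson_map I Q Jp Qp (pip D) /\ complete_map Q Qp (pip D)] &
      forall z (u : tangent z),
        (push (pip D) u = 0 <->
           forall v : tangent z, push (pim D) v = 0 -> Omega D z u v = 0) /\
        (push (pim D) u = 0 <->
           forall v : tangent z, push (pip D) v = 0 -> Omega D z u v = 0)].

Definition brane_bisection D : Prop :=
  [/\ submanifold (brane D),
      lagrangian (imF (Omega D)) (brane D),
      (exists s, section_onto (pim D) (brane D) s) &
      (exists s, section_onto (pip D) (brane D) s)].

(* D, together with a property P of the structure (I_+, I_-, Q, F) that it
   induces on the manifold underlying X_+ : there s is the inverse of the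
   restriction of pi_+ to the brane, and I_- is transported by
   pi_- s : X_+ -> X_-, which matches Q_+ with Q_-. *)
Definition represents
    (P : endo Xp -> endo Xp -> bivector Xp -> form2 Xp -> Prop)
    (Jm : endo Xm) (Qm : bivector Xm) (Jp : endo Xp) (Qp : bivector Xp) D : Prop :=
  [/\ morita Jm Qm Jp Qp D, brane_bisection D &
      exists s, [/\ section_onto (pip D) (brane D) s,
        related_bivectors (pim D \o s) Qp Qm &
        P Jp (pullback_endo (pim D \o s) Jm) Qp
          (pullback2 s (reF (Omega D)))]].

Definition degenerate_gk_data := represents (@degenerate_gk R Xp).
Definition gk_data := represents (@gk R Xp).

Definition act (phi : Xp -> Xp) (F : form2 Xp) D : brane_data Xm Xp :=
  {| Omega := fun z (u v : tangent z) =>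
       Omega D z u v + (pullback2 (pip D) F z u v)%:C;
     pim := pim D;
     pip := phi \o pip D;
     brane := brane D |}.

Definition with_brane D (L : set (tot D)) : brane_data Xm Xp :=
  {| Omega := Omega D; pim := pim D; pip := pip D; brane := L |}.

Definition isomorphic D D' : Prop :=
  exists h : tot D -> tot D',
    [/\ diffeo h /\ holomorphic_map (cplx_of (Omega D)) (cplx_of (Omega D')) h,
        (forall z (u v : tangent z), Omega D' (h z) (push h u) (push h v) = Omega D z u v),
        (forall z, pim D' (h z) = pim D z),
        (forall z, pip D' (h z) = pip D z) &
        h @` brane D = brane D'].

End Morita.
Arguments act {R Xm Xp} phi F D.
Arguments with_brane {R Xm Xp} D L.

(* Main.v *)
(* Write [pi] for pi_+ and [V_Z] for (Im Omega)^-1 (pi^* alpha). Since pi is Poisson, V_Z is pi-related to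
   V = Q(alpha); since the kernels of d pi_+ and d pi_- are orthogonal, it is tangent to the fibres of
   pi_-. Near any point alpha is the differential of a compactly supported function f, whose Hamiltonian
   field is complete, hence so is that of its pullback by pi, which is V_Z over that neighbourhood: as V is
   complete, V_Z is complete.
   By Cartan's formula the flow eta of V_Z preserves Im Omega, while the Lie derivative of Re Omega is
   d (pi^* (alpha I_+)) = pi^* (d^c alpha) because d (alpha I_+) is of type (1,1). Integrating,
   eta_t^* Omega = Omega + pi^* F_t, and eta_t covers psi_t over X_+ and the identity over X_-. Thus eta_t is
   an isomorphism from the action of (psi_t, F_t) on (Z, Omega, L) to (Z, Omega, eta_t(L)), and the
   properties of (psi_t, F_t) as a Courant automorphism descend from those of eta_t along pi.
   Tangent vectors being derivations, everything is computed in the coordinates of a chart cut off by a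
   bump function. *)

(* Most identities wanted on the base are proved on Z, where the bivector is the inverse of a
   symplectic form and the gauged complex structure is the conjugate of I by eta_t; they then
   descend because pi_+ is a surjective submersion. F_t is an integral over time, yet no integral is
   differentiated in the point: for a section s of pi_+ supplied by the brane, F_t is the pullback
   by s of eta_t^* B - B, where B = Re Omega. The obstacle is completeness: the hypothesis on pi_+
   concerns Hamiltonian fields of global functions, whereas alpha is exact only locally. Curves are
   prolonged step by step, with a step that depends on the base curve alone, since the fibres need
   not be compact. Derivations act on global functions. Local data are therefore replaced by global
   ones that agree with them near a point, and the smoothness of flows, which are given curve by
   curve, has to be proved. On R^n a derivative of a flow is a component of a flow in twice the
   dimension; on a manifold smoothness at a fixed point propagates in time by connectedness. *)
From HB Require Import structures.
Require Import Defs.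
From mathcomp Require Import all_boot all_order all_algebra.
From mathcomp Require Import all_classical all_reals all_analysis.
From mathcomp Require Import complex ring lra.
Set Implicit Arguments.
Unset Strict Implicit.
Unset Printing Implicit Defensive.
Import Order.TTheory GRing.Theory Num.Theory.
Import numFieldNormedType.Exports.
Local Open Scope classical_set_scope.
Local Open Scope ring_scope.

(** * Calculus in coordinates *)

Section Calculus.
Variable R : realType.
Section Ck.
Variable n : nat.
Implicit Types (U V : set 'rV[R]_n) (f g : 'rV[R]_n -> R).

Local Notation "'d_ i f" := (fun x => 'D_(delta_mx 0 i) f x) (at level 10, i at level 8, f at level 8).

Lemma near_open U x (P : 'rV[R]_n -> Prop) : open U -> U x -> (forall y, U y -> P y) ->
  \forall y \near x, P y.
Proof. by move=> oU Ux h; apply: filterS h _; exact: open_nbhs_nbhs. Qed.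

Lemma Ck_onW k U f : Ck_on k.+1 U f -> Ck_on k U f.
Proof.
elim: k f => [|k IH] f [cf df]; split=> // i.
by split; [apply (df i).1|apply: IH; apply (df i).2].
Qed.

Lemma Ck_onC k U f : Ck_on k U f -> forall x, U x -> {for x, continuous f}.
Proof. by case: k => [|k] []. Qed.

Lemma Ck_on_sub k U V f : V `<=` U -> Ck_on k U f -> Ck_on k V f.
Proof.
move=> sVU; elim: k f => [|k IH] f [cf df]; split => //; try by move=> x /sVU; apply: cf.
by move=> i; split; [move=> x /sVU; apply (df i).1|apply: IH; apply (df i).2].
Qed.

Lemma Ck_on_local k U f :
  (forall x, U x -> exists V, [/\ open V, V x & Ck_on k V f]) -> Ck_on k U f.
Proof.
elim: k f => [|k IH] f H.
  by split=> // x /H [V [oV Vx]] [cf _]; apply: cf.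
split=> [x /H [V [oV Vx]] [cf _]|i]; first exact: cf.
split=> [x /H [V [oV Vx]] [_ df]|]; first by apply (df i).1.
by apply: IH => x /H [V [oV Vx]] [_ df]; exists V; split => //; apply (df i).2.
Qed.

Lemma continuous_ext U f g x : open U -> U x -> (forall y, U y -> f y = g y) ->
  {for x, continuous f} -> {for x, continuous g}.
Proof.
move=> oU Ux fg; rewrite /prop_for /continuous_at fg // => h; apply: cvg_trans h.
have e : \forall y \near x, f y = g y by apply: (near_open oU Ux).
exact: near_eq_cvg e.
Qed.

Lemma Ck_on_ext k U f g : open U -> (forall x, U x -> f x = g x) ->
  Ck_on k U f -> Ck_on k U g.
Proof.
move=> oU; elim: k f g => [|k IH] f g fg [cf df]; split => //.
- by move=> x Ux; exact: (continuous_ext oU Ux fg (cf x Ux)).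
- by move=> x Ux; exact: (continuous_ext oU Ux fg (cf x Ux)).
move=> i; split=> [x Ux|].
  have e : \forall y \near x, f y = g y by apply: (near_open oU Ux).
  by apply: near_eq_derivable e _; apply (df i).1.
apply: IH (df i).2 => x Ux.
have e : \forall y \near x, f y = g y by apply: (near_open oU Ux).
exact: near_eq_derive.
Qed.

Lemma Ck_onS k U f (df : 'I_n -> 'rV[R]_n -> R) : open U ->
  (forall x, U x -> {for x, continuous f}) ->
  (forall i x, U x -> is_derive x (delta_mx 0 i) f (df i x)) ->
  (forall i, Ck_on k U (df i)) -> Ck_on k.+1 U f.
Proof.
move=> oU cf h hk; split=> // i; split=> [x Ux|]; first by case: (h i x Ux).
by apply: Ck_on_ext (hk i) => // x Ux; case: (h i x Ux).
Qed.

Lemma Ck_onSP k U f i : Ck_on k.+1 U f ->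
  (forall x, U x -> is_derive x (delta_mx 0 i) f ('D_(delta_mx 0 i) f x)) /\
  Ck_on k U (fun x => 'D_(delta_mx 0 i) f x).
Proof.
move=> [cf /(_ i)[h1 h2]]; split=> // x Ux.
by apply: DeriveDef => //; apply: h1.
Qed.

Lemma for_continuousD f g x : {for x, continuous f} -> {for x, continuous g} ->
  {for x, continuous (fun y => f y + g y)}.
Proof. by move=> hf hg; exact: (continuousD hf hg). Qed.

Lemma for_continuousM f g x : {for x, continuous f} -> {for x, continuous g} ->
  {for x, continuous (fun y => f y * g y)}.
Proof. by move=> hf hg; exact: (continuousM hf hg). Qed.

Lemma for_continuousV f x : f x != 0 -> {for x, continuous f} ->
  {for x, continuous (fun y => (f y)^-1)}.
Proof. by move=> f0 hf; exact: (continuousV f0 hf). Qed.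

Lemma Ck_on0 U f : (forall x, U x -> {for x, continuous f}) -> Ck_on 0 U f.
Proof. by []. Qed.

Lemma Ck_on_cst k U (a : R) : open U -> Ck_on k U (fun=> a).
Proof.
move=> oU; elim: k a => [|k IH] a; first by split=> // x Ux; exact: cst_continuous.
apply: (@Ck_onS _ _ _ (fun _ _ => 0)) => //; first by move=> x Ux; exact: cst_continuous.
Qed.

Lemma Ck_on_coord k U j : open U -> Ck_on k U (fun x => x 0 j).
Proof.
move=> oU; case: k => [|k].
  by split=> // x Ux; exact: coord_continuous.
apply: (@Ck_onS _ _ _ (fun i _ => (delta_mx 0 i : 'rV[R]_n) 0 j)) => //; first by move=> x Ux; exact: coord_continuous.
- move=> i x Ux; pose v := delta_mx 0 i : 'rV[R]_n.
  have d : derivable (fun y : 'rV[R]_n => y) x v by exact: derivable_id.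
  have := derive_mx d; rewrite derive_id => e.
  apply: DeriveDef; first by move/derivable_mxP: d => /(_ 0 j).
  by have := congr1 (fun M : 'rV_n => M 0 j) e; rewrite [in RHS]mxE => <-.
by move=> i; exact: Ck_on_cst.
Qed.

Lemma Ck_onD k U f g : open U -> Ck_on k U f -> Ck_on k U g ->
  Ck_on k U (fun x => f x + g x).
Proof.
move=> oU; elim: k f g => [|k IH] f g hf hg.
  by apply: Ck_on0 => x Ux; apply: for_continuousD; [exact: (Ck_onC hf Ux)|exact: (Ck_onC hg Ux)].
apply: (@Ck_onS _ _ _ (fun i x => 'D_(delta_mx 0 i) f x + 'D_(delta_mx 0 i) g x)) => //.
- by move=> x Ux; apply: for_continuousD; [exact: (Ck_onC hf Ux)|exact: (Ck_onC hg Ux)].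
- move=> i x Ux; have [fd _] := Ck_onSP i hf; have [gd _] := Ck_onSP i hg.
  by have := fd _ Ux; have := gd _ Ux => ? ?; exact: is_deriveD.
- by move=> i; apply: IH; [exact: (Ck_onSP i hf).2|exact: (Ck_onSP i hg).2].
Qed.

Lemma Ck_onM k U f g : open U -> Ck_on k U f -> Ck_on k U g ->
  Ck_on k U (fun x => f x * g x).
Proof.
move=> oU; elim: k f g => [|k IH] f g hf hg.
  by apply: Ck_on0 => x Ux; apply: for_continuousM; [exact: (Ck_onC hf Ux)|exact: (Ck_onC hg Ux)].
apply: (@Ck_onS _ _ _ (fun i x => f x * 'D_(delta_mx 0 i) g x + g x * 'D_(delta_mx 0 i) f x)) => //.
- by move=> x Ux; apply: for_continuousM; [exact: (Ck_onC hf Ux)|exact: (Ck_onC hg Ux)].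
- move=> i x Ux; have [fd _] := Ck_onSP i hf; have [gd _] := Ck_onSP i hg.
  by have := fd _ Ux; have := gd _ Ux => ? ?; exact: is_deriveM.
- move=> i; have [_ fd] := Ck_onSP i hf; have [_ gd] := Ck_onSP i hg.
  by apply: Ck_onD => //; apply: IH => //; apply: Ck_onW.
Qed.

Lemma Ck_onN k U f : open U -> Ck_on k U f -> Ck_on k U (fun x => - f x).
Proof.
move=> oU hf; apply: (@Ck_on_ext _ _ (fun x => -1 * f x)) => //.
  by move=> x _; rewrite mulN1r.
by apply: Ck_onM => //; exact: Ck_on_cst.
Qed.

Lemma Ck_on_sum k U (I : Type) (r : seq I) (P : pred I) (F : I -> 'rV[R]_n -> R) : open U ->
  (forall i, P i -> Ck_on k U (F i)) -> Ck_on k U (fun x => \sum_(i <- r | P i) F i x).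
Proof.
move=> oU hF; elim: r => [|a r IH].
  by apply: (@Ck_on_ext _ _ (fun=> 0)) (Ck_on_cst _ _ oU) => // x _; rewrite big_nil.
have [Pa|Pa] := boolP (P a); last first.
  by apply: Ck_on_ext IH => // x _; rewrite big_cons (negbTE Pa).
apply: (@Ck_on_ext _ _ (fun x => F a x + \sum_(i <- r | P i) F i x)) => //.
  by move=> x _; rewrite big_cons Pa.
by apply: Ck_onD => //; exact: hF.
Qed.

Lemma Ck_on_prod k U (I : Type) (r : seq I) (P : pred I) (F : I -> 'rV[R]_n -> R) : open U ->
  (forall i, P i -> Ck_on k U (F i)) -> Ck_on k U (fun x => \prod_(i <- r | P i) F i x).
Proof.
move=> oU hF; elim: r => [|a r IH].
  by apply: (@Ck_on_ext _ _ (fun=> 1)) (Ck_on_cst _ _ oU) => // x _; rewrite big_nil.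
have [Pa|Pa] := boolP (P a); last first.
  by apply: Ck_on_ext IH => // x _; rewrite big_cons (negbTE Pa).
apply: (@Ck_on_ext _ _ (fun x => F a x * \prod_(i <- r | P i) F i x)) => //.
  by move=> x _; rewrite big_cons Pa.
by apply: Ck_onM => //; exact: hF.
Qed.

Lemma Ck_onV k U f : open U -> (forall x, U x -> f x != 0) -> Ck_on k U f ->
  Ck_on k U (fun x => (f x)^-1).
Proof.
move=> oU f0; elim: k => [|k IH] hf.
  by apply: Ck_on0 => x Ux; apply: for_continuousV; [exact: f0|exact: (Ck_onC hf Ux)].
apply: (@Ck_onS _ _ _ (fun i x => - ((f x)^-1 * (f x)^-1 * 'D_(delta_mx 0 i) f x))) => //.
- by move=> x Ux; apply: for_continuousV; [exact: f0|exact: (Ck_onC hf Ux)].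
- move=> i x Ux; have [/(_ x Ux) [fd _] _] := Ck_onSP i hf.
  apply: DeriveDef; first by apply: derivableV => //; exact: f0.
  rewrite deriveV //; last exact: f0.
  by rewrite scaleNr /GRing.scale /= -exprVn expr2.
- move=> i; have [_ fd] := Ck_onSP i hf.
  by apply: Ck_onN => //; apply: Ck_onM => //; apply: Ck_onM => //; apply: IH; exact: Ck_onW.
Qed.


Lemma cvg_rV (T : Type) (F : set_system T) {FF : Filter F} (g : T -> 'rV[R]_n) (a : 'rV[R]_n) :
  (forall j, g x 0 j @[x --> F] --> a 0 j) -> g @ F --> a.
Proof.
move=> h; apply/cvgrPdist_le => /= e e0.
near=> x.
rewrite /Num.Def.normr/= mx_normrE (bigmax_le _ (ltW e0))//= => -[i j] _.
rewrite !mxE/= (ord1 i).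
move: j; near: x; apply: filter_forall => /= j.
by move/cvgrPdist_le : (h j) => /(_ _ e0).
Unshelve. all: by end_near. Qed.

Lemma rV_le (x : 'rV[R]_n) (e : R) : 0 <= e -> (forall j, `|x 0 j| <= e) -> `|x| <= e.
Proof.
move=> e0 h; rewrite /Num.Def.normr/= mx_normrE; apply: bigmax_le => // -[i j] _ /=.
by rewrite (ord1 i).
Qed.

Lemma coord_le (x : 'rV[R]_n) j : `|x 0 j| <= `|x|.
Proof.
by rewrite [leRHS]/Num.Def.normr/= mx_normrE; apply: (le_bigmax _ (fun ij => `|x ij.1 ij.2|) (0, j)).
Qed.

Lemma is_derive_line f y v s d : is_derive (y + s *: v) v f d ->
  is_derive (s : R) 1 (fun t => f (y + t *: v)) d.
Proof.
case=> h1 h2; have e : (fun h : R => h^-1 *: (((fun t : R => f (y + t *: v)) \o shift s) (h *: 1) - f (y + s *: v)))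
   = (fun h => h^-1 *: ((f \o shift (y + s *: v)) (h *: v) - f (y + s *: v))).
  apply/funext => h /=; congr (_ *: (f _ - _)).
  by rewrite /shift /= scalerDl [h *: 1]mulr1 addrCA.
by split; [rewrite /derivable e|rewrite /derive e].
Qed.

Lemma line_is_derive f y v d : is_derive (0 : R) 1 (fun t => f (y + t *: v)) d ->
  is_derive y v f d.
Proof.
case=> h1 h2; have e : (fun h : R => h^-1 *: (((fun t : R => f (y + t *: v)) \o shift 0) (h *: 1) - f (y + 0 *: v)))
   = (fun h => h^-1 *: ((f \o shift y) (h *: v) - f y)).
  apply/funext => h /=; rewrite /shift /= scale0r !addr0; congr (_ *: (f _ - _)).
  by rewrite [h *: 1]mulr1 addrC.
by split; [rewrite /derivable -e|rewrite /derive -e].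
Qed.

Lemma MVT_unit (f df : R -> R) : (forall s : R, 0 <= s <= 1 -> is_derive s 1 f (df s)) ->
  exists2 c : R, 0 <= c <= 1 & f 1 - f 0 = df c.
Proof.
move=> h; have [x||c cI] := @MVT_segment R f df 0 1 ler01.
- by rewrite in_itv /= => /andP[x0 x1]; apply: h; rewrite !ltW.
- apply: derivable_within_continuous => x; rewrite in_itv /= => xI.
  by case: (h x xI).
- by rewrite subr0 mulr1 => e; exists c; first by move: cI; rewrite in_itv.
Qed.

Lemma is_derive_scale f y v d (c : R) : is_derive y v f d -> is_derive y (c *: v) f (c * d).
Proof.
move=> h; apply: line_is_derive.
have h0 : is_derive (c * 0 : R) 1 (fun t => f (y + t *: v)) d.
  by apply: is_derive_line; rewrite mulr0 scale0r addr0.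
have h1 : is_derive (0 : R) 1 (fun t : R => c * t) c.
  by apply: is_derive_eq; rewrite [_ *: _]mulr1.
have := is_derive1_comp h0 h1; rewrite mulrC /comp.
by under [X in _ -> is_derive _ _ X _]eq_fun do rewrite scalerA mulrC.
Qed.

(** An increment of [f] is split along the coordinate axes; the mean value theorem on each piece
    turns it into partial derivatives at points tending to [a], where these are continuous. *)
Lemma C1_differentiable U f (df : 'I_n -> 'rV[R]_n -> R) a : open U -> U a ->
  (forall i x, U x -> is_derive x (delta_mx 0 i) f (df i x)) ->
  (forall i, {for a, continuous (df i)}) ->
  differentiable f a /\ forall h, 'd f a h = \sum_i h 0 i * df i a.
Proof.
move=> oU Ua hd hc.
pose L (h : 'rV[R]_n) : R := \sum_i h 0 i * df i a.
have linL : linear L.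
  move=> c x y; rewrite /L scaler_sumr -big_split /=; apply: eq_bigr => i _.
  by rewrite !mxE mulrDl -mulrA.
pose LL : {linear 'rV[R]_n -> R} := HB.pack L (GRing.isLinear.Build _ _ _ _ _ linL).
have cL : continuous LL.
  move=> x; apply: (@Ck_onC 0 setT L _ x I); apply: Ck_on_sum => [|i _]; first exact: openT.
  by apply: Ck_onM; [exact: openT|apply: Ck_on_coord; exact: openT|apply: Ck_on_cst; exact: openT].
have key : f \o shift a = cst (f a) + LL +o_ (0 : 'rV[R]_n) id.
  apply/eqaddoP => _/posnumP[eps].
  (* The [n] pieces each contribute an error of at most [eps / (n + 1)] times the norm of the
     increment; the successor keeps the denominator nonzero for [n = 0]. *)
  have n1 : 0 < eps%:num / n.+1%:R by [].
  have [r /= r0 hr] : exists2 r : R, 0 < r & forall x, `|x| < r ->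
      U (a + x) /\ forall i, `|df i a - df i (a + x)| <= eps%:num / n.+1%:R.
    have : \forall x \near a, U x /\ forall i, `|df i a - df i x| <= eps%:num / n.+1%:R.
      near=> x; split; first by near: x; exact: open_nbhs_nbhs.
      move=> i; move: i; near: x; apply: filter_forall => i.
      by have /cvgrPdist_le/(_ _ n1) := hc i.
    case/nbhs_ballP => r r0 hr; exists r => // x xr; apply: hr.
    by rewrite -ball_normE /= opprD addrA subrr sub0r normrN.
  (* [tr h k] keeps the first [k] coordinates of [h], so consecutive truncations differ along one
     axis and the increments telescope. *)
  pose tr (h : 'rV[R]_n) (k : nat) : 'rV[R]_n := \row_i (if (i < k)%N then h 0 i else 0).
  have trn h : tr h n = h by apply/rowP => i; rewrite !mxE ltn_ord.
  have tr0 h : tr h 0%N = 0 by apply/rowP => i; rewrite !mxE ltn0.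
  have step h (k : 'I_n) : tr h k.+1 = tr h k + h 0 k *: delta_mx 0 k.
    apply/rowP => i; rewrite !mxE eqxx /= ltnS leq_eqVlt.
    have [->|ik] := eqVneq i k; first by rewrite eqxx ltnn add0r mulr1.
    by rewrite -(inj_eq val_inj) /= in ik *; rewrite (negbTE ik) mulr0 addr0.
  near=> h.
  have hlt : `|h| < r.
    by near: h; apply/nbhs_ballP; exists r => // y; rewrite -ball_normE /= sub0r normrN.
  have -> : (f \o shift a - (cst (f a) + LL)) h = \sum_(k < n)
      (f (a + tr h k.+1) - f (a + tr h k) - h 0 k * df k a).
    rewrite sumrB -(big_mkord xpredT (fun k => f (a + tr h k.+1) - f (a + tr h k))).
    rewrite telescope_sumr // trn tr0 addr0 /= /L.
    rewrite -[LHS]/(f (h + a) - (f a + L h)) /L [h + a]addrC.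
    by rewrite opprD addrA.
  apply: (@le_trans _ _ (\sum_(k < n) (eps%:num / n.+1%:R * `|h|))); last first.
    rewrite sumr_const card_ord -[leLHS]mulr_natl mulrA ler_wpM2r //.
    by rewrite mulrCA ler_piMr // ler_pdivrMr // mul1r ler_nat.
  apply: le_trans (ler_norm_sum _ _ _) _; apply: ler_sum => k _.
  pose y := a + tr h k.
  have hy (s : R) : 0 <= s <= 1 -> `|tr h k + s *: (h 0 k *: delta_mx 0 k)| <= `|h|.
    move=> /andP[s0 s1]; apply: rV_le => // j; rewrite !mxE eqxx /=.
    have [->|jk] := eqVneq j k.
      rewrite ltnn add0r mulr1 normrM ger0_norm //.
      by apply: le_trans (coord_le h k); rewrite ler_piMl.
    rewrite mulr0 mulr0 addr0; case: ifP => _; first exact: coord_le.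
    by rewrite normr0.
  have hs (s : R) : 0 <= s <= 1 -> is_derive s 1 (fun t : R => f (y + t *: (h 0 k *: delta_mx 0 k)))
      (h 0 k * df k (y + s *: (h 0 k *: delta_mx 0 k))).
    move=> sI; apply: is_derive_line; apply: is_derive_scale; apply: hd.
    have := hy s sI; rewrite /y -addrA => /le_lt_trans/(_ hlt)/hr; by case.
  have [c cI] := MVT_unit hs.
  rewrite scale1r scale0r addr0 /y step addrA => ->.
  rewrite -mulrBr normrM mulrC ler_pM // ?coord_le //.
  have := hy c cI; rewrite distrC -addrA => /le_lt_trans/(_ hlt)/hr [_]; exact.
have e := diff_unique cL key.
have d : differentiable f a by apply/diff_locallyP; rewrite e.
by split=> // h; rewrite e.
Unshelve. all: by end_near. Qed.


Lemma Ck1_differentiable U f a : open U -> U a -> Ck_on 1 U f -> 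
  differentiable f a /\ forall h, 'd f a h = \sum_i h 0 i * 'D_(delta_mx 0 i) f a.
Proof.
move=> oU Ua hf; apply: (C1_differentiable (df := fun i x => 'D_(delta_mx 0 i) f x) oU Ua).
  by move=> i; apply (Ck_onSP i hf).1.
by move=> i; apply: (Ck_onC (Ck_onSP i hf).2 Ua).
Qed.

Lemma is_derive_curve U f (g : 'I_n -> R -> R) (dg : 'I_n -> R) (t : R) :
  open U -> U (\row_j g j t) -> Ck_on 1 U f ->
  (forall j, is_derive t 1 (g j) (dg j)) ->
  is_derive t 1 (fun s => f (\row_j g j s)) (\sum_j dg j * 'D_(delta_mx 0 j) f (\row_j g j t)).
Proof.
move=> oU Ut hf hg; have [df dE] := Ck1_differentiable oU Ut hf.
pose G (s : R) : 'rV[R]_n := \row_j g j s.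
have dG : derivable G t 1.
  apply/derivable_mxP => i j; rewrite (ord1 i).
  have -> : (fun x : R => G x 0 j) = g j by apply/funext => s; rewrite mxE.
  by case: (hg j).
have dG' : differentiable G t by apply/derivable1_diffP.
have dfG : differentiable (f \o G) t by apply: differentiable_comp.
have e : 'd G t 1 = \row_j dg j.
  rewrite -deriveE // derive_mx //; apply/rowP => j; rewrite !mxE.
  have -> : (fun x : R => G x 0 j) = g j by apply/funext => s; rewrite mxE.
  by case: (hg j).
apply: DeriveDef; first exact/derivable1_diffP.
rewrite deriveE // diff_comp //= e dE; apply: eq_bigr => j _; by rewrite mxE.
Qed.
End Ck.

Lemma continuous_row (T : topologicalType) m (g : 'I_m -> T -> R) (x : T) :
  (forall j, {for x, continuous (g j)}) -> {for x, continuous (fun x => \row_j g j x : 'rV[R]_m)}.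
Proof.
move=> h; rewrite /prop_for /continuous_at; apply: cvg_rV => j.
by under eq_fun do rewrite mxE; rewrite mxE; exact: h.
Qed.

Lemma continuous_comp_row (T : topologicalType) m (g : 'I_m -> T -> R) (f : 'rV[R]_m -> R) (x : T) :
  (forall j, {for x, continuous (g j)}) -> {for \row_j g j x, continuous f} ->
  {for x, continuous (fun x => f (\row_j g j x))}.
Proof. by move=> /continuous_row hg hf; exact: (continuous_comp hg hf). Qed.

Lemma Ck_on_comp k m n (V : set 'rV[R]_m) (U : set 'rV[R]_n) (f : 'rV[R]_m -> R)
    (g : 'I_m -> 'rV[R]_n -> R) : open U -> open V ->
  (forall x, U x -> V (\row_j g j x)) -> Ck_on k V f -> (forall j, Ck_on k U (g j)) ->
  Ck_on k U (fun x => f (\row_j g j x)).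
Proof.
move=> oU oV UV; elim: k f g UV => [|k IH] f g UV hf hg.
  by apply: Ck_on0 => x Ux; apply: (continuous_comp_row (fun j => Ck_onC (hg j) Ux)); exact: (Ck_onC hf (UV _ Ux)).
apply: (@Ck_onS _ _ _ _ (fun i x => \sum_j 'D_(delta_mx 0 i) (g j) x * 'D_(delta_mx 0 j) f (\row_j g j x))) => //.
- by move=> x Ux; apply: (continuous_comp_row (fun j => Ck_onC (hg j) Ux)); exact: (Ck_onC hf (UV _ Ux)).
- move=> i x Ux; apply: line_is_derive.
  have := @is_derive_curve m V f (fun j t => g j (x + t *: delta_mx 0 i))
    (fun j => 'D_(delta_mx 0 i) (g j) x) 0 oV.
  rewrite scale0r addr0; apply; first exact: UV.
    by elim: k {IH hg} hf => // k IH /Ck_onW/IH.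
  move=> j; apply: is_derive_line; rewrite scale0r addr0.
  by apply (Ck_onSP i (hg j)).1.
- move=> i; apply: Ck_on_sum => // j _; apply: Ck_onM => //; first exact: (Ck_onSP i (hg j)).2.
  apply: (IH (fun y => 'D_(delta_mx 0 j) f y)) => //; first exact: (Ck_onSP j hf).2.
  by move=> j'; exact: Ck_onW.
Qed.

End Calculus.

Lemma is_derive_ext (R : numFieldType) (V W : normedModType R) (f g : V -> W) x v d d' :
  is_derive x v f d -> (forall y, f y = g y) -> d = d' -> is_derive x v g d'.
Proof. by move=> h /funext <- <-. Qed.

(** * One real variable: mean value estimates, Gronwall's inequality, primitives *)

Section OneVariable.
Variable R : realType.
Implicit Types (t s : R).

Lemma MVT_itv (f df : R -> R) (a b : R) : a <= b ->
  (forall s : R, a <= s <= b -> is_derive s 1 f (df s)) ->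
  exists2 c : R, a <= c <= b & f b - f a = df c * (b - a).
Proof.
move=> ab h; have [x||c cI e] := @MVT_segment R f df a b ab.
- by rewrite in_itv /= => /andP[x0 x1]; apply: h; rewrite !ltW.
- apply: derivable_within_continuous => x; rewrite in_itv /= => xI.
  by case: (h x xI).
- by exists c => //; move: cI; rewrite in_itv.
Qed.

(** Both [g + w] and [g - w] have nonnegative derivatives on the interval, so their increments are
    nonnegative. *)
Lemma derive_le_cmp (w dw g dg : R -> R) t : 0 <= t ->
  (forall s, 0 <= s <= t -> is_derive s 1 w (dw s)) ->
  (forall s, 0 <= s <= t -> is_derive s 1 g (dg s)) ->
  (forall s, 0 <= s <= t -> `|dw s| <= dg s) -> `|w t - w 0| <= g t - g 0.
Proof.
move=> t0 hw hg h; rewrite ler_norml.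
have [|c cI] := @MVT_itv (fun s => g s + w s) (fun s => dg s + dw s) 0 t t0.
  by move=> s sI; have := hw s sI; have := hg s sI => ? ?; exact: is_deriveD.
have [|d dI] := @MVT_itv (fun s => g s - w s) (fun s => dg s - dw s) 0 t t0.
  by move=> s sI; have := hw s sI; have := hg s sI => ? ?; exact: is_deriveB.
rewrite subr0.
have := h c cI; have := h d dI; rewrite !ler_norml => /andP[h1 h2] /andP[h3 h4] e1 e2.
have : 0 <= (dg c + dw c) * t by rewrite mulr_ge0 //; lra.
have : 0 <= (dg d - dw d) * t by rewrite mulr_ge0 //; lra.
by move: e1 e2; lra.
Qed.

Lemma is_derive_reflect (w : R -> R) t d : is_derive (- t) 1 w d ->
  is_derive t 1 (fun s => w (- s)) (- d).
Proof.
move=> h; have h1 : is_derive t 1 (fun s : R => - s) (-1) by apply: is_derive_eq.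
by have := is_derive1_comp h h1; rewrite mulrN1.
Qed.

Lemma is_derive_mull (c : R) t : is_derive t 1 (fun s : R => c * s) c.
Proof. by apply: is_derive_eq; rewrite [_ *: _]mulr1. Qed.

Lemma derive_le_cst (w dw : R -> R) (C : R) t :
  (forall s, `|s| <= `|t| -> is_derive s 1 w (dw s)) ->
  (forall s, `|s| <= `|t| -> `|dw s| <= C) -> `|w t - w 0| <= C * `|t|.
Proof.
move=> hw h; have [t0|t0] := leP 0 t.
  rewrite (ger0_norm t0) in hw h *.
  have := @derive_le_cmp w dw (fun s => C * s) (fun=> C) t t0.
  rewrite mulr0 subr0; apply => s /andP[s0 st]; [apply: hw|exact: is_derive_mull|apply: h]; by rewrite ger0_norm.
rewrite (ltr0_norm t0) in hw h *.
have t0' : 0 <= - t by rewrite oppr_ge0 ltW.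
have := @derive_le_cmp (fun s => w (- s)) (fun s => - dw (- s)) (fun s => C * s) (fun=> C) (- t) t0'.
rewrite mulr0 subr0 oppr0 opprK; apply => s /andP[s0 st].
- by apply: is_derive_reflect; apply: hw; rewrite normrN ger0_norm.
- exact: is_derive_mull.
- by rewrite normrN; apply: h; rewrite normrN ger0_norm.
Qed.

Lemma derive0_cst (w : R -> R) t : (forall s, `|s| <= `|t| -> is_derive s 1 w 0) -> w t = w 0.
Proof.
move=> h; apply/eqP; rewrite -subr_eq0 -normr_le0 -[X in _ <= X](mul0r `|t|).
by apply: derive_le_cst h _ => s _; rewrite normr0.
Qed.

Lemma is_derive_expR_scale (c : R) t : is_derive t 1 (fun s => expR (c * s)) (c * expR (c * t)).
Proof.
by have := is_derive1_comp (is_derive_expR (c * t)) (is_derive_mull c t); rewrite mulrC.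
Qed.

Lemma gronwall_ge0 (S dS : R -> R) (c e : R) t : 0 <= c -> 0 <= e -> 0 <= t ->
  (forall s, 0 <= s <= t -> is_derive s 1 S (dS s)) ->
  (forall s, 0 <= s <= t -> dS s <= c * S s + e) ->
  S t <= (S 0 + e * t) * expR (c * t).
Proof.
move=> c0 e0 t0 hS h.
(* The derivative of [f] is [(S' - c S) expR (- c s) - e], at most [e (expR (- c s) - 1)], hence
   nonpositive. *)
pose f (s : R) := S s * expR (- c * s) - e * s.
pose df (s : R) := S s * (- c * expR (- c * s)) + expR (- c * s) * dS s - e.
have [|d dI] := @MVT_itv f df 0 t t0.
  move=> s sI; have h1 := hS s sI; have h2 := is_derive_expR_scale (- c) s; have h3 := is_derive_mull e s.
  by have h4 := is_deriveM h1 h2; exact: is_deriveB h4 h3.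
have : df d <= 0.
  have := h d dI; rewrite /df => hd.
  have E0 := expR_ge0 (- c * d).
  have E1 : expR (- c * d) <= 1.
    by rewrite -[X in _ <= X]expR0 ler_expR mulNr oppr_le0 mulr_ge0 //; case/andP: dI.
  have : expR (- c * d) * dS d <= expR (- c * d) * (c * S d + e) by rewrite ler_wpM2l.
  have : e * expR (- c * d) <= e by rewrite ler_piMr.
  by lra.
rewrite /f subr0 mulr0 expR0 mulr1 mulr0 subr0 => d0 e1.
have {d0 e1} : S t * expR (- c * t) - e * t - S 0 <= 0 by rewrite e1 mulr_le0_ge0.
rewrite !subr_le0 lerBlDr => h1.
have := expR_gt0 (c * t) => E0.
have : S t * expR (- c * t) * expR (c * t) <= (S 0 + e * t) * expR (c * t) by rewrite ler_wpM2r // ltW.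
by rewrite -mulrA -expRD mulNr addNr expR0 mulr1.
Qed.

Lemma gronwall (S dS : R -> R) (c e : R) t : 0 <= c -> 0 <= e ->
  (forall s, `|s| <= `|t| -> is_derive s 1 S (dS s)) ->
  (forall s, `|s| <= `|t| -> `|dS s| <= c * S s + e) ->
  S t <= (S 0 + e * `|t|) * expR (c * `|t|).
Proof.
move=> c0 e0 hS h; have [t0|t0] := leP 0 t.
  rewrite (ger0_norm t0) in hS h *.
  apply: gronwall_ge0 => // s /andP[s0 st]; first by apply: hS; rewrite ger0_norm.
  by apply: le_trans (ler_norm _) _; apply: h; rewrite ger0_norm.
rewrite (ltr0_norm t0) in hS h *.
have t0' : 0 <= - t by rewrite oppr_ge0 ltW.
have := @gronwall_ge0 (fun s => S (- s)) (fun s => - dS (- s)) c e (- t) c0 e0 t0'.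
rewrite oppr0 opprK; apply => s /andP[s0 st].
  by apply: is_derive_reflect; apply: hS; rewrite normrN ger0_norm.
apply: le_trans (ler_norm _) _; rewrite normrN; apply: h; by rewrite normrN ger0_norm.
Qed.

Lemma primitive_bounded (f : R -> R) (a : R) : continuous f -> 0 < a ->
  exists F : R -> R, F 0 = 0 /\ forall t, `|t| < a -> is_derive t 1 F (f t).
Proof.
move=> cf a0; pose G x := (\int[lebesgue_measure]_(t in `[- a, x]) f t)%R.
have h t : `|t| < a -> is_derive t 1 G (f t).
  rewrite ltr_norml => /andP[t1 t2].
  have fi : lebesgue_measure.-integrable `[- a, a] (EFin \o f).
    apply: continuous_compact_integrable; first exact: segment_compact.
    exact: continuous_subspaceT.
  have h1 : derivable G t 1 by exact: (continuous_FTC1_closed t2 fi t1 (cf t)).1.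
  have h2 : derive1 G t = f t by exact: (continuous_FTC1_closed t2 fi t1 (cf t)).2.
  by split; [exact: h1|rewrite -derive1E; exact: h2].
exists (fun x => G x - G 0); split; first by rewrite subrr.
move=> t /h ht; have := is_deriveB ht (is_derive_cst (G 0) t 1); by rewrite subr0.
Qed.

(** Primitives normalised at 0 agree on common intervals, so evaluating at [t] the one on radius
    [|t| + 1] defines a primitive on the whole line. *)
Lemma primitive (f : R -> R) : continuous f ->
  exists F : R -> R, F 0 = 0 /\ forall t, is_derive t 1 F (f t).
Proof.
move=> cf; have h (a : R) : exists F : R -> R, 0 < a -> F 0 = 0 /\ forall t, `|t| < a -> is_derive t 1 F (f t).
  have [a0|a0] := ltP 0 a; first by have [F hF] := primitive_bounded cf a0; exists F.
  by exists f.
pose F (a : R) := projT1 (cid (h a)).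
have hF a : 0 < a -> F a 0 = 0 /\ forall t, `|t| < a -> is_derive t 1 (F a) (f t).
  by rewrite /F; case: (cid (h a)).
have e a b t : 0 < a -> a <= b -> `|t| < a -> F a t = F b t.
  move=> a0 ab ta; have b0 := lt_le_trans a0 ab.
  have [Fa0 hFa] := hF a a0; have [Fb0 hFb] := hF b b0.
  apply/eqP; rewrite -subr_eq0; apply/eqP.
  have := @derive0_cst (fun s => F a s - F b s) t; rewrite Fa0 Fb0 subrr; apply => s st.
  have sa := le_lt_trans st ta; have sb := lt_le_trans sa ab.
  by have := is_deriveB (hFa s sa) (hFb s sb); rewrite subrr.
exists (fun t => F (`|t| + 1) t); split; first by rewrite normr0 add0r; apply (hF 1 ltr01).1.
move=> t; have p : 0 < `|t| + 2 by have := normr_ge0 t; lra.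
(* Near [t] the radius varies with the point; all these values are those of the single primitive on
   radius [|t| + 2]. *)
have [_ /(_ t)] := hF (`|t| + 2) p.
rewrite ltrDl ltr0n => /(_ isT); apply: near_eq_is_derive.
near=> s; have st : `|s| < `|t| + 1.
  have : `|s - t| < 1 by near: s; apply: cvgr_distC_lt => //; exact: cvg_id.
  by have := ler_normD (s - t) t; rewrite subrK; lra.
apply/esym/e; first by rewrite ltr_wpDl.
  by lra.
by rewrite ltrDl.
Unshelve. all: by end_near. Qed.

End OneVariable.

(** * Uniform estimates for compactly supported functions *)

Section Support.
Variables (R : realType) (n : nat).
Implicit Types (f g : 'rV[R]_n -> R) (x y h : 'rV[R]_n).

Lemma is_derive_along (U : set 'rV[R]_n) f (g : R -> 'rV[R]_n) (dg : 'I_n -> R) (t : R) :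
  open U -> U (g t) -> Ck_on 1 U f ->
  (forall j, is_derive t 1 (fun s => g s 0 j) (dg j)) ->
  is_derive t 1 (fun s => f (g s)) (\sum_j dg j * 'D_(delta_mx 0 j) f (g t)).
Proof.
move=> oU Ut hf hg.
have e s : (\row_j g s 0 j) = g s by apply/rowP => j; rewrite mxE.
have := @is_derive_curve R n U f (fun j s => g s 0 j) dg t oU; rewrite e => /(_ Ut hf hg).
by under eq_fun do rewrite e.
Qed.

Lemma is_derive_affine f y h (t : R) : Ck_on 1 setT f ->
  is_derive t 1 (fun s => f (y + s *: h)) (\sum_j h 0 j * 'D_(delta_mx 0 j) f (y + t *: h)).
Proof.
move=> hf; apply: (is_derive_along (g := fun s => y + s *: h) openT I hf) => j.
have -> : (fun s : R => (y + s *: h) 0 j) = (fun s => y 0 j + h 0 j * s).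
  by apply/funext => s; rewrite !mxE mulrC.
by have := is_deriveD (is_derive_cst (y 0 j) t 1) (is_derive_mull (h 0 j) t); rewrite add0r.
Qed.

(** Taylor and Gronwall estimates deliver errors of order two in the increment; in this form they
    yield derivatives of integrals and of flows with respect to a parameter. *)
Lemma quad_is_derive (f : R -> R) (d C : R) :
  (forall h : R, `|h| <= 1 -> `|f h - f 0 - h * d| <= C * h ^+ 2) -> is_derive (0 : R) 1 f d.
Proof.
move=> hq; have C0 : 0 <= C.
  by have := hq 1; rewrite normr1 expr1n mulr1 => /(_ (lexx _)); apply: le_trans.
have H : h^-1 *: ((f \o shift 0) (h *: 1) - f 0) @[h --> 0^'] --> d.
  apply/cvgrPdist_le => /= e e0; have e1 : 0 < e / (C + 1) by rewrite divr_gt0 // ltr_wpDl.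
  near=> h; have hn0 : h != 0 by near: h; exact: nbhs_dnbhs_neq.
  have h1 : `|h| <= 1 by near: h; apply: dnbhs0_le.
  have he : `|h| <= e / (C + 1) by near: h; apply: dnbhs0_le.
  rewrite /shift /= [h *: 1]mulr1 addr0.
  have -> : d - h^-1 *: (f h - f 0) = - (h^-1 * (f h - f 0 - h * d)).
    have -> : h^-1 *: (f h - f 0) = h^-1 * (f h - f 0) by [].
    by field.
  rewrite normrN normrM normfV ler_pdivrMl ?normr_gt0 //.
  apply: le_trans (hq h h1) _.
  rewrite -real_normK ?num_real // expr2 mulrC -mulrA ler_wpM2l // .
  have -> : e = (e / (C + 1)) * (C + 1) by rewrite divfK // gt_eqF // ltr_wpDl.
  by apply: ler_pM => //; lra.
by apply: DeriveDef; [apply/cvg_ex; exists d|apply/cvg_lim].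
Unshelve. all: by end_near. Qed.

Definition csupp f := exists r : R, forall x, r < `|x| -> f x = 0.

(** This class is stable under partial derivatives, and its members have global bounds, Lipschitz
    constants and second order Taylor estimates, so that no domain has to be tracked in the
    estimates on flows. *)
Definition ccs f := smooth_on setT f /\ csupp f.

Lemma csupp_bounded f : (forall x, {for x, continuous f}) -> csupp f ->
  exists2 C : R, 0 <= C & forall x, `|f x| <= C.
Proof.
move=> cf [r hr]; pose r' := Num.max r 0.
have r0 : 0 <= r' by rewrite le_max lexx orbT.
pose A := [set x : 'rV[R]_n | `|x| <= r'].
have cA : compact A.
  apply: bounded_closed_compact.
    by exists r'; split; [exact: num_real|move=> M hM x /= /le_trans; apply; rewrite ltW].
  by apply: (@closed_comp _ _ (fun x : 'rV[R]_n => `|x|) [set y | y <= r']); [move=> x _; exact: norm_continuous|exact: closed_le].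
have A0 : A !=set0 by exists 0; rewrite /A /= normr0.
have cn : {within A, continuous (fun x => `|f x|)}.
  by apply: continuous_subspaceT => x; apply: (continuous_comp (cf x)); exact: norm_continuous.
have [c cA' hc] := EVT_max_rV A0 cA cn.
exists `|f c| => // x; have [xr|xr] := leP `|x| r'; first by apply: hc; rewrite inE.
by rewrite hr ?normr0 //; apply: le_lt_trans xr; rewrite le_max lexx.
Qed.

Lemma csupp_derive f v : csupp f -> csupp (fun x => 'D_v f x).
Proof.
move=> [r hr]; exists r => x xr.
rewrite -[RHS](derive_cst (V := 'rV[R]_n) (0 : R) x v); apply: near_eq_derive.
near=> y; apply: hr; near: y.
by apply: (@cvgr_gt _ _ (nbhs x) _ (fun y => `|y|) `|x|) => //; exact: norm_continuous.
Unshelve. all: by end_near. Qed.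

Lemma smooth_onD_ U f i : smooth_on U f -> smooth_on U (fun x => 'D_(delta_mx 0 i) f x).
Proof. by move=> hf k; have := (Ck_onSP i (hf k.+1)).2. Qed.

Lemma ccs_derive f i : ccs f -> ccs (fun x => 'D_(delta_mx 0 i) f x).
Proof. by move=> [hf sf]; split; [exact: smooth_onD_|exact: csupp_derive]. Qed.

Lemma ccs_bounded f : ccs f -> exists2 C : R, 0 <= C & forall x, `|f x| <= C.
Proof.
by move=> [hf sf]; apply: csupp_bounded => // x; apply: (Ck_onC (hf 0%N)).
Qed.

Lemma ccs_lip f : ccs f -> exists2 C : R, 0 <= C & forall x h, `|f (x + h) - f x| <= C * `|h|.
Proof.
move=> hf; have /choice[C hC] : forall i : 'I_n, exists C : R, 0 <= C /\ forall x, `|'D_(delta_mx 0 i) f x| <= C.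
  by move=> i; have [C C0 hC] := ccs_bounded (ccs_derive i hf); exists C.
exists (\sum_i C i); first by apply: sumr_ge0 => i _; case: (hC i).
move=> x h; have := MVT_unit (fun s _ => is_derive_affine x h s (hf.1 1%N)).
rewrite scale1r scale0r addr0 => -[c _ ->].
rewrite mulr_suml; apply: le_trans (ler_norm_sum _ _ _) _; apply: ler_sum => i _.
by rewrite normrM mulrC ler_pM // ?coord_le //; case: (hC i).
Qed.

(** The mean value theorem on the segment leaves differences of first derivatives, which are
    globally Lipschitz. *)
Lemma ccs_taylor f : ccs f -> exists2 C : R, 0 <= C & forall x h,
  `|f (x + h) - f x - \sum_i h 0 i * 'D_(delta_mx 0 i) f x| <= C * `|h| ^+ 2.
Proof.
move=> hf; have /choice[C hC] : forall i : 'I_n, exists C : R, 0 <= C /\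
    forall x h, `|'D_(delta_mx 0 i) f (x + h) - 'D_(delta_mx 0 i) f x| <= C * `|h|.
  by move=> i; have [C C0 hC] := ccs_lip (ccs_derive i hf); exists C.
exists (\sum_i C i); first by apply: sumr_ge0 => i _; case: (hC i).
move=> x h; have := MVT_unit (fun s _ => is_derive_affine x h s (hf.1 1%N)).
rewrite scale1r scale0r addr0 => -[c /andP[c0 c1] ->].
rewrite -sumrB mulr_suml; apply: le_trans (ler_norm_sum _ _ _) _; apply: ler_sum => i _.
have [Ci0 hCi] := hC i.
rewrite -mulrBr normrM mulrC expr2 mulrA ler_pM // ?coord_le //.
apply: le_trans (hCi _ _) _; rewrite ler_wpM2l // normrZ ger0_norm //.
by rewrite ler_piMl.
Qed.

End Support.

(** * Bump functions *)

Section Bump.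
Variables (R : realType).
Implicit Types (t : R).

(** The function t^(-m) e^(-1/t), flat at 0. The exponent is carried along because the family is
    closed under differentiation: the derivative of member [m] combines members [m + 1] and
    [m + 2]. *)
Definition bexp (m : nat) t : R := if 0 < t then t^-1 ^+ m * expR (- t^-1) else 0.

(** From the term of degree [m + 2] of the exponential series at 1/t. The square on the right lets
    [quad_is_derive] give derivative 0 at the origin. *)
Lemma bexp_bound m : exists C : R, forall t, `|bexp m t| <= C * t ^+ 2.
Proof.
exists ((m.+2)`!%:R) => t; rewrite /bexp; case: ifP => t0; last by rewrite normr0 mulr_ge0 // sqr_ge0.
have i0 : 0 < t^-1 by rewrite invr_gt0.
rewrite ger0_norm ?mulr_ge0 ?exprn_ge0 ?expR_ge0 ?(ltW i0) //.
have := expR_ge1Dxn m.+1 (ltW i0) => h.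
have {}h : t^-1 ^+ m.+2 / (m.+2)`!%:R <= expR t^-1 by apply: le_trans h; rewrite lerDr.
have f0 : 0 < (m.+2)`!%:R :> R by rewrite ltr0n fact_gt0.
have E0 := expR_gt0 t^-1.
rewrite expRN ler_pdivrMr //.
have -> : t^-1 ^+ m = (m.+2)`!%:R * t ^+ 2 * (t^-1 ^+ m.+2 / (m.+2)`!%:R).
  by rewrite !exprS; field; rewrite !gt_eqF.
by rewrite ler_wpM2l // mulr_ge0 ?sqr_ge0 // ltW.
Qed.

Lemma bexp_derive m t : is_derive t 1 (bexp m) (- m%:R * bexp m.+1 t + bexp m.+2 t).
Proof.
have [t0|t0|->] := ltgtP t 0.
- rewrite /bexp !ltNge (ltW t0) /= mulr0 addr0.
  apply: near_eq_is_derive (is_derive_cst (0 : R) t (1 : R)).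
  near=> s; have : s < 0 by near: s; exact: lt_nbhsl.
  by move=> s0; rewrite ltNge (ltW s0).
- have tn0 : t != 0 by rewrite gt_eqF.
  apply: (@near_eq_is_derive _ R R (fun s : R => s^-1 ^+ m * expR (- s^-1))).
    by near=> s; rewrite /bexp; have -> : 0 < s by near: s; exact: lt_nbhsr.
  have h1 : is_derive t 1 (fun s : R => s^-1) (- t^-1 ^+ 2).
    apply: DeriveDef; first by apply: derivableV.
    by rewrite deriveV // derive_id [_ *: _]mulr1 exprVn.
  have h2 : is_derive t 1 (fun s : R => s^-1 ^+ m) (m%:R * t^-1 ^+ m.-1 * - t^-1 ^+ 2).
    apply: is_derive_ext (is_deriveX m h1) _ _ => // s.
    by elim: m => // m IH; rewrite !exprS -IH.
  have h3 : is_derive t 1 (fun s => - s^-1) (- - t^-1 ^+ 2) by exact: is_deriveN h1.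
  have h4 := is_derive1_comp (g := fun s : R => - s^-1) (is_derive_expR (- t^-1)) h3.
  apply: is_derive_ext (is_deriveM h2 h4) _ _ => //.
  rewrite /bexp t0 /GRing.scale /=; case: m {h2} => [|m] /=; last by rewrite !exprS; ring.
  by ring.
- have [C hC] := bexp_bound m.
  have -> : - m%:R * bexp m.+1 0 + bexp m.+2 0 = 0 by rewrite /bexp ltxx mulr0 addr0.
  apply: (@quad_is_derive _ _ _ C) => h _.
  have -> : bexp m 0 = 0 by rewrite /bexp ltxx.
  by rewrite mulr0 !subr0.
Unshelve. all: by end_near. Qed.

Lemma bexp_ge0 m t : 0 <= bexp m t.
Proof.
by rewrite /bexp; case: ifP => // t0; rewrite mulr_ge0 ?expR_ge0 // exprn_ge0 // invr_ge0 ltW.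
Qed.

Lemma Ck_on_bexp n k U (g : 'rV[R]_n -> R) m : open U -> Ck_on k U g ->
  Ck_on k U (fun x => bexp m (g x)).
Proof.
move=> oU; have cb x j : U x -> {for x, continuous g} -> {for x, continuous (fun x => bexp j (g x))}.
  move=> Ux cg; apply: (continuous_comp cg).
  apply: differentiable_continuous; apply/derivable1_diffP.
  by case: (bexp_derive j (g x)).
elim: k g m cb => [|k IH] g m cb hg.
  by apply: Ck_on0 => x Ux; apply: cb => //; exact: (Ck_onC hg Ux).
apply: (@Ck_onS _ _ _ _ _ (fun i x => (- m%:R * bexp m.+1 (g x) + bexp m.+2 (g x)) * 'D_(delta_mx 0 i) g x)) => //.
- by move=> x Ux; apply: cb => //; exact: (Ck_onC hg Ux).
- move=> i x Ux; apply: line_is_derive.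
  have h1 : is_derive (0 : R) 1 (fun t => g (x + t *: delta_mx 0 i)) ('D_(delta_mx 0 i) g x).
    by apply: is_derive_line; rewrite scale0r addr0; apply (Ck_onSP i hg).1.
  have := bexp_derive m (g (x + 0 *: delta_mx 0 i)) => h2.
  by have := is_derive1_comp h2 h1; rewrite scale0r addr0.
- move=> i; have [_ hd] := Ck_onSP i hg; have hg' := Ck_onW hg.
  apply: Ck_onM => //; apply: Ck_onD => //; last exact: IH.
  by apply: Ck_onM => //; [exact: Ck_on_cst|exact: IH].
Qed.

(** The quotient p / (p + q) of two flat functions of the squared Euclidean distance [N], the first
    living on [N < r^2], the second on [N > r^2 / 4]. The norm in the statement is the maximum norm,
    and [N] is at most [n] times its square; the factor [2 * n.+1] therefore forces
    [N <= r^2 / 4]. *)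
Lemma bump_exists n (a : 'rV[R]_n) (r : R) : 0 < r -> exists b : 'rV[R]_n -> R,
  [/\ smooth_on setT b, forall x, `|x - a| * (2 * n.+1%:R) <= r -> b x = 1,
      forall x, r <= `|x - a| -> b x = 0 & forall x, 0 <= b x <= 1].
Proof.
move=> r0; pose N (x : 'rV[R]_n) := \sum_i (x 0 i - a 0 i) ^+ 2.
pose p x := bexp 0 (r ^+ 2 - N x); pose q x := bexp 0 (N x - r ^+ 2 / 4).
have p0 x : 0 <= p x by exact: bexp_ge0.
have q0 x : 0 <= q x by exact: bexp_ge0.
have bpos t : 0 < t -> 0 < bexp 0 t by move=> t0; rewrite /bexp t0 expr0 mul1r expR_gt0.
have bneg t : t <= 0 -> bexp 0 t = 0 by rewrite /bexp leNgt => /negbTE ->.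
have r2 : 0 < r ^+ 2 by rewrite exprn_gt0.
have pq x : 0 < p x + q x.
  have [h|h] := ltP (N x) (r ^+ 2); first by rewrite ltr_pwDl // bpos // subr_gt0.
  by rewrite ltr_wpDl // bpos //; lra.
have sN k : Ck_on k setT N.
  apply: Ck_on_sum => [|i _]; first exact: openT.
  have h : Ck_on k setT (fun x : 'rV[R]_n => x 0 i - a 0 i).
    by apply: Ck_onD; [exact: openT|apply: Ck_on_coord; exact: openT|apply: Ck_on_cst; exact: openT].
  by apply: Ck_onM => //; exact: openT.
have sp k : Ck_on k setT p.
  apply: Ck_on_bexp; first exact: openT.
  by apply: Ck_onD; [exact: openT|apply: Ck_on_cst; exact: openT|apply: Ck_onN => //; exact: openT].
have sq k : Ck_on k setT q.
  apply: Ck_on_bexp; first exact: openT.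
  by apply: Ck_onD; [exact: openT| |apply: Ck_on_cst; exact: openT].
exists (fun x => p x * (p x + q x)^-1); split.
- move=> k; apply: Ck_onM => //; first exact: openT.
  by apply: Ck_onV => [|x _|]; [exact: openT|rewrite gt_eqF|apply: Ck_onD => //; exact: openT].
- move=> x hx; have qx : q x = 0.
    apply: bneg; rewrite subr_le0.
    have : N x <= n%:R * `|x - a| ^+ 2.
      have -> : n%:R * `|x - a| ^+ 2 = \sum_(i < n) `|x - a| ^+ 2 by rewrite sumr_const card_ord mulr_natl.
      apply: ler_sum => i _.
      rewrite -real_normK ?num_real // ler_sqr ?nnegrE //.
      by have := coord_le (x - a) i; rewrite !mxE.
    have d0 := normr_ge0 (x - a).
    have : (`|x - a| * (2 * n.+1%:R)) ^+ 2 <= r ^+ 2 by rewrite ler_sqr ?nnegrE ?mulr_ge0 // ltW.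
    have n0 : 0 <= n%:R :> R by [].
    have := mulr_ge0 n0 (sqr_ge0 `|x - a|); have := mulr_ge0 n0 (mulr_ge0 n0 (sqr_ge0 `|x - a|)).
    have := sqr_ge0 `|x - a|.
    by rewrite -natr1 !exprMn; nra.
  by rewrite qx addr0 mulfV // gt_eqF //; have := pq x; rewrite qx addr0.
- move=> x hx; suff -> : p x = 0 by rewrite mul0r.
  apply: bneg; rewrite subr_le0.
  have N0 : 0 <= N x by apply: sumr_ge0 => i _; exact: sqr_ge0.
  rewrite -[N x]sqr_sqrtr // ler_sqr ?nnegrE ?sqrtr_ge0 ?(ltW r0) //.
  apply: le_trans hx _; apply: rV_le => [|j]; first exact: sqrtr_ge0.
  rewrite -sqrtr_sqr ler_sqrt // !mxE /N (bigD1 j) //= lerDl.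
  by apply: sumr_ge0 => i _; exact: sqr_ge0.
- move=> x; rewrite divr_ge0 ?(ltW (pq x)) //=.
  by rewrite ler_pdivrMr // mul1r lerDl.
Qed.
End Bump.

Lemma lip_continuous (R : realType) (V : normedModType R) (f : V -> R) (x : V) (C : R) : 0 <= C -> (forall y, `|f x - f y| <= C * `|x - y|) ->
  {for x, continuous f}.
Proof.
move=> C0 lip; apply/cvgrPdist_le => /= e e0.
have e1 : 0 < e / (C + 1) by rewrite divr_gt0 // ltr_wpDl.
near=> y; apply: le_trans (lip y) _.
have : `|x - y| <= e / (C + 1) by near: y; apply: cvgr_dist_le => //; exact: cvg_id.
move=> h; have -> : e = (C + 1) * (e / (C + 1)) by rewrite mulrC divfK // gt_eqF // ltr_wpDl.
by apply: ler_pM => //; lra.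
Unshelve. all: by end_near. Qed.

(** * Hadamard's lemma and the Poincaré lemma *)

Section Hadamard.
Variables (R : realType) (n : nat).
Implicit Types (f g : 'rV[R]_n -> R) (x y h : 'rV[R]_n).

Definition prim (f : R -> R) : R -> R :=
  xget (fun=> 0) [set F : R -> R | F 0 = 0 /\ forall t : R, is_derive t 1 F (f t)].

Lemma primP (f : R -> R) : continuous f -> prim f 0 = 0 /\ forall t : R, is_derive t 1 (prim f) (f t).
Proof. by move=> /primitive[F hF]; rewrite /prim; case: xgetP => [G -> //|/(_ F)]. Qed.

Lemma prim_unique (f F : R -> R) t : continuous f ->
  (forall s : R, `|s| <= `|t| -> is_derive s 1 F (f s)) -> prim f t = F t - F 0.
Proof.
move=> cf hF; have [p0 hp] := primP cf.
have := @derive0_cst R (fun s => prim f s - F s) t; rewrite p0 => h.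
apply/eqP; rewrite -subr_eq0 opprB addrA -subr_eq0 ?subr0; apply/eqP.
have {}h : prim f t - F t = 0 - F 0.
  apply: h => s /hF hs; by have := is_deriveB (hp s) hs; rewrite subrr.
by move: h; lra.
Qed.

(** The integral over t in [0, 1] of t^m g(x0 + t (x - x0)): the coefficient in Hadamard's lemma and
    in the homotopy operator of the Poincaré lemma. The weight [m] is there because a partial
    derivative raises it by one. *)
Definition hint x0 m g x : R := prim (fun t : R => t ^+ m * g (x0 + t *: (x - x0))) 1.

Lemma continuous_hint x0 m g x : ccs g -> continuous (fun t : R => t ^+ m * g (x0 + t *: (x - x0))).
Proof.
move=> hg t; apply: differentiable_continuous; apply/derivable1_diffP.
have := is_derive_affine x0 (x - x0) t (hg.1 1%N) => h1.
have h2 : derivable (fun s : R => s ^+ m) t 1 by exact: exprn_derivable.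
have h3 : derivable (fun s : R => g (x0 + s *: (x - x0))) t 1 by case: h1.
exact: (derivableM h2 h3).
Qed.
Arguments continuous_hint x0 m {g} x _ _.

(** Differentiation under the integral sign: the Taylor estimate of [g] bounds the integrand of the
    remainder by [C h^2] uniformly on [0, 1], so the integrated error is quadratic as well. *)
Lemma hint_derive x0 m g i x : ccs g ->
  is_derive x (delta_mx 0 i) (hint x0 m g) (hint x0 m.+1 (fun y => 'D_(delta_mx 0 i) g y) x).
Proof.
move=> hg; apply: line_is_derive.
have [C C0 hC] := ccs_taylor hg.
apply: (@quad_is_derive _ _ _ C) => h h1; rewrite scale0r addr0.
pose e := delta_mx 0 i : 'rV[R]_n.
have [p0 hp] := primP (continuous_hint x0 m (x + h *: e) hg).
have [q0 hq] := primP (continuous_hint x0 m x hg).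
have [r0 hr] := primP (continuous_hint x0 m.+1 x (ccs_derive i hg)).
rewrite /hint -/e.
set p := prim _ in p0 hp *; set q := prim _ in q0 hq *; set r := prim _ in r0 hr *.
have hw (s : R) : is_derive s 1 (fun s => p s - q s - h * r s)
    (s ^+ m * (g (x0 + s *: (x + h *: e - x0)) - g (x0 + s *: (x - x0)) - h * s * 'D_e g (x0 + s *: (x - x0)))).
  apply: is_derive_ext (is_deriveB (is_deriveB (hp s) (hq s)) (is_deriveZ h (hr s))) _ _ => //.
  by rewrite /GRing.scale /= exprS -/e; ring.
have := @derive_le_cst R _ _ (C * h ^+ 2) 1 (fun s _ => hw s).
rewrite p0 q0 r0 !(mulr0, subr0, normr1, mulr1); apply => s s1.
rewrite normrM normrX; apply: (@le_trans _ _ (1 * (C * h ^+ 2))); last by rewrite mul1r.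
apply: ler_pM => //; first by rewrite exprn_ile1.
have -> : x0 + s *: (x + h *: e - x0) = x0 + s *: (x - x0) + (s * h) *: e.
  by apply/rowP => k; rewrite !mxE; ring.
have -> : h * s * 'D_e g (x0 + s *: (x - x0)) = \sum_j ((s * h) *: e) 0 j * 'D_(delta_mx 0 j) g (x0 + s *: (x - x0)).
  rewrite (bigD1 i) //= big1 ?addr0; first by rewrite !mxE !eqxx mulr1 [h * s]mulrC.
  by move=> j ji; rewrite !mxE (negbTE ji) andbF mulr0 mul0r.
apply: le_trans (hC _ _) _; rewrite ler_wpM2l //.
rewrite -[h ^+ 2]real_normK ?num_real // ler_sqr ?nnegrE //.
apply: rV_le => // j; rewrite !mxE normrM normrM.
have : `|(((0 : 'I_1) == 0) && (j == i))%:R| <= 1 :> R by case: (_ && _); rewrite ?normr1 ?normr0.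
move=> j1; rewrite -mulrA; have := normr_ge0 h.
have : `|h| * `|(((0 : 'I_1) == 0) && (j == i))%:R| <= `|h| * 1 by rewrite ler_wpM2l.
rewrite mulr1 => h2 h3; apply: le_trans h2.
by rewrite ler_piMl // mulr_ge0.
Qed.

Lemma hint_continuous x0 m g x : ccs g -> {for x, continuous (hint x0 m g)}.
Proof.
move=> hg; have [C C0 hC] := ccs_lip hg.
have lip y : `|hint x0 m g x - hint x0 m g y| <= C * `|x - y|.
  have [q0 hq] := primP (continuous_hint x0 m x hg).
  have [p0 hp] := primP (continuous_hint x0 m y hg).
  rewrite /hint; set p := prim _ in p0 hp *; set q := prim _ in q0 hq *.
  have := @derive_le_cst R (fun s => q s - p s) _ (C * `|x - y|) 1 (fun s _ => is_deriveB (hq s) (hp s)).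
  rewrite /= p0 q0 !(subr0, normr1, mulr1); apply => s s1.
  rewrite -mulrBr normrM normrX; apply: (@le_trans _ _ (1 * (C * `|x - y|))); last by rewrite mul1r.
  apply: ler_pM => //; first by rewrite exprn_ile1.
  have -> : x0 + s *: (x - x0) = x0 + s *: (y - x0) + s *: (x - y).
    by apply/rowP => k; rewrite !mxE; ring.
  apply: le_trans (hC _ _) _; rewrite ler_wpM2l // normrZ.
  by rewrite ler_piMl.
exact: lip_continuous lip.
Qed.

Lemma hint_smooth x0 m g : ccs g -> smooth_on setT (hint x0 m g).
Proof.
move=> hg k; elim: k m g hg => [|k IH] m g hg.
  by apply: Ck_on0 => x _; exact: hint_continuous.
apply: (@Ck_onS _ _ _ _ _ (fun i => hint x0 m.+1 (fun y => 'D_(delta_mx 0 i) g y))) => //.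
- exact: openT.
- by move=> x _; exact: hint_continuous.
- by move=> i x _; exact: hint_derive.
- by move=> i; apply: IH; exact: ccs_derive.
Qed.

(** The derivative of [f] along the segment from [x0] to [x] is integrated. *)
Lemma hadamard x0 f x : ccs f ->
  f x = f x0 + \sum_i (x 0 i - x0 0 i) * hint x0 0 (fun y => 'D_(delta_mx 0 i) f y) x.
Proof.
move=> hf; pose P i := prim (fun t : R => t ^+ 0 * 'D_(delta_mx 0 i) f (x0 + t *: (x - x0))).
have hP i := primP (continuous_hint x0 0 x (ccs_derive i hf)).
have h1 (s : R) : is_derive s 1 (fun t => f (x0 + t *: (x - x0)) - \sum_i (x - x0) 0 i * P i t) 0.
  have hs : is_derive s 1 (\sum_i (fun t => (x - x0) 0 i * P i t))
      (\sum_i (x - x0) 0 i * (s ^+ 0 * 'D_(delta_mx 0 i) f (x0 + s *: (x - x0)))).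
    by apply: is_derive_sum => i; have := is_deriveZ ((x - x0) 0 i) ((hP i).2 s).
  apply: is_derive_ext (is_deriveB (is_derive_affine x0 (x - x0) s (hf.1 1%N)) hs) _ _.
    by move=> t; rewrite fct_sumE.
  by rewrite -sumrB big1 // => i _; rewrite expr0 mul1r subrr.
have := @derive0_cst R _ 1 (fun s _ => h1 s) => /=.
rewrite scale0r scale1r addr0 addrCA subrr addr0 => e.
have {e} : f x = f x0 + \sum_i (x - x0) 0 i * P i 1.
  move/eqP: e; rewrite subr_eq => /eqP ->; congr (_ + _); rewrite big1 ?subr0 // => i _.
  by rewrite /P (hP i).1 mulr0.
by move=> ->; congr (_ + _); apply: eq_bigr => i _; rewrite !mxE.
Qed.

(** The homotopy operator on a ball: [f] integrates the 1-form along the rays from [x0], and these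
    stay in the ball, where the form is closed. *)
Lemma poincare x0 (r : R) (a : 'I_n -> 'rV[R]_n -> R) : (forall i, ccs (a i)) ->
  (forall i j x, `|x - x0| < r -> 'D_(delta_mx 0 j) (a i) x = 'D_(delta_mx 0 i) (a j) x) ->
  exists f, smooth_on setT f /\
    forall j x, `|x - x0| < r -> 'D_(delta_mx 0 j) f x = a j x.
Proof.
move=> ha hc; pose f x := \sum_i (x 0 i - x0 0 i) * hint x0 0 (a i) x.
exists f; split.
  move=> k; apply: Ck_on_sum => [|i _]; first exact: openT.
  apply: Ck_onM; [exact: openT| |exact: hint_smooth].
  by apply: Ck_onD; [exact: openT|apply: Ck_on_coord; exact: openT|apply: Ck_on_cst; exact: openT].
move=> j x xr.
pose df := \sum_i ((x 0 i - x0 0 i) * hint x0 1 (fun y => 'D_(delta_mx 0 j) (a i) y) x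
   + hint x0 0 (a i) x * (delta_mx 0 j : 'rV[R]_n) 0 i).
have hd : is_derive x (delta_mx 0 j) f df.
  have : is_derive x (delta_mx 0 j) (\sum_i (fun x => (x 0 i - x0 0 i) * hint x0 0 (a i) x)) df.
    apply: is_derive_sum => i; apply: is_deriveM; last exact: hint_derive.
    have h0 : is_derive x (delta_mx 0 j) (fun y : 'rV[R]_n => y 0 i) ((delta_mx 0 j : 'rV[R]_n) 0 i).
      apply: line_is_derive.
      have -> : (fun t : R => (x + t *: delta_mx 0 j : 'rV[R]_n) 0 i) = (fun t => x 0 i + (delta_mx 0 j : 'rV[R]_n) 0 i * t).
        by apply/funext => t; rewrite !mxE mulrC.
      by have := is_deriveD (is_derive_cst (x 0 i) (0 : R) 1) (is_derive_mull ((delta_mx 0 j : 'rV[R]_n) 0 i) 0); rewrite add0r.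
    by have := is_deriveB h0 (is_derive_cst (x0 0 i) x (delta_mx 0 j)); rewrite subr0.
  by rewrite fct_sumE.
have -> : 'D_(delta_mx 0 j) f x = df by case: hd.
rewrite /df big_split /= [X in _ + X](bigD1 j) //= [X in _ + (_ + X)]big1 => [|i ij]; last first.
  by rewrite mxE (negbTE ij) andbF mulr0.
rewrite addr0 mxE !eqxx mulr1.
pose P i := prim (fun t : R => t ^+ 1 * 'D_(delta_mx 0 j) (a i) (x0 + t *: (x - x0))).
have hP i := primP (continuous_hint x0 1 x (ccs_derive j (ha i))).
have hQ := primP (continuous_hint x0 0 x (ha j)).
set Q := prim _ in hQ.
(* By closedness the integrand of d_j f is the derivative in t of [t * a j (x0 + t (x - x0))], which
   is 0 at 0 and [a j x] at 1. *)
have h1 (s : R) : `|s| <= `|1| -> is_derive s 1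
    (fun t => (\sum_i (x 0 i - x0 0 i) * P i t) + Q t - t * a j (x0 + t *: (x - x0))) 0.
  rewrite normr1 => s1.
  have hs : is_derive s 1 (\sum_i (fun t => (x 0 i - x0 0 i) * P i t))
      (\sum_i (x 0 i - x0 0 i) * (s ^+ 1 * 'D_(delta_mx 0 j) (a i) (x0 + s *: (x - x0)))).
    by apply: is_derive_sum => i; have := is_deriveZ (x 0 i - x0 0 i) ((hP i).2 s).
  apply: is_derive_ext (is_deriveB (is_deriveD hs (hQ.2 s)) (is_deriveM (is_derive_id s (1 : R)) (is_derive_affine x0 (x - x0) s ((ha j).1 1%N)))) _ _.
    by move=> t; rewrite fct_sumE.
  have -> : \sum_i (x 0 i - x0 0 i) * (s ^+ 1 * 'D_(delta_mx 0 j) (a i) (x0 + s *: (x - x0)))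
      = s * \sum_i (x - x0) 0 i * 'D_(delta_mx 0 i) (a j) (x0 + s *: (x - x0)).
    rewrite mulr_sumr; apply: eq_bigr => i _; rewrite hc; first by rewrite !mxE expr1; ring.
    rewrite [_ + _ - _]addrC addKr normrZ; apply: le_lt_trans xr.
    by rewrite ler_piMl.
  set A := \sum_(i < n) _; set B := a j _.
  by rewrite /GRing.scale /=; ring.
have := @derive0_cst R _ 1 h1 => /=.
have -> : \sum_(i < n) (x 0 i - x0 0 i) * P i 0 = 0 by rewrite big1 // => i _; rewrite /P (hP i).1 mulr0.
rewrite mul0r hQ.1 scale1r mul1r subr0 addr0.
by rewrite [x0 + _]addrC subrK => /eqP; rewrite subr_eq0 => /eqP.
Qed.

End Hadamard.

(** * Flows of vector fields on R^n *)

Section Picard.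
Variable R : realType.

(** Comparison with [C * expR (c * s)] on either side of 0. The exponential weight is what lets the
    Picard iteration converge on the whole line at once. *)
Lemma derive_le_exp (w dw : R -> R) (C c t : R) : 
  (forall s : R, `|s| <= `|t| -> is_derive s 1 w (dw s)) ->
  (forall s : R, `|s| <= `|t| -> `|dw s| <= C * (c * expR (c * `|s|))) ->
  `|w t - w 0| <= C * expR (c * `|t|) - C.
Proof.
move=> hw h.
have hg (s : R) : is_derive s 1 (fun s => C * expR (c * s)) (C * (c * expR (c * s))).
  exact: is_derive_ext (is_deriveZ C (is_derive_expR_scale c s)) _ _.
have [t0|t0] := leP 0 t.
  rewrite (ger0_norm t0) in hw h *.
  have := @derive_le_cmp R w dw _ _ t t0 _ (fun s _ => hg s).
  rewrite mulr0 expR0 mulr1; apply => s /andP[s0 st]; first by apply: hw; rewrite ger0_norm.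
  by have := h s; rewrite ger0_norm // => /(_ st).
rewrite (ltr0_norm t0) in hw h *.
have t0' : 0 <= - t by rewrite oppr_ge0 ltW.
have := @derive_le_cmp R (fun s => w (- s)) (fun s => - dw (- s)) _ _ (- t) t0' _ (fun s _ => hg s).
rewrite mulr0 expR0 mulr1 oppr0 opprK; apply => s /andP[s0 st].
  by apply: is_derive_reflect; apply: hw; rewrite normrN ger0_norm.
by have := h (- s); rewrite !normrN ger0_norm // => /(_ st).
Qed.

Lemma rV_subE n (x y : 'rV[R]_n) j : (x - y) 0 j = x 0 j - y 0 j.
Proof. by rewrite !mxE. Qed.

(** The intervals of radius [2 * D / 2 ^ m] around [a m] are nested; the limit is the supremum of
    their left ends. *)
Lemma half_cauchy (a : nat -> R) (D : R) : (forall m, `|a m.+1 - a m| <= D / 2 ^+ m) ->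
  exists l, forall m, `|l - a m| <= 2 * D / 2 ^+ m.
Proof.
move=> ha; pose b m := a m - 2 * D / 2 ^+ m; pose c m := a m + 2 * D / 2 ^+ m.
have h2 m : 2 * D / 2 ^+ m.+1 = D / 2 ^+ m by rewrite exprS; field; rewrite expf_neq0.
have h3 m : 2 * D / 2 ^+ m = D / 2 ^+ m + D / 2 ^+ m by field; rewrite expf_neq0.
have bS m : b m <= b m.+1 by have := ha m; rewrite /b ler_norml h2 h3 => /andP[]; lra.
have cS m : c m.+1 <= c m by have := ha m; rewrite /c ler_norml h2 h3 => /andP[]; lra.
have bc m : b m <= c m.
  have := le_trans (normr_ge0 _) (ha m); rewrite /b /c -h2 h3 => h; have := h2 m; rewrite !h3; lra.
have bm m k : (m <= k)%N -> b m <= b k.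
  by elim: k => [|k IH]; [rewrite leqn0 => /eqP->|rewrite leq_eqVlt => /orP[/eqP<-//|/IH/le_trans]; apply].
have cm m k : (m <= k)%N -> c k <= c m.
  elim: k => [|k IH]; first by rewrite leqn0 => /eqP->.
  by rewrite leq_eqVlt => /orP[/eqP<-//|/IH]; apply: le_trans.
have bck m k : b m <= c k.
  have [mk|km] := leqP m k; first exact: le_trans (bm _ _ mk) (bc k).
  exact: le_trans (bc m) (cm _ _ (ltnW km)).
exists (sup (range b)) => m; rewrite ler_norml.
have h1 : b m <= sup (range b).
  by apply: ub_le_sup; [exists (c 0%N) => _ [k _ <-]|exists m].
have h4 : sup (range b) <= c m.
  by apply: ge_sup; [exists (b 0%N), 0%N|move=> _ [k _ <-]].
by move: h1 h4; rewrite /b /c; lra.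
Qed.

Lemma le_half_eps (a b c : R) : (forall m : nat, a <= b + c / 2 ^+ m) -> a <= b.
Proof.
move=> h; apply/ler_addgt0Pr => e e0.
have [c0|c0] := leP c 0.
  apply: le_trans (h 0%N) _; rewrite expr0 divr1; lra.
pose m := Num.bound (c / e).
have hm : c / e < m%:R by apply: archi_boundP; rewrite divr_ge0 // ltW.
apply: le_trans (h m) _; rewrite lerD2l.
have h2 : m%:R <= 2 ^+ m :> R by rewrite -natrX ler_nat ltnW // ltn_expl.
have p2 : 0 < 2 ^+ m :> R by rewrite exprn_gt0.
rewrite ler_pdivrMr // mulrC -ler_pdivrMr //; apply: le_trans h2; exact: ltW.
Qed.

Lemma derivable_continuous (f : R -> R) (df : R -> R) : (forall t : R, is_derive t 1 f (df t)) -> continuous f.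
Proof.
move=> h t; apply: differentiable_continuous; apply/derivable1_diffP; by case: (h t).
Qed.

Section Existence.
Variables (n : nat) (V : 'I_n -> 'rV[R]_n -> R) (hV : forall j, ccs (V j)).

Lemma ccs_family_bound : exists2 K, 0 <= K & forall j x, `|V j x| <= K.
Proof.
have /choice[C hC] : forall j, exists C : R, 0 <= C /\ forall x, `|V j x| <= C.
  by move=> j; have [C C0 hC] := ccs_bounded (hV j); exists C.
exists (\sum_j C j); first by apply: sumr_ge0 => j _; case: (hC j).
move=> j x; apply: le_trans ((hC j).2 x) _; rewrite (bigD1 j) //= lerDl.
by apply: sumr_ge0 => i _; case: (hC i).
Qed.

Lemma ccs_family_lip : exists2 L, 0 < L & forall j x y, `|V j x - V j y| <= L * `|x - y|.
Proof.
have /choice[C hC] : forall j, exists C : R, 0 <= C /\ forall x h, `|V j (x + h) - V j x| <= C * `|h|.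
  by move=> j; have [C C0 hC] := ccs_lip (hV j); exists C.
exists (1 + \sum_j C j); first by rewrite ltr_pwDl //; apply: sumr_ge0 => j _; case: (hC j).
move=> j x y; have := (hC j).2 y (x - y); rewrite [y + _]addrC subrK => h.
apply: le_trans h _; rewrite ler_wpM2r // (bigD1 j) //= addrCA lerDl addr_ge0 //.
by apply: sumr_ge0 => i _; case: (hC i).
Qed.

Fixpoint picard (x : 'rV[R]_n) (m : nat) : R -> 'rV[R]_n :=
  if m is m'.+1 then fun t => \row_j (x 0 j + prim (fun s => V j (picard x m' s)) t) else fun=> x.

Lemma continuous_field (g : R -> 'rV[R]_n) j : (forall i, continuous (fun t => g t 0 i)) ->
  continuous (fun t => V j (g t)).
Proof.
move=> hg t; have e s : (\row_i g s 0 i) = g s by apply/rowP => i; rewrite mxE.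
have := @continuous_comp_row R R n (fun i s => g s 0 i) (V j) t (fun i => hg i t).
rewrite e => /(_ (Ck_onC ((hV j).1 0%N) I)).
by have -> : (fun s => V j (\row_i g s 0 i)) = (fun s => V j (g s)) by apply/funext => s; rewrite e.
Qed.

Arguments continuous_field {g} j _ _.

Lemma picard_continuous x m i : continuous (fun t => picard x m t 0 i).
Proof.
elim: m i => [|m IH] i /=; first exact: cst_continuous.
have [_ hp] := primP (continuous_field i IH).
have -> : (fun t => (\row_j (x 0 j + prim (fun s => V j (picard x m s)) t)) 0 i)
  = (fun t => x 0 i + prim (fun s => V i (picard x m s)) t) by apply/funext => t; rewrite mxE.
apply: (@derivable_continuous _ (fun t => V i (picard x m t))) => t.
by apply: is_derive_ext (is_deriveD (is_derive_cst (x 0 i) t 1) (hp t)) _ _ => //; rewrite add0r.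
Qed.

Lemma picardS_derive x m i (t : R) : is_derive t 1 (fun t => picard x m.+1 t 0 i) (V i (picard x m t)).
Proof.
have [_ hp] := primP (continuous_field i (@picard_continuous x m)).
apply: is_derive_ext (is_deriveD (is_derive_cst (x 0 i) t 1) (hp t)) _ _; last by rewrite add0r.
by move=> s; rewrite /= mxE.
Qed.

Lemma picard0 x m : picard x m 0 = x.
Proof.
case: m => [//|m]; apply/rowP => i /=; rewrite mxE.
by have [-> _] := primP (continuous_field i (@picard_continuous x m)); rewrite addr0.
Qed.

Lemma curve_exists (x : 'rV[R]_n) : exists g : R -> 'rV[R]_n, g 0 = x /\
  forall (t : R) j, is_derive t 1 (fun s => g s 0 j) (V j (g t)).
Proof.
have [K K0 hK] := ccs_family_bound; have [L L0 hL] := ccs_family_lip.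
(* [B] is chosen so that the weight [expR (2 * L * |t|)] absorbs the first iteration, of speed at
   most [K]. Integrating a Lipschitz bound with constant [L] against this weight gains a factor 1 /
   2 at each later one. *)
pose u := picard x; pose B := K / (2 * L).
have B0 : 0 <= B by rewrite divr_ge0 // mulr_ge0 // ltW.
have step m t i : `|u m.+1 t 0 i - u m t 0 i| <= B * expR (2 * L * `|t|) / 2 ^+ m.
  elim: m t i => [|m IH] t i.
    have := @derive_le_exp (fun t => u 1%N t 0 i) _ B (2 * L) t (fun s _ => picardS_derive x 0 i s).
    rewrite /u picard0 expr0 divr1 => h; apply: le_trans (h _) _ => [s _|]; last by rewrite lerBlDr lerDl.
    rewrite /B mulrA divfK; last by rewrite gt_eqF // mulr_gt0.
    apply: le_trans (hK _ _) _; rewrite ler_peMr // -[X in X <= _]expR0 ler_expR.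
    by rewrite mulr_ge0 // mulr_ge0 // ltW.
  have := @derive_le_exp (fun t => u m.+2 t 0 i - u m.+1 t 0 i)
     (fun t => V i (u m.+1 t) - V i (u m t)) (B / 2 ^+ m.+1) (2 * L) t _ _.
  rewrite /u !picard0 !subrr subr0 => h; apply: le_trans (h _ _) _.
  - by move=> s _; exact: is_deriveB (picardS_derive x m.+1 i s) (picardS_derive x m i s).
  - move=> s _; apply: le_trans (hL _ _ _) _.
    have -> : B / 2 ^+ m.+1 * (2 * L * expR (2 * L * `|s|)) = L * (B * expR (2 * L * `|s|) / 2 ^+ m).
      by rewrite exprS; field; rewrite expf_neq0.
    rewrite ler_wpM2l ?(ltW L0) //; apply: rV_le => [|j].
      by apply: divr_ge0; [exact: mulr_ge0 B0 (expR_ge0 _)|rewrite exprn_ge0].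
    by rewrite rV_subE; exact: IH.
  - rewrite mulrAC lerBlDr lerDl; by rewrite divr_ge0 // exprn_ge0.
pose E (t : R) := B * expR (2 * L * `|t|).
have /choice[G hG] : forall tj : R * 'I_n, exists l, forall m, `|l - u m tj.1 0 tj.2| <= 2 * E tj.1 / 2 ^+ m.
  by move=> [t j]; apply: half_cauchy => m; exact: step.
pose g t : 'rV[R]_n := \row_j G (t, j).
have hg t m : `|g t - u m t| <= 2 * E t / 2 ^+ m.
  apply: rV_le => [|j]; last by rewrite rV_subE mxE; exact: hG (t, j) m.
  by apply: divr_ge0; [apply: mulr_ge0 => //; exact: mulr_ge0 B0 (expR_ge0 _)|rewrite exprn_ge0].
(* All iterates have Lipschitz constant [K], so their pointwise limit is continuous and the integral
   equation can be formed with it. *)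
have ulip m s t j : `|u m t 0 j - u m s 0 j| <= K * `|t - s|.
  case: m => [|m]; first by rewrite subrr normr0 mulr_ge0.
  wlog st : s t / s <= t => [hw|].
    have [|/ltW] := leP s t; first exact: hw.
    by rewrite distrC [`|t - s|]distrC; exact: hw.
  have [c _ ->] := MVT_itv st (fun r _ => picardS_derive x m j r).
  by rewrite normrM ler_wpM2r.
have glip s t j : `|g t 0 j - g s 0 j| <= K * `|t - s|.
  apply: (@le_half_eps _ _ (2 * E t + 2 * E s)) => m.
  have h1 := le_trans (coord_le _ j) (hg t m); have h2 := le_trans (coord_le _ j) (hg s m).
  have h3 := ulip m s t j; rewrite mulrDl.
  move: h1 h2 h3; rewrite !rV_subE; set a := 2 * E t / _; set b := 2 * E s / _.
  rewrite !ler_norml => /andP[? ?] /andP[? ?] /andP[? ?]; lra.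
have gc j : continuous (fun t => g t 0 j).
  by move=> t; apply: (@lip_continuous _ _ _ _ K K0) => s; exact: glip.
pose psi t : 'rV[R]_n := \row_j (x 0 j + prim (fun s => V j (g s)) t).
have hpsi (t : R) j : is_derive t 1 (fun t => psi t 0 j) (V j (g t)).
  have [_ hp] := primP (continuous_field j gc).
  apply: is_derive_ext (is_deriveD (is_derive_cst (x 0 j) t 1) (hp t)) _ _; last by rewrite add0r.
  by move=> s; rewrite /psi mxE.
have psi0 : psi 0 = x.
  apply/rowP => j; rewrite mxE; have [-> _] := primP (continuous_field j gc); by rewrite addr0.
(* Both sides are limits of the iterates: [u m.+1] is built from [u m] as [psi] is from [g]. *)
have e t : g t = psi t.
  apply/rowP => j; apply/eqP; rewrite -subr_eq0 -normr_le0.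
  apply: (@le_half_eps _ _ (2 * E t)) => m; rewrite add0r.
  have := @derive_le_exp (fun t => u m.+1 t 0 j - psi t 0 j)
     (fun t => V j (u m t) - V j (g t)) (B / 2 ^+ m) (2 * L) t _ _.
  rewrite /u psi0 !picard0 !subrr subr0 => h.
  have {}h : `|u m.+1 t 0 j - psi t 0 j| <= E t / 2 ^+ m.
    apply: le_trans (h _ _) _.
    - by move=> s _; exact: is_deriveB (picardS_derive x m j s) (hpsi s j).
    - move=> s _; apply: le_trans (hL _ _ _) _; rewrite distrC.
      have -> : B / 2 ^+ m * (2 * L * expR (2 * L * `|s|)) = L * (2 * E s / 2 ^+ m).
        by rewrite /E; field; rewrite expf_neq0.
      by rewrite ler_wpM2l ?(ltW L0).
    - by rewrite mulrAC lerBlDr lerDl divr_ge0 // exprn_ge0.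
  have h1 := le_trans (coord_le _ j) (hg t m.+1).
  have h4 : 2 * E t / 2 ^+ m.+1 = E t / 2 ^+ m by rewrite exprS; field; rewrite expf_neq0.
  have h5 : 2 * E t / 2 ^+ m = E t / 2 ^+ m + E t / 2 ^+ m by field; rewrite expf_neq0.
  rewrite h4 rV_subE in h1; move: h h1; rewrite h5 !ler_norml => /andP[? ?] /andP[? ?]; lra.
exists psi; split=> // t j; rewrite -e; exact: hpsi.
Qed.

End Existence.
End Picard.

(** * Smooth dependence of flows on the initial point *)

Section SmoothFlow.
Variable R : realType.

Definition nsq n (x : 'rV[R]_n) : R := \sum_j x 0 j ^+ 2.

Lemma nsq_ge0 n (x : 'rV[R]_n) : 0 <= nsq x.
Proof. by apply: sumr_ge0 => i _; exact: sqr_ge0. Qed.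

Lemma norm_le_nsq n (x : 'rV[R]_n) : `|x| ^+ 2 <= nsq x.
Proof.
rewrite -[leRHS]sqr_sqrtr ?nsq_ge0 // ler_sqr ?nnegrE ?sqrtr_ge0 //.
apply: rV_le => [|j]; first exact: sqrtr_ge0.
rewrite -sqrtr_sqr ler_sqrt ?nsq_ge0 // /nsq (bigD1 j) //= lerDl.
by apply: sumr_ge0 => i _; exact: sqr_ge0.
Qed.

Lemma nsq_le_norm n (x : 'rV[R]_n) : nsq x <= n%:R * `|x| ^+ 2.
Proof.
have -> : n%:R * `|x| ^+ 2 = \sum_(i < n) `|x| ^+ 2 by rewrite sumr_const card_ord mulr_natl.
apply: ler_sum => i _; rewrite -real_normK ?num_real // ler_sqr ?nnegrE //; exact: coord_le.
Qed.

(** The maximum norm is not differentiable, so Gronwall's inequality is run on the sum of squares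
    [nsq]. By 2ab <= a^2 + b^2 each term of its derivative is at most [u_j^2 + 2 L^2 |u|^2 + 2 e^2];
    summing over [j] brings the factor [n]. *)
Lemma norm_gronwall n (u : R -> 'rV[R]_n) (w : 'I_n -> R -> R) (L e t : R) :
  0 <= L -> 0 <= e ->
  (forall (s : R) j, `|s| <= `|t| -> is_derive s 1 (fun r => u r 0 j) (w j s)) ->
  (forall (s : R) j, `|s| <= `|t| -> `|w j s| <= L * `|u s| + e) ->
  nsq (u t) <= (nsq (u 0) + 2 * n%:R * e ^+ 2 * `|t|) * expR ((1 + 2 * n%:R * L ^+ 2) * `|t|).
Proof.
move=> L0 e0 hu hw.
apply: (@gronwall R (fun s => nsq (u s)) (fun s => \sum_j (2 * u s 0 j * w j s))).
- by have := sqr_ge0 L; have : 0 <= n%:R :> R by []; move=> h1 h2; have := mulr_ge0 h1 h2; lra.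
- by rewrite mulr_ge0 ?sqr_ge0 // mulr_ge0.
- move=> s st.
  have : is_derive s 1 (\sum_j (fun r => u r 0 j * u r 0 j)) (\sum_j (2 * u s 0 j * w j s)).
    apply: is_derive_sum => j; apply: is_derive_ext (is_deriveM (hu s j st) (hu s j st)) _ _ => //.
    by rewrite /GRing.scale /=; ring.
  by rewrite fct_sumE.
- move=> s st; apply: le_trans (ler_norm_sum _ _ _) _.
  apply: (@le_trans _ _ (\sum_j (u s 0 j ^+ 2 + 2 * L ^+ 2 * `|u s| ^+ 2 + 2 * e ^+ 2))).
    apply: ler_sum => j _; have := hw s j st.
    have h1 : 0 <= (`|u s 0 j| - `|w j s|) ^+ 2 by exact: sqr_ge0.
    have h2 : 0 <= (L * `|u s| - e) ^+ 2 by exact: sqr_ge0.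
    rewrite -[u s 0 j ^+ 2]real_normK ?num_real // normrM normrM [`|2|]ger0_norm // => h3.
    have h4 : `|w j s| ^+ 2 <= (L * `|u s| + e) ^+ 2.
      by rewrite ler_sqr ?nnegrE // addr_ge0 // mulr_ge0.
    rewrite sqrrB sqrrD in h1 h2 h4; rewrite exprMn in h2 h4; lra.
  rewrite !big_split /= !sumr_const card_ord -/(nsq (u s)).
  have e2 (b : R) : b *+ n = n%:R * b by rewrite mulr_natl.
  rewrite (e2 (2 * L ^+ 2 * _)) (e2 (2 * e ^+ 2)).
  have := norm_le_nsq (u s) => h.
  have : (2 * n%:R * L ^+ 2) * `|u s| ^+ 2 <= (2 * n%:R * L ^+ 2) * nsq (u s).
    by rewrite ler_wpM2l // mulr_ge0 ?sqr_ge0 // mulr_ge0.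
  by lra.
Qed.

Definition is_rflow n (V : 'I_n -> 'rV[R]_n -> R) (phi : R -> 'rV[R]_n -> 'rV[R]_n) : Prop :=
  (forall x, phi 0 x = x) /\
  (forall x (t : R) j, is_derive t 1 (fun s => phi s x 0 j) (V j (phi t x))).

Section OneFlow.
Variables (n : nat) (V : 'I_n -> 'rV[R]_n -> R) (hV : forall j, ccs (V j)).

Lemma rflow_exists : exists phi, is_rflow V phi.
Proof.
have /choice[g hg] := curve_exists hV.
by exists (fun t x => g x t); split=> [x|x]; case: (hg x).
Qed.

Lemma rcurve_unique (g h : R -> 'rV[R]_n) (t : R) : g 0 = h 0 ->
  (forall (s : R) j, `|s| <= `|t| -> is_derive s 1 (fun r => g r 0 j) (V j (g s))) ->
  (forall (s : R) j, `|s| <= `|t| -> is_derive s 1 (fun r => h r 0 j) (V j (h s))) ->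
  g t = h t.
Proof.
move=> e0 hg hh; have [L L0 hL] := ccs_family_lip hV.
have := @norm_gronwall n (fun s => g s - h s) (fun j s => V j (g s) - V j (h s)) L 0 t (ltW L0) (lexx _).
rewrite e0 subrr => H.
have {}H : nsq (g t - h t) <= 0.
  apply: le_trans (H _ _) _.
  - move=> s j st; apply: is_derive_ext (is_deriveB (hg s j st) (hh s j st)) _ _ => // r.
    by rewrite rV_subE.
  - by move=> s j st; rewrite addr0; exact: hL.
  - by rewrite /nsq big1 ?expr0n ?mulr0 ?mul0r ?add0r ?mul0r // => j _; rewrite mxE expr0n.
apply/eqP; rewrite -subr_eq0 -normr_eq0 -sqrf_eq0 eq_le sqr_ge0 andbT.
exact: le_trans (norm_le_nsq _) H.
Qed.

Variables (phi : R -> 'rV[R]_n -> 'rV[R]_n) (hphi : is_rflow V phi).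

Lemma rflow_lip (a : R) : 0 <= a -> exists2 C, 0 <= C & forall (s : R) x y, `|s| <= a ->
  `|phi s x - phi s y| <= C * `|x - y|.
Proof.
move=> a0; have [L L0 hL] := ccs_family_lip hV.
pose c := 1 + 2 * n%:R * L ^+ 2.
have c0 : 0 <= c by rewrite addr_ge0 // mulr_ge0 ?sqr_ge0 // mulr_ge0.
pose K := n%:R * expR (c * a).
have K0 : 0 <= K by rewrite mulr_ge0 // expR_ge0.
exists (Num.sqrt K); first exact: sqrtr_ge0.
move=> s x y sa.
have H := @norm_gronwall n (fun s => phi s x - phi s y) (fun j s => V j (phi s x) - V j (phi s y)) L 0 s (ltW L0) (lexx _).
rewrite -(@ler_pXn2r _ 2) ?nnegrE ?mulr_ge0 ?sqrtr_ge0 //.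
apply: le_trans (norm_le_nsq _) _; apply: le_trans (H _ _) _.
- move=> r j rs; apply: is_derive_ext (is_deriveB (hphi.2 x r j) (hphi.2 y r j)) _ _ => // q.
  by rewrite rV_subE.
- by move=> r j rs; rewrite addr0; exact: hL.
- have -> : (Num.sqrt K * `|x - y|) ^+ 2 = n%:R * `|x - y| ^+ 2 * expR (c * a) by rewrite exprMn sqr_sqrtr // /K; ring.
  rewrite !hphi.1 expr0n mulr0 mul0r addr0 -/c.
  apply: ler_pM; [exact: nsq_ge0|exact: expR_ge0|exact: nsq_le_norm|].
  by rewrite ler_expR ler_wpM2l.
Qed.

Lemma rflow_bound : exists2 K, 0 <= K & forall t x, `|phi t x - x| <= K * `|t|.
Proof.
have [K K0 hK] := ccs_family_bound hV; exists K => // t x.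
apply: rV_le => [|j]; first by rewrite mulr_ge0.
rewrite rV_subE -{2}(hphi.1 x).
apply: (@derive_le_cst R (fun s => phi s x 0 j) (fun s => V j (phi s x))) => s _; [exact: hphi.2|exact: hK].
Qed.

Lemma rflow_continuous (t : R) j x : {for x, continuous (fun x => phi t x 0 j)}.
Proof.
have [C C0 hC] := rflow_lip (normr_ge0 t).
apply: (@lip_continuous _ _ _ _ C C0) => y.
by apply: le_trans (hC t x y (lexx _)); rewrite -rV_subE; exact: coord_le.
Qed.

(** The curve [y] solves the variational equation along the orbit of [x]. The defect between the
    increment of the flow and [h y] starts at 0 and satisfies the same linear equation up to a
    Taylor error of order [h^2], so Gronwall keeps it of that order. *)
Lemma rflow_derive x (v : 'rV[R]_n) (y : R -> 'rV[R]_n) (t : R) j : y 0 = v ->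
  (forall (s : R) j, `|s| <= `|t| -> is_derive s 1 (fun r => y r 0 j)
     (\sum_i y s 0 i * 'D_(delta_mx 0 i) (V j) (phi s x))) ->
  is_derive x v (fun x => phi t x 0 j) (y t 0 j).
Proof.
move=> y0 hy; have [C C0 hC] := rflow_lip (normr_ge0 t).
have /choice[T hT] : forall j, exists C : R, 0 <= C /\ forall x h,
    `|V j (x + h) - V j x - \sum_i h 0 i * 'D_(delta_mx 0 i) (V j) x| <= C * `|h| ^+ 2.
  by move=> i; have [c c0 hc] := ccs_taylor (hV i); exists c.
have /choice[B hB] : forall ij : 'I_n * 'I_n, exists C : R, 0 <= C /\ forall x, `|'D_(delta_mx 0 ij.2) (V ij.1) x| <= C.
  by move=> [i k]; have [c c0 hc] := ccs_bounded (ccs_derive k (hV i)); exists c.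
pose TT := \sum_i T i; pose BB := \sum_i \sum_k B (i, k).
have TT0 : 0 <= TT by apply: sumr_ge0 => i _; case: (hT i).
have BB0 : 0 <= BB by apply: sumr_ge0 => i _; apply: sumr_ge0 => k _; case: (hB (i, k)).
have leT i : T i <= TT.
  by rewrite /TT (bigD1 i) //= lerDl; apply: sumr_ge0 => k _; case: (hT k).
have leB i : \sum_k B (i, k) <= BB.
  rewrite /BB [leRHS](bigD1 i) //= lerDl.
  by apply: sumr_ge0 => k _; apply: sumr_ge0 => l _; case: (hB (k, l)).
(* The bound of [norm_gronwall] with linear constant [BB] and error [TT * (C |v|)^2], the factor
   [h^2] being taken out; [C] controls the distance between the two orbits. *)
pose K := Num.sqrt ((2 * n%:R * (TT * (C * `|v|) ^+ 2) ^+ 2 * `|t|) * expR ((1 + 2 * n%:R * BB ^+ 2) * `|t|)).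
apply: line_is_derive; apply: (@quad_is_derive _ _ _ K) => h h1.
rewrite scale0r addr0.
pose u s := phi s (x + h *: v) - phi s x - h *: y s.
pose e := TT * (C * `|h *: v|) ^+ 2.
have e0 : 0 <= e by rewrite mulr_ge0 // sqr_ge0.
have uE s i : u s 0 i = phi s (x + h *: v) 0 i - phi s x 0 i - h * y s 0 i by rewrite !mxE.
have := @norm_gronwall n u (fun i s => V i (phi s (x + h *: v)) - V i (phi s x)
   - h * \sum_k y s 0 k * 'D_(delta_mx 0 k) (V i) (phi s x)) BB e t BB0 e0.
have -> : u 0 = 0 by rewrite /u !hphi.1 y0 [x + _]addrC addrK subrr.
have -> : nsq 0 = 0 :> R by move=> m; rewrite /nsq big1 // => i _; rewrite mxE expr0n.
rewrite add0r => H.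
have -> : phi t (x + h *: v) 0 j - phi t x 0 j - h * y t 0 j = u t 0 j by rewrite uE.
apply: le_trans (coord_le _ _) _.
have K2 : 0 <= (2 * n%:R * (TT * (C * `|v|) ^+ 2) ^+ 2 * `|t|) * expR ((1 + 2 * n%:R * BB ^+ 2) * `|t|).
  by rewrite mulr_ge0 ?expR_ge0 // mulr_ge0 // mulr_ge0 ?sqr_ge0 // mulr_ge0.
have Kh : 0 <= K * h ^+ 2 by apply: mulr_ge0; [exact: sqrtr_ge0|exact: sqr_ge0].
rewrite -(@ler_pXn2r _ 2) ?nnegrE //.
apply: le_trans (norm_le_nsq _) _; apply: le_trans (H _ _) _.
- move=> s i st.
  apply: is_derive_ext (is_deriveB (is_deriveB (hphi.2 (x + h *: v) s i) (hphi.2 x s i)) (is_deriveZ h (hy s i st))) _ _ => //.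
- move=> s i st.
  have -> : V i (phi s (x + h *: v)) - V i (phi s x) - h * (\sum_k y s 0 k * 'D_(delta_mx 0 k) (V i) (phi s x))
     = (V i (phi s x + (phi s (x + h *: v) - phi s x)) - V i (phi s x)
        - \sum_k (phi s (x + h *: v) - phi s x) 0 k * 'D_(delta_mx 0 k) (V i) (phi s x))
      + \sum_k u s 0 k * 'D_(delta_mx 0 k) (V i) (phi s x).
    have -> : \sum_k u s 0 k * 'D_(delta_mx 0 k) (V i) (phi s x)
        = \sum_k (phi s (x + h *: v) - phi s x) 0 k * 'D_(delta_mx 0 k) (V i) (phi s x)
          - h * \sum_k y s 0 k * 'D_(delta_mx 0 k) (V i) (phi s x).
      by rewrite mulr_sumr -sumrB; apply: eq_bigr => k _; rewrite uE rV_subE; ring.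
    by rewrite [phi s x + _]addrC subrK; ring.
  apply: le_trans (ler_normD _ _) _; rewrite addrC lerD //.
    apply: le_trans (ler_norm_sum _ _ _) _.
    apply: (@le_trans _ _ ((\sum_k B (i, k)) * `|u s|)); last by rewrite ler_wpM2r.
    rewrite mulr_suml; apply: ler_sum => k _; rewrite normrM mulrC.
    by apply: ler_pM => //; [case: (hB (i, k))|exact: coord_le].
  apply: le_trans ((hT i).2 _ _) _; rewrite /e.
  apply: ler_pM; [by case: (hT i)|exact: sqr_ge0|exact: leT|].
  rewrite ler_pXn2r ?nnegrE ?mulr_ge0 //.
  by have := hC s (x + h *: v) x st; rewrite [x + _]addrC addrK.
- rewrite [leRHS]exprMn /K sqr_sqrtr // /e normrZ.
  have -> : (h ^+ 2) ^+ 2 = `|h| ^+ 4 by rewrite -[h ^+ 2]real_normK ?num_real // -exprM.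
  rewrite le_eqVlt; apply/orP; left; apply/eqP; ring.
Qed.

End OneFlow.

Section Variation.
Variables (n : nat).
Let pl (z : 'rV[R]_(n + n)) : 'rV[R]_n := \row_i z 0 (lshift n i).
Let pr (z : 'rV[R]_(n + n)) : 'rV[R]_n := \row_i z 0 (rshift n i).

(* The vector field (V, DV) on the tangent bundle, multiplied by a cut-off
   function which is 1 on all the orbits under consideration. *)
Lemma variational_field (V : 'I_n -> 'rV[R]_n -> R) (r0 a : R) : (forall j, ccs (V j)) ->
  0 <= r0 -> 0 <= a ->
  exists W : 'I_(n + n) -> 'rV[R]_(n + n) -> R, (forall k, ccs (W k)) /\
    forall th, is_rflow W th -> forall x v : 'rV[R]_n, `|x| <= r0 -> `|v| <= 1 ->
    forall (s : R) j, `|s| <= a ->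
      is_derive s 1 (fun r => th r (row_mx x v) 0 (lshift n j)) (V j (pl (th s (row_mx x v)))) /\
      is_derive s 1 (fun r => th r (row_mx x v) 0 (rshift n j))
        (\sum_i pr (th s (row_mx x v)) 0 i * 'D_(delta_mx 0 i) (V j) (pl (th s (row_mx x v)))).
Proof.
move=> hV r00 a0; have [K K0 hK] := ccs_family_bound hV.
have /choice[B hB] : forall ij : 'I_n * 'I_n, exists C : R, 0 <= C /\ forall x, `|'D_(delta_mx 0 ij.2) (V ij.1) x| <= C.
  by move=> [i k]; have [c c0 hc] := ccs_bounded (ccs_derive k (hV i)); exists c.
pose BB := \sum_i \sum_k B (i, k).
have BB0 : 0 <= BB by apply: sumr_ge0 => i _; apply: sumr_ge0 => k _; case: (hB (i, k)).
have leB i : \sum_k B (i, k) <= BB.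
  rewrite /BB [leRHS](bigD1 i) //= lerDl.
  by apply: sumr_ge0 => k _; apply: sumr_ge0 => l _; case: (hB (k, l)).
pose c := 1 + 2 * n%:R * BB ^+ 2.
have c0 : 0 <= c by rewrite addr_ge0 // mulr_ge0 ?sqr_ge0 // mulr_ge0.
(* Up to time [a] the base point travels at most [K * a], and by Gronwall the tangent part stays
   below the square root; the added 1 makes [rho] positive. *)
pose rho := (r0 + K * a) + (Num.sqrt (n%:R * expR (c * a)) + 1).
have rho1 : r0 + K * a <= rho by rewrite /rho lerDl addr_ge0 // sqrtr_ge0.
have rho2 : Num.sqrt (n%:R * expR (c * a)) <= rho.
  by rewrite /rho; have := mulr_ge0 K0 a0; lra.
have rho0 : 0 < rho.
  by rewrite /rho; have := mulr_ge0 K0 a0; have := sqrtr_ge0 (n%:R * expR (c * a)); lra.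
(* [bump_exists] gives the value 1 only on a ball smaller by the factor [2 * (n + n).+1], hence the
   enlarged radius. *)
have rr0 : 0 < rho * (2 * (n + n).+1%:R) by rewrite mulr_gt0.
have [chi [schi chi1 chi0 chiI]] := bump_exists (0 : 'rV[R]_(n + n)) rr0.
pose W0 (k : 'I_(n + n)) (z : 'rV[R]_(n + n)) : R :=
  match fintype.split k with
  | inl j => V j (pl z)
  | inr j => \sum_(i < n) z 0 (rshift n i) * 'D_(delta_mx 0 i) (V j) (pl z) end.
pose W k z := chi z * W0 k z.
have oT : open [set: 'rV[R]_(n + n)] by exact: openT.
have spl f k : smooth_on setT f -> Ck_on k setT (fun z => f (pl z)).
  move=> hf; apply: (@Ck_on_comp R k n (n + n) setT setT f (fun i z => z 0 (lshift n i)) oT openT) => //.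
  by move=> i; exact: Ck_on_coord.
exists W; split.
  move=> k; split.
    move=> l; apply: (Ck_onM oT (schi l)).
    rewrite /W0; case: (fintype.split k) => j; first by apply: spl; exact: (hV j).1.
    apply: Ck_on_sum => // i _; apply: Ck_onM => //; first exact: Ck_on_coord.
    by apply: (spl (fun x => 'D_(delta_mx 0 i) (V j) x)); exact: (ccs_derive i (hV j)).1.
  exists (rho * (2 * (n + n).+1%:R)) => z hz; rewrite /W chi0 ?mul0r //.
  by rewrite subr0; exact: ltW.
move=> th hT x v xr v1 s j sa.
set z := fun r => th r (row_mx x v).
have z0 : z 0 = row_mx x v by rewrite /z hT.1.
have split_l i : fintype.split (lshift n i) = inl i by rewrite -(unsplitK (inl i)).
have split_r i : fintype.split (rshift n i) = inr i by rewrite -(unsplitK (inr i)).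
have dl (r : R) i : is_derive r 1 (fun r => z r 0 (lshift n i)) (chi (z r) * V i (pl (z r))).
  by have := hT.2 (row_mx x v) r (lshift n i); rewrite /W /W0 split_l.
have dr (r : R) i : is_derive r 1 (fun r => z r 0 (rshift n i))
    (chi (z r) * (\sum_k pr (z r) 0 k * 'D_(delta_mx 0 k) (V i) (pl (z r)))).
  have := hT.2 (row_mx x v) r (rshift n i); rewrite /W /W0 split_r.
  have -> : \sum_k pr (z r) 0 k * 'D_(delta_mx 0 k) (V i) (pl (z r))
     = \sum_(k < n) z r 0 (rshift n k) * 'D_(delta_mx 0 k) (V i) (pl (z r)) by apply: eq_bigr => k _; rewrite mxE.
  by [].
have chile w : `|chi w| <= 1 by have /andP[h1 h2] := chiI w; rewrite ger0_norm.
have hl r i : `|r| <= a -> `|z r 0 (lshift n i)| <= rho.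
  move=> ra; apply: le_trans rho1.
  have := @derive_le_cst R (fun r => z r 0 (lshift n i)) _ K r (fun q _ => dl q i).
  rewrite z0 row_mxEl => h.
  have {}h : `|z r 0 (lshift n i) - x 0 i| <= K * a.
    apply: le_trans (h _) _ => [q _|]; last by rewrite ler_wpM2l.
    by rewrite normrM -[K]mul1r ler_pM.
  have := ler_normD (z r 0 (lshift n i) - x 0 i) (x 0 i); rewrite subrK.
  by have := coord_le x i; lra.
have hr r i : `|r| <= a -> `|z r 0 (rshift n i)| <= rho.
  move=> ra; apply: le_trans rho2.
  have prE q k : pr (z q) 0 k = z q 0 (rshift n k) by rewrite mxE.
  have := @norm_gronwall n (fun q => pr (z q)) _ BB 0 r BB0 (lexx _).
  move=> /(_ (fun i q => chi (z q) * (\sum_k pr (z q) 0 k * 'D_(delta_mx 0 k) (V i) (pl (z q))))) h.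
  have {}h : nsq (pr (z r)) <= n%:R * expR (c * a).
    apply: le_trans (h _ _) _.
    - by move=> q k _; apply: is_derive_ext (dr q k) _ _ => // p; rewrite prE.
    - move=> q k _; rewrite addr0 normrM -[leRHS]mul1r; apply: ler_pM => //.
      apply: le_trans (ler_norm_sum _ _ _) _.
      apply: (@le_trans _ _ ((\sum_l B (k, l)) * `|pr (z q)|)); last by rewrite ler_wpM2r.
      rewrite mulr_suml; apply: ler_sum => l _; rewrite normrM mulrC.
      by apply: ler_pM => //; [case: (hB (k, l))|exact: coord_le].
    - rewrite z0 expr0n mulr0 mul0r addr0 -/c.
      have -> : pr (row_mx x v) = v by apply/rowP => k; rewrite mxE row_mxEr.
      apply: ler_pM; [exact: nsq_ge0|exact: expR_ge0| |by rewrite ler_expR ler_wpM2l].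
      apply: le_trans (nsq_le_norm _) _; rewrite -[leRHS]mulr1 ler_wpM2l //.
      by rewrite -[leRHS](expr1n _ 2) ler_pXn2r ?nnegrE.
  rewrite -prE; apply: le_trans (coord_le _ _) _.
  rewrite -(@ler_pXn2r _ 2) ?nnegrE ?sqrtr_ge0 //.
  by apply: le_trans (norm_le_nsq _) _; rewrite sqr_sqrtr // mulr_ge0 // expR_ge0.
have chiz : chi (z s) = 1.
  apply: chi1; rewrite subr0 ler_wpM2r //.
  apply: rV_le => [|k]; first exact: ltW.
  by case: (splitP k) => i ki; [have -> : k = lshift n i by exact: val_inj|have -> : k = rshift n i by exact: val_inj]; [exact: hl|exact: hr].
by split; [have := dl s j|have := dr s j]; rewrite chiz mul1r.
Qed.
End Variation.

(** The partial derivatives of a flow are themselves components of a flow of compactly supported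
    fields in dimension [n + n], which is what makes an induction on the order of smoothness
    possible. *)
Lemma rflow_variation n (V : 'I_n -> 'rV[R]_n -> R) phi (r0 a : R) : (forall j, ccs (V j)) ->
  is_rflow V phi -> 0 <= r0 -> 0 <= a ->
  exists (W : 'I_(n + n) -> 'rV[R]_(n + n) -> R) th, [/\ forall k, ccs (W k), is_rflow W th &
   forall x i, `|x| <= r0 ->
    [/\ forall (s : R) j, `|s| <= a -> is_derive x (delta_mx 0 i) (fun x => phi s x 0 j)
             (th s (row_mx x (delta_mx 0 i)) 0 (rshift n j)),
        forall j, th 0 (row_mx x (delta_mx 0 i)) 0 (rshift n j) = (delta_mx 0 i : 'rV[R]_n) 0 j &
        forall (s : R) j, `|s| <= a -> is_derive s 1 (fun s => th s (row_mx x (delta_mx 0 i)) 0 (rshift n j))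
          (\sum_k th s (row_mx x (delta_mx 0 i)) 0 (rshift n k) * 'D_(delta_mx 0 k) (V j) (phi s x))]].
Proof.
move=> hV hphi r00 a0; have [W [hW H]] := variational_field hV r00 a0.
have [th hT] := rflow_exists hW; exists W, th; split=> // x i xr.
have v1 : `|delta_mx 0 i : 'rV[R]_n| <= 1.
  by apply: rV_le => // j; rewrite mxE; case: (_ && _); rewrite ?normr1 ?normr0.
pose v := delta_mx 0 i : 'rV[R]_n.
have H' := H th hT x v xr v1.
have e (s : R) : `|s| <= a -> \row_j th s (row_mx x v) 0 (lshift n j) = phi s x.
  move=> sa; apply: (rcurve_unique hV (g := fun s => \row_j th s (row_mx x v) 0 (lshift n j)) (h := fun s => phi s x)).
  - by rewrite hphi.1; apply/rowP => j; rewrite mxE hT.1 row_mxEl.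
  - move=> r j rs; apply: is_derive_ext (H' r j (le_trans rs sa)).1 _ _ => // q.
    by rewrite mxE.
  - by move=> r j _; exact: hphi.2.
pose y s : 'rV[R]_n := \row_j th s (row_mx x v) 0 (rshift n j).
have hy (s : R) j : `|s| <= a -> is_derive s 1 (fun s => th s (row_mx x v) 0 (rshift n j))
          (\sum_k th s (row_mx x v) 0 (rshift n k) * 'D_(delta_mx 0 k) (V j) (phi s x)).
  move=> sa; have [_] := H' s j sa; rewrite e // => h; apply: is_derive_ext h _ _ => //.
  by apply: eq_bigr => k _; rewrite mxE.
split=> //.
- move=> s j sa; have y0 : y 0 = v by apply/rowP => k; rewrite mxE hT.1 row_mxEr.
  have := @rflow_derive n V hV phi hphi x v y s j y0; rewrite [y s 0 j]mxE; apply.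
  move=> r k rs; apply: is_derive_ext (hy r k (le_trans rs sa)) _ _.
    by move=> q; rewrite mxE.
  by apply: eq_bigr => l _; rewrite mxE.
- by move=> j; rewrite hT.1 row_mxEr.
Qed.

(** Induction on the order over all dimensions at once: by [rflow_variation] a partial derivative
    is, locally in [x], a component of a flow in dimension [n + n] restricted to a fixed tangent
    direction. *)
Lemma rflow_smooth n (V : 'I_n -> 'rV[R]_n -> R) phi (t : R) j : (forall j, ccs (V j)) ->
  is_rflow V phi -> smooth_on setT (fun x => phi t x 0 j).
Proof.
move=> hV hphi k; elim: k n V phi j hV hphi => [|k IH] n V phi j hV hphi.
  by apply: Ck_on0 => x _; exact: (rflow_continuous hV hphi).
apply: Ck_on_local => x0 _; pose U := [set x : 'rV[R]_n | `|x| < `|x0| + 1].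
have oU : open U.
  by apply: (@open_comp _ _ (fun x : 'rV[R]_n => `|x|) [set y | y < `|x0| + 1]); [move=> x _; exact: norm_continuous|exact: open_lt].
exists U; split=> //; first by rewrite /U /= ltrDl.
have r00 : 0 <= `|x0| + 1 by rewrite addr_ge0.
have [W [th [hW hT H]]] := rflow_variation hV hphi r00 (normr_ge0 t).
apply: (@Ck_onS _ _ _ _ _ (fun i x => th t (row_mx x (delta_mx 0 i)) 0 (rshift n j))) => //.
- by move=> x _; exact: (rflow_continuous hV hphi).
- by move=> i x Ux; have [h _ _] := H x i (ltW Ux); exact: h.
- move=> i; have := @Ck_on_comp R k (n + n) n setT U (fun z => th t z 0 (rshift n j))
    (fun l x => (row_mx x (delta_mx 0 i)) 0 l) oU openT (fun _ _ => I) (IH _ W th (rshift n j) hW hT).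
  have e x : (\row_l row_mx x (delta_mx 0 i) 0 l) = row_mx x (delta_mx 0 i) :> 'rV[R]_(n + n).
    by apply/rowP => l; rewrite mxE.
  under eq_fun do rewrite e; apply => l.
  case: (splitP l) => m lm.
    have -> : l = lshift n m by exact: val_inj.
    by under eq_fun do rewrite row_mxEl; exact: Ck_on_coord.
  have -> : l = rshift n m by exact: val_inj.
  by under eq_fun do rewrite row_mxEr; exact: Ck_on_cst.
Qed.

(** The variational equation read at time 0, where the derivative of the flow in space is the
    identity. *)
Lemma rflow_derive_derive n (V : 'I_n -> 'rV[R]_n -> R) phi x i j : (forall j, ccs (V j)) ->
  is_rflow V phi ->
  is_derive (0 : R) 1 (fun s => 'D_(delta_mx 0 i) (fun x => phi s x 0 j) x) ('D_(delta_mx 0 i) (V j) x).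
Proof.
move=> hV hphi; have [W [th [hW hT H]]] := rflow_variation hV hphi (normr_ge0 x) (@ler01 R).
have [h1 h2 h3] := H x i (lexx _).
have := h3 0 j; rewrite normr0 => /(_ (@ler01 R)) h.
apply: (@near_eq_is_derive _ R R (fun s => th s (row_mx x (delta_mx 0 i)) 0 (rshift n j))).
  near=> s; have s1 : `|s| <= 1.
    by rewrite -[s]subr0; near: s; apply: cvgr_distC_le => //; exact: cvg_id.
  by case: (h1 s j s1).
move: h; rewrite hphi.1 => h; apply: is_derive_ext h _ _ => //.
rewrite (bigD1 i) //= big1 ?addr0; first by rewrite h2 mxE !eqxx mul1r.
by move=> k ki; rewrite h2 mxE (negbTE ki) andbF mul0r.
Unshelve. all: by end_near. Qed.

End SmoothFlow.

Arguments tan_val {R M p} _ _ : simpl never.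

(** * Charts and smooth functions *)

Section ChartBasics.
Variables (R : realType) (M : manifold R).
Local Notation n := (mdim M).
Implicit Types (c d : chart R M n) (p q : M) (f g : M -> R).

Definition cimg c : set 'rV[R]_n := cmap c @` cdom c.

Lemma cdom_open c : atlas c -> open (cdom c).
Proof. by move=> /atlas_chart[]. Qed.

Lemma cimg_open c : atlas c -> open (cimg c).
Proof. by move=> /atlas_chart[]. Qed.

Lemma cmapK c p : atlas c -> cdom c p -> cinv c (cmap c p) = p.
Proof. by move=> /atlas_chart[_ _ h _ _]; exact: h. Qed.

Lemma cinvP c x : atlas c -> cimg c x -> cdom c (cinv c x) /\ cmap c (cinv c x) = x.
Proof. by move=> ac [p cp <-]; rewrite cmapK. Qed.

Lemma cmap_img c p : cdom c p -> cimg c (cmap c p).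
Proof. by move=> cp; exists p. Qed.

Lemma cmap_continuous c p : atlas c -> cdom c p -> {for p, continuous (cmap c)}.
Proof.
move=> ac cp; have [oc _ _ h _] := atlas_chart ac.
by move: h; rewrite continuous_open_subspace // => h; apply: h; rewrite inE.
Qed.

Lemma cinv_continuous c x : atlas c -> cimg c x -> {for x, continuous (cinv c)}.
Proof.
move=> ac cx; have [_ oc _ _ h] := atlas_chart ac.
by move: h; rewrite continuous_open_subspace // => h; apply: h; rewrite inE.
Qed.

Lemma open_preim (T T' : topologicalType) (A : set T) (B : set T') (f : T -> T') : open A -> open B ->
  (forall x, A x -> {for x, continuous f}) -> open (A `&` f @^-1` B).
Proof.
move=> oA oB cf; rewrite openE => x [Ax Bx]; rewrite /interior.
apply: filterI; first exact: open_nbhs_nbhs.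
by apply: (cf x Ax); exact: open_nbhs_nbhs.
Qed.

Lemma chart_preim_open c (V : set 'rV[R]_n) : atlas c -> open V -> open (cdom c `&` cmap c @^-1` V).
Proof.
move=> ac oV; apply: open_preim => //; first exact: cdom_open.
by move=> p cp; exact: cmap_continuous.
Qed.

Lemma cinv_preim_open c (U : set M) : atlas c -> open U -> open (cimg c `&` cinv c @^-1` U).
Proof.
move=> ac oU; apply: open_preim => //; first exact: cimg_open.
by move=> p cp; exact: cinv_continuous.
Qed.

Lemma img_setI c (U : set M) : atlas c -> cmap c @` (cdom c `&` U) = cimg c `&` cinv c @^-1` U.
Proof.
move=> ac; apply/seteqP; split=> [_ [p [cp Up] <-]|x [cx Ux]].
  by split; [exact: cmap_img|rewrite /= cmapK].
by have [h1 h2] := cinvP ac cx; exists (cinv c x).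
Qed.

Lemma img_setI_open c (U : set M) : atlas c -> open U -> open (cmap c @` (cdom c `&` U)).
Proof. by move=> ac oU; rewrite img_setI //; exact: cinv_preim_open. Qed.

Lemma smooth_local f : (forall p, exists U g, [/\ open U, U p, smooth g & forall q, U q -> f q = g q]) ->
  smooth f.
Proof.
move=> h c ac k; apply: Ck_on_local => x cx.
have [cp e] := cinvP ac cx; have [U [g [oU Up sg fg]]] := h (cinv c x).
have oV := cinv_preim_open ac oU.
exists (cimg c `&` cinv c @^-1` U); split=> //.
apply: (@Ck_on_ext _ _ _ _ (g \o cinv c)) => // [y [_ Uy]|]; first by rewrite /= fg.
by apply: Ck_on_sub (sg c ac k) => y [].
Qed.

Lemma smooth_ext f g : smooth f -> (forall p, f p = g p) -> smooth g.
Proof. by move=> sf /funext <-. Qed.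

Lemma smooth_cst (a : R) : smooth (fun _ : M => a).
Proof. by move=> c ac k; apply: Ck_on_cst; exact: cimg_open. Qed.

Lemma smoothD f g : smooth f -> smooth g -> smooth (fun q => f q + g q).
Proof. by move=> sf sg c ac k; apply: Ck_onD; [exact: cimg_open|exact: sf|exact: sg]. Qed.

Lemma smoothM f g : smooth f -> smooth g -> smooth (fun q => f q * g q).
Proof. by move=> sf sg c ac k; apply: Ck_onM; [exact: cimg_open|exact: sf|exact: sg]. Qed.

Lemma smoothN f : smooth f -> smooth (fun q => - f q).
Proof. by move=> sf c ac k; apply: Ck_onN; [exact: cimg_open|exact: sf]. Qed.

Lemma smoothB f g : smooth f -> smooth g -> smooth (fun q => f q - g q).
Proof. by move=> sf sg; apply: smoothD => //; exact: smoothN. Qed.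

Lemma smoothZ (a : R) f : smooth f -> smooth (fun q => a * f q).
Proof. by move=> sf; apply: smoothM => //; exact: smooth_cst. Qed.

Lemma smooth_sum (I : Type) (r : seq I) (P : pred I) (F : I -> M -> R) :
  (forall i, P i -> smooth (F i)) -> smooth (fun q => \sum_(i <- r | P i) F i q).
Proof.
move=> sF c ac k; apply: Ck_on_sum; first exact: cimg_open.
by move=> i Pi; exact: (sF i Pi c ac k).
Qed.

Lemma smooth_prod (I : Type) (r : seq I) (P : pred I) (F : I -> M -> R) :
  (forall i, P i -> smooth (F i)) -> smooth (fun q => \prod_(i <- r | P i) F i q).
Proof.
move=> sF c ac k; apply: Ck_on_prod; first exact: cimg_open.
by move=> i Pi; exact: (sF i Pi c ac k).
Qed.

Lemma smoothV f : (forall q, f q != 0) -> smooth f -> smooth (fun q => (f q)^-1).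
Proof. by move=> f0 sf c ac k; apply: Ck_onV; [exact: cimg_open| |exact: sf]. Qed.

Lemma continuous_eq_open (T T' : topologicalType) (f g : T -> T') (U : set T) x : open U -> U x ->
  (forall y, U y -> f y = g y) -> {for x, continuous f} -> {for x, continuous g}.
Proof.
move=> oU Ux fg; rewrite /prop_for /continuous_at -fg // => h; apply: cvg_trans h.
by apply: near_eq_cvg; apply: (filterS fg); exact: open_nbhs_nbhs.
Qed.

Lemma smooth_continuous f : smooth f -> continuous f.
Proof.
move=> sf p; have [c ac cp] := atlas_cover p.
have h : {for p, continuous ((f \o cinv c) \o cmap c)}.
  apply: continuous_comp; first exact: cmap_continuous.
  by apply: (Ck_onC (sf c ac 0%N)); exact: cmap_img.
apply: continuous_eq_open (cdom_open ac) cp _ h => q cq /=; by rewrite cmapK.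
Qed.

(** A closed ball around the image of [p] inside a chart and over [U], with a cut-off function for
    it: the device that turns data in coordinates into global objects. *)
Definition box p (U : set M) c (r : R) (b : 'rV[R]_n -> R) : Prop :=
  [/\ atlas c /\ cdom c p, 0 < r,
      (forall x, `|x - cmap c p| <= r -> cimg c x /\ U (cinv c x)),
      [/\ smooth_on setT b, (forall x, r <= `|x - cmap c p| -> b x = 0) & (forall x, 0 <= b x <= 1)] &
      (forall x, `|x - cmap c p| * (2 * n.+1%:R) <= r -> b x = 1)].

Lemma box_exists_in p (U : set M) c : open U -> U p -> atlas c -> cdom c p -> exists r b, box p U c r b.
Proof.
move=> oU Up ac cp.
have oV := cinv_preim_open ac oU.
have Vp : (cimg c `&` cinv c @^-1` U) (cmap c p) by split; [exact: cmap_img|rewrite /= cmapK].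
have := open_nbhs_nbhs (conj oV Vp); case/nbhs_ballP => e /= e0 he.
have r0 : 0 < e / 2 by rewrite divr_gt0.
have [b [sb b1 b0 bI]] := bump_exists (cmap c p) r0.
exists (e / 2), b; split=> // x hx.
have : (cimg c `&` cinv c @^-1` U) x.
  by apply: he; rewrite -ball_normE /= distrC; apply: le_lt_trans hx _; lra.
by case.
Qed.

Lemma box_exists p (U : set M) : open U -> U p -> exists c r b, box p U c r b.
Proof.
move=> oU Up; have [c ac cp] := atlas_cover p.
by exists c; exact: box_exists_in.
Qed.

Definition bext c (b h : 'rV[R]_n -> R) q : R :=
  if `[< cdom c q >] then b (cmap c q) * h (cmap c q) else 0.

(** Here the cut-off function of a box equals 1, so cut-off data coincide with the original ones. *)
Definition boxW p c (r : R) : set M :=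
  cdom c `&` cmap c @^-1` [set x | `|x - cmap c p| * (2 * n.+1%:R) < r].

Lemma boxW_open_at p c (r : R) : atlas c -> open (boxW p c r).
Proof.
move=> ac; apply: chart_preim_open => //.
apply: (@open_comp _ _ (fun x : 'rV[R]_n => `|x - cmap c p| * (2 * n.+1%:R)) [set y | y < r]); last exact: open_lt.
move=> x _; apply: (@lip_continuous _ _ _ _ (2 * n.+1%:R)) => // y.
rewrite -mulrBl normrM (@ger0_norm _ (2 * n.+1%:R)) // mulrC ler_wpM2l //.
by apply: le_trans (ler_dist_dist _ _) _; rewrite opprB addrA subrK.
Qed.

Section Box.
Variables (p : M) (U : set M) (c : chart R M n) (r : R) (b : 'rV[R]_n -> R) (hb : box p U c r b).
Let W := boxW p c r.

Lemma box_chart : atlas c. Proof. by case: hb => -[]. Qed.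

Lemma boxW_open : open W.
Proof. exact: boxW_open_at box_chart. Qed.

Lemma boxW_self : W p.
Proof. by case: hb => -[ac cp] r0 _ _ _; split=> //=; rewrite subrr normr0 mul0r. Qed.

Lemma boxW_norm x : `|x - cmap c p| * (2 * n.+1%:R) < r -> `|x - cmap c p| <= r.
Proof.
move=> h; apply: le_trans (ltW h); rewrite ler_peMr //.
by rewrite -natrM ler1n.
Qed.

Lemma boxW_cdom q : W q -> cdom c q. Proof. by case. Qed.

Lemma bextE h q : W q -> bext c b h q = h (cmap c q).
Proof.
move=> [cq hq]; rewrite /bext (introT (asboolP _) cq).
by case: hb => _ _ _ _ b1; rewrite b1 ?mul1r // ltW.
Qed.

Lemma box_support : exists2 K : set M, compact K /\ K `<=` U `&` cdom c &
  forall h q, ~ K q -> bext c b h q = 0.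
Proof.
case: (hb) => -[ac cp] r0 hr [sb b0 bI] b1.
pose A := [set x : 'rV[R]_n | `|x - cmap c p| <= r].
have cA : compact A.
  apply: bounded_closed_compact.
    exists (r + `|cmap c p|); split; first exact: num_real.
    move=> m hm x /= xA; apply: le_trans (ltW hm).
    by have := ler_normD (x - cmap c p) (cmap c p); rewrite subrK => /le_trans; apply; rewrite lerD2r.
  apply: (@closed_comp _ _ (fun x : 'rV[R]_n => `|x - cmap c p|) [set y | y <= r]); last exact: closed_le.
  move=> x _; apply: (@lip_continuous _ _ _ _ 1) => // y; rewrite mul1r.
  by apply: le_trans (ler_dist_dist _ _) _; rewrite opprB addrA subrK.
exists (cinv c @` A).
  split.
    apply: continuous_compact cA; apply: continuous_in_subspaceT => x; rewrite inE => xA.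
    by apply: cinv_continuous => //; case: (hr x xA).
  by move=> _ [x xA <-]; have [h1 h2] := hr x xA; split=> //; case: (cinvP ac h1).
move=> h q hq; rewrite /bext; case: asboolP => // cq.
rewrite b0 ?mul0r //; rewrite leNgt; apply/negP => hlt; apply: hq.
by exists (cmap c q); [exact: ltW|rewrite cmapK].
Qed.

(** Inside the chart this is compatibility of charts. Outside, the Hausdorff property is at work:
    the support lies in the image of a compact ball, which is closed, so a point outside the chart
    has a neighbourhood on which the extension vanishes. *)
Lemma bext_smooth h : smooth_on (cimg c) h -> smooth (bext c b h).
Proof.
move=> sh; have ac := box_chart; have [K [cK sK] hK] := box_support.
have clK : closed K := compact_closed (@mfd_hausdorff R M) cK.
move=> d ad k; apply: Ck_on_local => x dx.
have [dq e] := cinvP ad dx.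
have [cq|cq] := pselect (cdom c (cinv d x)); last first.
  have oV := cinv_preim_open ad (closed_openC clK).
  exists (cimg d `&` cinv d @^-1` ~` K); split=> //.
    by split=> //= /sK[].
  apply: (@Ck_on_ext _ _ _ _ (fun=> 0)) (Ck_on_cst _ _ oV) => // y [_ hy].
  by rewrite /= hK.
have oV := cinv_preim_open ad (cdom_open ac).
exists (cimg d `&` cinv d @^-1` cdom c); split=> //.
case: (hb) => _ _ _ [sb _ _] _.
have sbh : Ck_on k (cimg c) (fun x => b x * h x).
  by apply: Ck_onM; [exact: cimg_open|apply: Ck_on_sub (sb k)|exact: sh].
have row x' : (\row_j cmap c (cinv d x') 0 j) = cmap c (cinv d x') by apply/rowP => j; rewrite mxE.
apply: (@Ck_on_ext _ _ _ _ (fun x => (fun y => b y * h y) (\row_j cmap c (cinv d x) 0 j))) => //.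
  by move=> y [dy cy]; rewrite row /= /bext (introT (asboolP _) cy).
apply: (Ck_on_comp oV (cimg_open ac)) sbh _.
  by move=> y [dy cy]; rewrite row; exact: cmap_img.
move=> j; rewrite -img_setI //.
exact: (atlas_compat ad ac j k).
Qed.

Lemma box_cut_ccs h : smooth_on (cimg c) h -> ccs (fun x => b x * h x).
Proof.
move=> sh; have ac := box_chart; case: (hb) => _ _ hr [sb b0 _] _; split.
  move=> k; apply: Ck_on_local => x _.
  have [xr|xr] := leP `|x - cmap c p| r.
    exists (cimg c); split; [exact: cimg_open|by case: (hr x xr)|].
    by apply: Ck_onM; [exact: cimg_open|apply: Ck_on_sub (sb k)|exact: sh].
  have oV : open [set x : 'rV[R]_n | r < `|x - cmap c p|].
    apply: (@open_comp _ _ (fun x : 'rV[R]_n => `|x - cmap c p|) [set y | r < y]); last exact: open_gt.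
    move=> y _; apply: (@lip_continuous _ _ _ _ 1) => // z; rewrite mul1r.
    by apply: le_trans (ler_dist_dist _ _) _; rewrite opprB addrA subrK.
  exists [set x | r < `|x - cmap c p|]; split=> //.
  apply: (@Ck_on_ext _ _ _ _ (fun=> 0)) (Ck_on_cst _ _ oV) => // y /= hy.
  by rewrite b0 ?mul0r // ltW.
exists (r + `|cmap c p|) => x hx; rewrite b0 ?mul0r //.
have := ler_normD (x - cmap c p) (cmap c p); rewrite subrK => h1; lra.
Qed.

End Box.

Lemma bump_manifold p (U : set M) : open U -> U p -> exists b : M -> R, exists K : set M,
  [/\ smooth b, compact K /\ K `<=` U, (forall q, ~ K q -> b q = 0),
      (forall q, 0 <= b q <= 1) & exists2 W, open W /\ W p & forall q, W q -> b q = 1].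
Proof.
move=> oU Up; have [c [r [b hb]]] := box_exists oU Up.
have [K [cK sK] hK] := box_support hb.
exists (bext c b (fun=> 1)), K; split.
- by apply: (bext_smooth hb) => k; apply: Ck_on_cst; apply: cimg_open; exact: (box_chart hb).
- by split=> // q /sK[].
- by move=> q; exact: hK.
- move=> q; rewrite /bext; case: asboolP => _; last by rewrite lexx ler01.
  by rewrite mulr1; case: hb => _ _ _ [_ _].
- exists (boxW p c r); first by split; [exact: (boxW_open hb)|exact: (boxW_self hb)].
  by move=> q Wq; rewrite (bextE hb).
Qed.

Lemma smooth_localV p f : smooth f -> f p != 0 -> exists g W,
  [/\ smooth g, open W, W p & forall q, W q -> f q * g q = 1].
Proof.
move=> sf fp; have oU : open [set q | f q != 0].
  apply: (@open_comp _ _ f [set y | y != 0]); last exact: open_neq.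
  by move=> q _; exact: smooth_continuous.
have [b [K [sb [cK sK] bK bI [W [oW Wp] bW]]]] := bump_manifold oU fp.
pose h q := f q * f q + (1 - b q).
have h0 q : h q != 0.
  rewrite gt_eqF // /h; have [fq|fq] := eqVneq (f q) 0.
    by rewrite bK ?fq; [lra|move=> /sK /=; rewrite fq eqxx].
  have : 0 < f q * f q by rewrite -expr2 exprn_even_gt0.
  by have /andP[_ ?] := bI q; lra.
have sh : smooth h by apply: smoothD; [exact: smoothM|apply: smoothB => //; exact: smooth_cst].
have fW q : W q -> f q != 0.
  move=> /bW bq; have [Kq|Kq] := pselect (K q); first exact: sK.
  by move: (bK q Kq) => /eqP; rewrite bq oner_eq0.
exists (fun q => f q * (h q)^-1), W; split=> //; first by apply: smoothM => //; exact: smoothV.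
by move=> q Wq; rewrite /h bW // subrr addr0; have := fW q Wq => ?; field.
Qed.

End ChartBasics.

Section SmoothMapTheory.
Variables (R : realType) (M N : manifold R).
Implicit Types (phi : M -> N).

Lemma smooth_comp phi (g : N -> R) : smooth_map phi -> smooth g -> smooth (g \o phi).
Proof.
move=> [cphi sphi] sg c ac k; apply: Ck_on_local => x cx.
have [cq e] := cinvP ac cx; have [d ad dq] := atlas_cover (phi (cinv c x)).
have oP : open (phi @^-1` cdom d) by apply: open_comp => [y _|]; [exact: cphi|exact: cdom_open].
exists (cmap c @` (cdom c `&` phi @^-1` cdom d)); split; first exact: img_setI_open.
  by exists (cinv c x).
have row x' : (\row_j cmap d (phi (cinv c x')) 0 j) = cmap d (phi (cinv c x')) by apply/rowP => j; rewrite mxE.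
apply: (@Ck_on_ext _ _ _ _ (fun x => (g \o cinv d) (\row_j cmap d (phi (cinv c x)) 0 j))).
- exact: img_setI_open.
- by move=> _ [q [cq' dq'] <-]; rewrite row /= cmapK // cmapK.
apply: (Ck_on_comp (img_setI_open ac oP) (cimg_open ad)); last 2 first.
- exact: sg.
- by move=> j; exact: (sphi c d ac ad j k).
- by move=> _ [q [cq' dq'] <-]; rewrite row cmapK //; exact: cmap_img.
Qed.

(** Bump functions detect continuity, and cut-off coordinates are test functions that detect
    smoothness. Smooth maps can thus be handled through the pullback of functions. *)
Lemma smooth_mapI phi : (forall g : N -> R, smooth g -> smooth (g \o phi)) -> smooth_map phi.
Proof.
move=> h; have cphi : continuous phi.
  move=> p A; rewrite nbhsE => -[U [oU Up] sUA].
  have [b [K [sb [cK sK] bK bI [W [oW Wp] bW]]]] := bump_manifold oU Up.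
  have := @smooth_continuous R M _ (h b sb) p.
  move=> /(_ [set y | 0 < y]) /=; rewrite bW // => H.
  have : nbhs (1 : R) [set y | 0 < y] by apply: open_nbhs_nbhs; split; [exact: open_gt|exact: ltr01].
  move=> h0; have H' : nbhs p [set q | 0 < b (phi q)] := H h0.
  apply: filterS H' => q /= bq; apply: sUA; apply: sK.
  by apply: contrapT => Kq; move: bq; rewrite /= bK // ltxx.
split=> // c d ac ad j k; apply: Ck_on_local => x [q [cq dq] qx].
have oP : open (phi @^-1` cdom d) by apply: open_comp => [y _|]; [exact: cphi|exact: cdom_open].
have [r [b hb]] := box_exists_in (cdom_open ad) dq ad dq.
have oW := boxW_open hb; have Wq := boxW_self hb.
have sG : smooth (bext d b (fun y => y 0 j)).
  by apply: (bext_smooth hb) => l; apply: Ck_on_coord; exact: cimg_open.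
have oQ : open (phi @^-1` boxW (phi q) d r) by apply: open_comp => [y _|]; [exact: cphi|].
exists (cmap c @` (cdom c `&` phi @^-1` boxW (phi q) d r)); split; first exact: img_setI_open.
  by exists q.
apply: (@Ck_on_ext _ _ _ _ ((bext d b (fun y => y 0 j) \o phi) \o cinv c)).
- exact: img_setI_open.
- by move=> _ [y [cy Wy] <-]; rewrite /= cmapK // (bextE hb).
- by apply: Ck_on_sub (h _ sG c ac k); rewrite img_setI // => y [].
Qed.

End SmoothMapTheory.

Lemma smooth_map_comp (R : realType) (M N P : manifold R) (phi : M -> N) (psi : N -> P) :
  smooth_map phi -> smooth_map psi -> smooth_map (psi \o phi).
Proof.
move=> h1 h2; apply: smooth_mapI => g sg.
exact: (smooth_comp h1 (smooth_comp h2 sg)).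
Qed.

(** * Tangent vectors and vector fields *)

Section TangentTheory.
Variables (R : realType) (M : manifold R).
Implicit Types (p q : M) (f g : M -> R).

Lemma tanP p (u : tangent p) : derivation_at p u.
Proof. by have := tan_valP u; rewrite unfold_in /= => /asboolP. Qed.

Lemma tan_nsmooth p (u : tangent p) f : ~ smooth f -> u f = 0.
Proof. by case: (tanP u) => _ _ h; exact: h. Qed.

Lemma tan_eq p (u v : tangent p) : (forall f, smooth f -> u f = v f) -> u = v.
Proof.
move=> h; apply: val_inj; apply/funext => f /=.
have [sf|sf] := pselect (smooth f); first exact: h.
by rewrite !tan_nsmooth.
Qed.

Lemma tan_addE p (u v : tangent p) f : (u + v) f = u f + v f.
Proof. by []. Qed.

Lemma tan_scaleE p (a : R) (u : tangent p) f : (a *: u) f = a * u f.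
Proof. by []. Qed.

Lemma tan_zeroE p f : (0 : tangent p) f = 0.
Proof. by []. Qed.

Lemma tan_oppE p (u : tangent p) f : (- u) f = - u f.
Proof. by []. Qed.

Lemma tan_subE p (u v : tangent p) f : (u - v) f = u f - v f.
Proof. by []. Qed.

Lemma tan_sumE p (I : Type) (r : seq I) (P : pred I) (F : I -> tangent p) f :
  (\sum_(i <- r | P i) F i) f = \sum_(i <- r | P i) F i f.
Proof. by elim/big_rec2: _ => // i x y _ <-. Qed.

Section AtPoint.
Variables (p : M) (u : tangent p).

Lemma tanD f g : smooth f -> smooth g -> u (fun q => f q + g q) = u f + u g.
Proof.
move=> sf sg; have [h _ _] := tanP u.
by have := h 1 f g sf sg; rewrite mul1r => <-; congr (tan_val u _); apply/funext => q; rewrite mul1r.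
Qed.

Lemma tanM f g : smooth f -> smooth g -> u (fun q => f q * g q) = f p * u g + g p * u f.
Proof. by case: (tanP u) => _ h _ sf sg; exact: h. Qed.

Lemma tan_cst (a : R) : u (fun=> a) = 0.
Proof.
have s1 : smooth (fun _ : M => 1 : R) by exact: smooth_cst.
have sa : smooth (fun _ : M => a) by exact: smooth_cst.
have h1 : u (fun=> 1) = 0.
  have := tanM s1 s1; rewrite !mul1r => h.
  have : u (fun=> 1) = u (fun=> 1) + u (fun=> 1) by [].
  by lra.
have [h _ _] := tanP u; have := h a (fun=> 1) (fun=> 0) s1 (@smooth_cst R M 0).
have h0 : u (fun=> 0) = 0.
  have := h 1 (fun=> 0) (fun=> 0) (@smooth_cst R M 0) (@smooth_cst R M 0).
  have -> : (fun _ : M => 1 * 0 + 0 : R) = (fun=> 0) by apply/funext => q; rewrite mul1r addr0.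
  by rewrite mul1r; lra.
have -> : (fun _ : M => a * 1 + 0) = (fun=> a) by apply/funext => q; rewrite mulr1 addr0.
by rewrite h1 h0 mulr0 => ->; rewrite addr0.
Qed.

Lemma tanZ (a : R) f : smooth f -> u (fun q => a * f q) = a * u f.
Proof. by move=> sf; rewrite tanM //; [rewrite tan_cst mulr0 addr0|exact: smooth_cst]. Qed.

Lemma tanN f : smooth f -> u (fun q => - f q) = - u f.
Proof.
move=> sf; rewrite -mulN1r -tanZ //; congr (tan_val u _); apply/funext => q; by rewrite mulN1r.
Qed.

Lemma tanB f g : smooth f -> smooth g -> u (fun q => f q - g q) = u f - u g.
Proof. by move=> sf sg; rewrite tanD ?tanN //; exact: smoothN. Qed.

Lemma tan_sum (I : Type) (r : seq I) (P : pred I) (F : I -> M -> R) : (forall i, P i -> smooth (F i)) ->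
  u (fun q => \sum_(i <- r | P i) F i q) = \sum_(i <- r | P i) u (F i).
Proof.
move=> sF; elim: r => [|a r IH].
  by rewrite big_nil -[RHS](tan_cst 0); congr (tan_val u _); apply/funext => q; rewrite big_nil.
rewrite big_cons; case Pa: (P a).
  rewrite -IH -tanD; [|exact: sF|exact: smooth_sum].
  by congr (tan_val u _); apply/funext => q; rewrite big_cons Pa.
by rewrite -IH; congr (tan_val u _); apply/funext => q; rewrite big_cons Pa.
Qed.

(** For a bump function [b] supported in [W] the product b (f - g) is 0; by the product rule at [p],
    where [b] is 1 and [f - g] is 0, the derivation kills [f - g]. *)
Lemma tan_local (W : set M) f g : open W -> W p -> smooth f -> smooth g ->
  (forall q, W q -> f q = g q) -> u f = u g.
Proof.
move=> oW Wp sf sg fg; apply/eqP; rewrite -subr_eq0 -tanB //; apply/eqP.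
have [b [K [sb [cK sK] bK _ [V [oV Vp] bV]]]] := bump_manifold oW Wp.
have : u (fun q => b q * (f q - g q)) = 0.
  rewrite -[RHS](tan_cst 0); congr (tan_val u _); apply/funext => q.
  have [Kq|Kq] := pselect (K q); first by rewrite fg ?subrr ?mulr0 //; exact: sK.
  by rewrite bK // mul0r.
by rewrite tanM ?bV //; [rewrite mul1r fg // subrr mul0r addr0|exact: smoothB].
Qed.

End AtPoint.

Lemma tanE p (v : (M -> R) -> R^o) (hv : derivation_at p v) f :
  (insubd (0 : tangent p) v) f = v f.
Proof.
have e : val (insubd (0 : tangent p) v) = v by apply: insubdK; rewrite unfold_in /=; apply/asboolP.
exact: (congr1 (fun w : (M -> R) -> R^o => w f) e).
Qed.

Lemma vfieldP (X : vfield M) f : is_vfield X -> smooth f -> smooth (fun p => X p f).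
Proof. by move=> h; exact: h. Qed.

End TangentTheory.

Section Frames.
Variables (R : realType) (M : manifold R).
Local Notation n := (mdim M).
Implicit Types (p q : M) (f g : M -> R) (X Y : vfield M).

Section ChartFrame.
Variables (p : M) (U : set M) (c : chart R M n) (r : R) (b : 'rV[R]_n -> R) (hb : box p U c r b).
Let ac := box_chart hb.

Definition chart_partial i q f : R :=
  if `[< smooth f >] then bext c b (fun x => 'D_(delta_mx 0 i) (f \o cinv c) x) q else 0.

Lemma chart_smooth_on f : smooth f -> smooth_on (cimg c) (f \o cinv c).
Proof. by move=> sf; exact: sf. Qed.

Lemma chart_is_derive f i x : smooth f -> cimg c x ->
  is_derive x (delta_mx 0 i) (f \o cinv c) ('D_(delta_mx 0 i) (f \o cinv c) x).
Proof. by move=> sf cx; apply (Ck_onSP i (sf c ac 1%N)).1. Qed.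

Lemma chart_partial_derivation i q : derivation_at q (chart_partial i q).
Proof.
split.
- move=> a f g sf sg; rewrite /chart_partial !asboolT //; last by apply: smoothD => //; exact: smoothZ.
  rewrite /bext; case: asboolP => cq; last by rewrite mulr0 addr0.
  have cx := cmap_img cq.
  have := is_deriveD (is_deriveZ a (chart_is_derive i sf cx)) (chart_is_derive i sg cx).
  case=> _ e; have -> : 'D_(delta_mx 0 i) ((fun q => a * f q + g q) \o cinv c) (cmap c q) = _ := e.
  by rewrite /GRing.scale /=; ring.
- move=> f g sf sg; rewrite /chart_partial !asboolT //; last exact: smoothM.
  rewrite /bext; case: asboolP => cq; last by rewrite !mulr0 addr0.
  have cx := cmap_img cq.
  have := is_deriveM (chart_is_derive i sf cx) (chart_is_derive i sg cx).
  case=> _ e; have -> : 'D_(delta_mx 0 i) ((fun q => f q * g q) \o cinv c) (cmap c q) = _ := e.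
  by rewrite /GRing.scale /= cmapK //; ring.
- by move=> f sf; rewrite /chart_partial asboolF.
Qed.

Definition chart_field i : vfield M := fun q => insubd (0 : tangent q) (chart_partial i q).

Lemma chart_fieldE i q f : smooth f ->
  chart_field i q f = bext c b (fun x => 'D_(delta_mx 0 i) (f \o cinv c) x) q.
Proof. by move=> sf; rewrite tanE ?/chart_partial ?asboolT //; exact: chart_partial_derivation. Qed.

Lemma chart_field_vfield i : is_vfield (chart_field i).
Proof.
move=> f sf; apply: (@smooth_ext _ _ (bext c b (fun x => 'D_(delta_mx 0 i) (f \o cinv c) x))).
  by apply: (bext_smooth hb); apply: smooth_onD_; exact: sf.
by move=> q; rewrite chart_fieldE.
Qed.

Definition chart_coord i : M -> R := bext c b (fun x => x 0 i).

Lemma chart_coord_smooth i : smooth (chart_coord i).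
Proof. by apply: (bext_smooth hb) => k; apply: Ck_on_coord; exact: cimg_open. Qed.

Lemma hint_self (x0 : 'rV[R]_n) (g : 'rV[R]_n -> R) : hint x0 0 g x0 = g x0.
Proof.
rewrite /hint (_ : (fun t : R => _) = (fun=> g x0)).
  have := @prim_unique R (fun=> g x0) (fun t => g x0 * t) 1 _ _; rewrite mulr1 mulr0 subr0; apply.
    by move=> t; exact: cst_continuous.
  by move=> s _; exact: is_derive_mull.
by apply/funext => t; rewrite expr0 mul1r subrr scaler0 addr0.
Qed.

(** Hadamard's lemma at [q] writes [f] near [q] as a constant plus products with a factor vanishing
    at [q]. A derivation sees only the value at [q] of the other factor, which is a partial
    derivative of [f]. *)
Lemma chart_expansion q (u : tangent q) f : boxW p c r q -> smooth f ->
  u f = \sum_i u (chart_coord i) * 'D_(delta_mx 0 i) (f \o cinv c) (cmap c q).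
Proof.
move=> Wq sf; have oW := boxW_open hb; have cq := boxW_cdom Wq.
pose F x := b x * (f \o cinv c) x.
have cF : ccs F := box_cut_ccs hb (chart_smooth_on sf).
pose G i := bext c b (hint (cmap c q) 0 (fun y => 'D_(delta_mx 0 i) F y)).
have sG i : smooth (G i).
  by apply: (bext_smooth hb) => k; apply: Ck_on_sub (hint_smooth _ _ (ccs_derive i cF) k).
pose g q' := f q + \sum_i (chart_coord i q' - chart_coord i q) * G i q'.
have sgi i : smooth (fun q' => (chart_coord i q' - chart_coord i q) * G i q').
  by apply: smoothM => //; apply: smoothB; [exact: chart_coord_smooth|exact: smooth_cst].
have sg : smooth g by apply: smoothD; [exact: smooth_cst|apply: smooth_sum => i _; exact: sgi].
have FE q' : boxW p c r q' -> F (cmap c q') = f q'.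
  move=> Wq'; have := bextE hb (f \o cinv c) Wq'; rewrite /bext asboolT; last exact: boxW_cdom Wq'.
  by move=> e; rewrite /F e /= cmapK //; exact: boxW_cdom Wq'.
rewrite (tan_local u oW Wq sf sg); last first.
  move=> q' Wq'; rewrite -(FE q') // (hadamard (cmap c q) (cmap c q') cF) FE // /g; congr (_ + _).
  by apply: eq_bigr => i _; rewrite /chart_coord /G !(bextE hb).
rewrite tanD; [|exact: smooth_cst|by apply: smooth_sum => i _; exact: sgi].
rewrite tan_cst add0r tan_sum //; apply: eq_bigr => i _.
rewrite tanM //; last by apply: smoothB; [exact: chart_coord_smooth|exact: smooth_cst].
rewrite subrr mul0r add0r tanB; [|exact: chart_coord_smooth|exact: smooth_cst].
rewrite tan_cst subr0 mulrC /G (bextE hb) // hint_self; congr (_ * _).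
apply: near_eq_derive.
have oV := cinv_preim_open ac oW.
apply: (@filterS _ (nbhs (cmap c q)) _ (cimg c `&` cinv c @^-1` boxW p c r)).
  by move=> x [cx Wx]; have := FE _ Wx; have [_ ->] := cinvP ac cx.
by apply: open_nbhs_nbhs; split=> //; split; [exact: cmap_img|rewrite /= cmapK].
Qed.

Lemma chart_frame q (u : tangent q) : boxW p c r q ->
  u = \sum_i (u (chart_coord i) : R) *: chart_field i q.
Proof.
move=> Wq; apply: tan_eq => f sf; rewrite tan_sumE (chart_expansion u Wq sf).
by apply: eq_bigr => i _; rewrite tan_scaleE chart_fieldE // (bextE hb).
Qed.

Lemma chart_frame_coord q i j : boxW p c r q -> chart_field i q (chart_coord j) = (i == j)%:R.
Proof.
move=> Wq; rewrite chart_fieldE; last exact: chart_coord_smooth.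
rewrite (bextE hb) //.
have oW := boxW_open hb; have oV := cinv_preim_open ac oW.
rewrite (@near_eq_derive _ _ _ _ (fun x : 'rV[R]_n => x 0 j)); last first.
  apply: (@filterS _ (nbhs (cmap c q)) _ (cimg c `&` cinv c @^-1` boxW p c r)).
    by move=> x [cx Wx]; rewrite /= /chart_coord (bextE hb) //; have [_ ->] := cinvP ac cx.
  by apply: open_nbhs_nbhs; split=> //; split; [exact: cmap_img (boxW_cdom Wq)|rewrite /= cmapK //; exact: boxW_cdom Wq].
have h : is_derive (cmap c q) (delta_mx 0 i) (fun x : 'rV[R]_n => x 0 j) ((delta_mx 0 i : 'rV[R]_n) 0 j).
  apply: line_is_derive.
  have -> : (fun t : R => (cmap c q + t *: delta_mx 0 i : 'rV[R]_n) 0 j) =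
     (fun t => cmap c q 0 j + (delta_mx 0 i : 'rV[R]_n) 0 j * t).
    by apply/funext => t; rewrite !mxE mulrC.
  by have := is_deriveD (is_derive_cst (cmap c q 0 j) (0 : R) 1) (is_derive_mull ((delta_mx 0 i : 'rV[R]_n) 0 j) 0); rewrite add0r.
by case: h => _ ->; rewrite mxE eqxx eq_sym.
Qed.

End ChartFrame.

Lemma local_frame p : exists (x : 'I_n -> M -> R) (E : 'I_n -> vfield M) (W : set M),
  [/\ open W /\ W p, (forall i, smooth (x i)), (forall i, is_vfield (E i)),
      (forall q (u : tangent q), W q -> u = \sum_i (u (x i) : R) *: E i q) &
      (forall q i j, W q -> E i q (x j) = (i == j)%:R)].
Proof.
have [c [r [b hb]]] := @box_exists R M p setT openT I.
exists (chart_coord c b), (chart_field c b), (boxW p c r); split.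
- by split; [exact: (boxW_open hb)|exact: (boxW_self hb)].
- by move=> i; exact: (chart_coord_smooth hb).
- by move=> i; exact: (chart_field_vfield hb).
- by move=> q u Wq; exact: (chart_frame hb).
- by move=> q i j Wq; exact: (chart_frame_coord hb).
Qed.

Lemma vfieldN X : is_vfield X -> is_vfield (fun q => - X q).
Proof. by move=> hX f sf; apply: smoothN; exact: hX. Qed.

Lemma vfieldZ f X : smooth f -> is_vfield X -> is_vfield (fun q => f q *: X q).
Proof. by move=> hf hX g sg; exact: (smoothM hf (hX g sg)). Qed.

Lemma vfield_sum (I : Type) (s : seq I) (P : pred I) (F : I -> vfield M) :
  (forall i, P i -> is_vfield (F i)) -> is_vfield (fun q => \sum_(i <- s | P i) F i q).
Proof.
move=> h f sf; apply: smooth_ext (smooth_sum s (fun i Pi => h i Pi f sf)) _ => q.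
by rewrite tan_sumE.
Qed.

Lemma extend_exists p (u : tangent p) : exists X, is_vfield X /\ X p = u.
Proof.
have [x [E [W [[oW Wp] sx sE hE _]]]] := local_frame p.
exists (fun q => \sum_i (u (x i) : R) *: E i q); split; last by rewrite -hE.
by apply: vfield_sum => i _; apply: vfieldZ => //; exact: smooth_cst.
Qed.

Lemma extendP p (u : tangent p) : is_vfield (extend u) /\ extend u p = u.
Proof. by rewrite /extend; case: xgetP => [X -> //|h]; have [X hX] := extend_exists u; case: (h X). Qed.

Lemma extend_vfield p (u : tangent p) : is_vfield (extend u).
Proof. by case: (extendP u). Qed.

Lemma extendE p (u : tangent p) : extend u p = u.
Proof. by case: (extendP u). Qed.

Lemma bracket_derivation X Y p : is_vfield X -> is_vfield Y -> derivation_at p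
  (fun f => if `[< smooth f >] then X p (fun q => Y q f) - Y p (fun q => X q f) else 0).
Proof.
move=> hX hY; split.
- move=> a f g sf sg; rewrite !asboolT //; last by apply: smoothD => //; exact: smoothZ.
  have h Z : is_vfield Z -> (fun q => Z q (fun r => a * f r + g r)) = (fun q => a * Z q f + Z q g).
    by move=> hZ; apply/funext => q; rewrite tanD ?tanZ //; exact: smoothZ.
  rewrite !h // !tanD ?tanZ; try (by [exact: hX|exact: hY|apply: smoothZ; exact: hX|apply: smoothZ; exact: hY]).
  by ring.
- move=> f g sf sg; rewrite !asboolT //; last exact: smoothM.
  have h Z : is_vfield Z -> (fun q => Z q (fun r => f r * g r)) = (fun q => f q * Z q g + g q * Z q f).
    by move=> hZ; apply/funext => q; rewrite tanM.
  have sX h' : smooth h' -> smooth (fun q => X q h') by exact: hX.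
  have sY h' : smooth h' -> smooth (fun q => Y q h') by exact: hY.
  rewrite !h // !tanD ?tanM; try (by [|exact: sX|exact: sY|apply: smoothM => //; exact: sX|apply: smoothM => //; exact: sY]).
  by ring.
- by move=> f sf; rewrite asboolF.
Qed.

Lemma bracketE X Y p f : is_vfield X -> is_vfield Y -> smooth f ->
  bracket X Y p f = X p (fun q => Y q f) - Y p (fun q => X q f).
Proof. by move=> hX hY sf; rewrite tanE ?asboolT //; exact: bracket_derivation. Qed.

Lemma bracket_vfield X Y : is_vfield X -> is_vfield Y -> is_vfield (bracket X Y).
Proof.
move=> hX hY f sf; apply: (@smooth_ext _ _ (fun p => X p (fun q => Y q f) - Y p (fun q => X q f))).
  by apply: smoothB; [apply: hX; exact: hY|apply: hY; exact: hX].
by move=> p; rewrite bracketE.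
Qed.

End Frames.

Section PushTheory.
Variables (R : realType).

Lemma push_derivation (M N : manifold R) (phi : M -> N) p (u : tangent p) : smooth_map phi ->
  derivation_at (phi p) (fun g : N -> R => if `[< smooth g >] then u (g \o phi) else 0).
Proof.
move=> sp; have sc g : smooth g -> smooth (g \o phi) by exact: smooth_comp.
split.
- move=> a f g sf sg; rewrite !asboolT //; last by apply: smoothD => //; exact: smoothZ.
  rewrite -(tanZ u a (sc f sf)) -tanD //; [apply: smoothZ; exact: sc|exact: sc].
- move=> f g sf sg; rewrite !asboolT //; last exact: smoothM.
  by rewrite -[f (phi p)]/((f \o phi) p) -[g (phi p)]/((g \o phi) p) -tanM //; exact: sc.
- by move=> f sf; rewrite asboolF.
Qed.

Lemma pushE (M N : manifold R) (phi : M -> N) p (u : tangent p) (g : N -> R) :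
  smooth_map phi -> smooth g -> push phi u g = u (g \o phi).
Proof. by move=> sp sg; rewrite tanE ?asboolT //; exact: push_derivation. Qed.

Lemma push_linear (M N : manifold R) (phi : M -> N) p (a : R) (u v : tangent p) : smooth_map phi ->
  push phi (a *: u + v) = a *: push phi u + push phi v.
Proof. by move=> sp; apply: tan_eq => g sg; rewrite tan_addE tan_scaleE !pushE. Qed.

Lemma pushD (M N : manifold R) (phi : M -> N) p (u v : tangent p) : smooth_map phi ->
  push phi (u + v) = push phi u + push phi v.
Proof. by move=> sp; apply: tan_eq => g sg; rewrite tan_addE !pushE. Qed.

Lemma push0 (M N : manifold R) (phi : M -> N) p : smooth_map phi ->
  push phi (0 : tangent p) = 0.
Proof. by move=> sp; apply: tan_eq => g sg; rewrite pushE // !tan_zeroE. Qed.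

Lemma pushZ (M N : manifold R) (phi : M -> N) p (a : R) (u : tangent p) : smooth_map phi ->
  push phi (a *: u) = a *: push phi u.
Proof. by move=> sp; apply: tan_eq => g sg; rewrite tan_scaleE !pushE. Qed.

Lemma pushN (M N : manifold R) (phi : M -> N) p (u : tangent p) : smooth_map phi ->
  push phi (- u) = - push phi u.
Proof. by move=> sp; apply: tan_eq => g sg; rewrite tan_oppE !pushE. Qed.

Lemma push_comp (M N P : manifold R) (phi : M -> N) (psi : N -> P) p (u : tangent p) :
  smooth_map phi -> smooth_map psi -> push (psi \o phi) u = push psi (push phi u).
Proof.
move=> s1 s2; apply: tan_eq => g sg; rewrite !pushE //; first exact: smooth_comp.
exact: smooth_map_comp.
Qed.

End PushTheory.

(** * Differential forms *)

Section Forms.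
Variables (R : realType) (M : manifold R).
Local Notation n := (mdim M).
Implicit Types (p q : M) (f g : M -> R) (X Y Z : vfield M) (al : form1 M).

Section Covectors.
Variables (p : M) (xi : covector p) (lxi : covec_linear xi).

Lemma covD u v : xi (u + v) = xi u + xi v.
Proof. by have := lxi 1 u v; rewrite scale1r mul1r. Qed.

Lemma cov0 : xi 0 = 0.
Proof. by have := lxi (-1) 0 0; rewrite scaler0 addr0 mulN1r addNr. Qed.

Lemma covZ a u : xi (a *: u) = a * xi u.
Proof. by have := lxi a u 0; rewrite !addr0 cov0 addr0. Qed.

Lemma covN u : xi (- u) = - xi u.
Proof. by rewrite -scaleN1r covZ mulN1r. Qed.

Lemma covB u v : xi (u - v) = xi u - xi v.
Proof. by rewrite covD covN. Qed.

Lemma cov_sum (I : Type) (r : seq I) (P : pred I) (F : I -> tangent p) :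
  xi (\sum_(i <- r | P i) F i) = \sum_(i <- r | P i) xi (F i).
Proof. by elim/big_rec2: _ => [|i y x _ <-]; [exact: cov0|rewrite covD]. Qed.

End Covectors.

Lemma dfun_linear f p : covec_linear (dfun f p).
Proof. by move=> a u v. Qed.

Lemma tan_linE f p (a : R) (u v : tangent p) : tan_val (a *: u + v) f = a * u f + v f.
Proof. by []. Qed.

Lemma dfun_form1 f : smooth f -> is_form1 (dfun f).
Proof. by move=> sf; split=> [p|X hX]; [exact: dfun_linear|exact: hX]. Qed.

Lemma form2_linr (F : form2 M) p u : is_form2 F -> covec_linear (F p u).
Proof. by case. Qed.

Lemma form2_skew (F : form2 M) p u v : is_form2 F -> F p u v = - F p v u.
Proof. by case. Qed.

Lemma form2_linl (F : form2 M) p v : is_form2 F -> covec_linear (fun u => F p u v).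
Proof. by move=> hF a u w; rewrite !(form2_skew _ v hF) (form2_linr v hF) opprD mulrN. Qed.

(** The functions of a local frame are globally defined, so a combination of their differentials
    with constant coefficients is a form on all of [M]. *)
Lemma covector_extend p (xi : covector p) : covec_linear xi ->
  exists al : form1 M, is_form1 al /\ forall u, al p u = xi u.
Proof.
move=> lxi; have [x [E [W [[oW Wp] sx sE hE _]]]] := local_frame p.
exists (fun q u => \sum_i xi (E i p) * u (x i)); split.
  split=> [q a u v|X hX].
    rewrite mulr_sumr -big_split; apply: eq_bigr => i _ /=.
    by rewrite tan_linE; ring.
  by apply: smooth_sum => i _; apply: smoothZ; exact: hX.
move=> u; rewrite {2}(hE p u Wp) cov_sum //; apply: eq_bigr => i _.
by rewrite covZ // mulrC.
Qed.

(** The [x i] are arbitrary smooth functions indexed by any finite type, not necessarily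
    coordinates: in this way presentations as sums of a_i dx_i pull back along every smooth map. *)
Definition loc1 (I : finType) (W : set M) (x a : I -> M -> R) (al : form1 M) : Prop :=
  [/\ open W, (forall i, smooth (x i)), (forall i, smooth (a i)) &
      forall q (u : tangent q), W q -> al q u = \sum_i a i q * u (x i)].

Definition loc2 (I : finType) (W : set M) (x : I -> M -> R) (c : I -> I -> M -> R) (F : form2 M) : Prop :=
  [/\ open W, (forall i, smooth (x i)), (forall i j, smooth (c i j)),
      (forall i j q, W q -> c i j q = - c j i q) &
      forall q (u v : tangent q), W q -> F q u v = \sum_i \sum_j c i j q * (u (x i) * v (x j))].

Section InBox.
Variables (p : M) (U : set M) (c : chart R M n) (r : R) (b : 'rV[R]_n -> R) (hb : box p U c r b).

Lemma form1_box (al : form1 M) : is_form1 al ->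
  loc1 (boxW p c r) (chart_coord c b) (fun i q => al q (chart_field c b i q)) al.
Proof.
move=> [la sa]; split; [exact: (boxW_open hb)|exact: (chart_coord_smooth hb)| |].
  by move=> i; apply: sa; exact: (chart_field_vfield hb).
move=> q u Wq; rewrite {1}(chart_frame hb u Wq) cov_sum //; apply: eq_bigr => i _.
by rewrite covZ // mulrC.
Qed.

Lemma form2_box (F : form2 M) : is_form2 F ->
  loc2 (boxW p c r) (chart_coord c b) (fun i j q => F q (chart_field c b i q) (chart_field c b j q)) F.
Proof.
move=> hF; have [lF kF sF] := hF.
split; [exact: (boxW_open hb)|exact: (chart_coord_smooth hb)| |by []|].
  by move=> i j; apply: sF; exact: (chart_field_vfield hb).
move=> q u v Wq; rewrite {1}(chart_frame hb u Wq) (cov_sum (form2_linl v hF)); apply: eq_bigr => i _.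
rewrite (covZ (form2_linl v hF)) {1}(chart_frame hb v Wq) cov_sum // mulr_sumr; apply: eq_bigr => j _.
by rewrite covZ //; ring.
Qed.

End InBox.

Lemma form1_local al p : is_form1 al -> exists W x a, W p /\ @loc1 'I_n W x a al.
Proof.
move=> hal; have [c [r [b hb]]] := @box_exists R M p setT openT I.
by eexists; eexists; eexists; split; [exact: (boxW_self hb)|exact: (form1_box hb hal)].
Qed.

Lemma form2_local (F : form2 M) p : is_form2 F -> exists W x c, W p /\ @loc2 'I_n W x c F.
Proof.
move=> hF; have [c [r [b hb]]] := @box_exists R M p setT openT I.
by eexists; eexists; eexists; split; [exact: (boxW_self hb)|exact: (form2_box hb hF)].
Qed.

Lemma is_form1_local (al : form1 M) : (forall p, covec_linear (al p)) ->
  (forall p, exists (I : finType) W x a, W p /\ @loc1 I W x a al) -> is_form1 al.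
Proof.
move=> la h; split=> // X hX; apply: smooth_local => p.
have [I [W [x [a [Wp [oW sx sa e]]]]]] := h p.
exists W, (fun q => \sum_i a i q * X q (x i)); split=> // [|q Wq]; last by rewrite e.
by apply: smooth_sum => i _; apply: (smoothM (sa i)); exact: hX.
Qed.

Lemma is_form2_local (F : form2 M) : (forall p u, covec_linear (F p u)) ->
  (forall p u v, F p u v = - F p v u) ->
  (forall p, exists (I : finType) W x c, W p /\ @loc2 I W x c F) -> is_form2 F.
Proof.
move=> lF kF h; split=> // X Y hX hY; apply: smooth_local => p.
have [I [W [x [c [Wp [oW sx sc _ e]]]]]] := h p.
exists W, (fun q => \sum_i \sum_j c i j q * (X q (x i) * Y q (x j))); split=> // [|q Wq]; last by rewrite e.
apply: smooth_sum => i _; apply: smooth_sum => j _; apply: (smoothM (sc i j)).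
by apply: smoothM; [exact: hX|exact: hY].
Qed.

Lemma form1_apply_smooth al X : is_form1 al -> is_vfield X -> smooth (fun q => al q (X q)).
Proof. by case=> _; apply. Qed.

Lemma form2_apply_smooth (F : form2 M) X Y : is_form2 F -> is_vfield X -> is_vfield Y ->
  smooth (fun q => F q (X q) (Y q)).
Proof. by case=> _ _; apply. Qed.

(** When the invariant formula is expanded in a presentation, second derivatives cancel against the
    bracket. The result depends on [X p] and [Y p] only, which makes the choice in [extend] harmless
    for [ext_d1]. *)
Lemma d1_local (I : finType) W (x a : I -> M -> R) al X Y p : is_form1 al -> loc1 W x a al -> W p ->
  is_vfield X -> is_vfield Y ->
  X p (fun q => al q (Y q)) - Y p (fun q => al q (X q)) - al p (bracket X Y p) =
  \sum_i (X p (a i) * Y p (x i) - Y p (a i) * X p (x i)).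
Proof.
move=> hal [oW sx sa e] Wp hX hY.
have key X' Y' : is_vfield X' -> is_vfield Y' ->
    X' p (fun q => al q (Y' q)) = \sum_i (a i p * X' p (fun q => Y' q (x i)) + Y' p (x i) * X' p (a i)).
  move=> hX' hY'; have sY i : smooth (fun q => Y' q (x i)) by exact: hY'.
  rewrite (tan_local (X' p) oW Wp (form1_apply_smooth hal hY') (g := fun q => \sum_i a i q * Y' q (x i))).
  - rewrite tan_sum => [|i _]; last exact: (smoothM (sa i)).
    by apply: eq_bigr => i _; rewrite tanM.
  - by apply: smooth_sum => i _; exact: (smoothM (sa i)).
  - by move=> q Wq; rewrite e.
rewrite !key // e // -!sumrB; apply: eq_bigr => i _.
by rewrite bracketE //; ring.
Qed.

Lemma ext_d1_loc (I : finType) W (x a : I -> M -> R) al p u v : is_form1 al -> loc1 W x a al -> W p ->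
  ext_d1 al p u v = \sum_i (u (a i) * v (x i) - v (a i) * u (x i)).
Proof.
move=> hal hl Wp; rewrite /ext_d1 (d1_local hal hl Wp (extend_vfield u) (extend_vfield v)).
by rewrite !extendE.
Qed.

Lemma ext_d1E al X Y p : is_form1 al -> is_vfield X -> is_vfield Y ->
  ext_d1 al p (X p) (Y p) = X p (fun q => al q (Y q)) - Y p (fun q => al q (X q)) - al p (bracket X Y p).
Proof.
move=> hal hX hY; have [W [x [a [Wp hl]]]] := form1_local p hal.
by rewrite (ext_d1_loc _ _ hal hl Wp) (d1_local hal hl Wp hX hY).
Qed.

Lemma ext_d1_form2 al : is_form1 al -> is_form2 (ext_d1 al).
Proof.
move=> hal; split.
- move=> p u a v w; have [W [x [c [Wp hl]]]] := form1_local p hal.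
  rewrite !(ext_d1_loc _ _ hal hl Wp) mulr_sumr -big_split; apply: eq_bigr => i _ /=.
  by rewrite !tan_linE; ring.
- move=> p u v; have [W [x [c [Wp hl]]]] := form1_local p hal.
  rewrite !(ext_d1_loc _ _ hal hl Wp) -sumrN; apply: eq_bigr => i _.
  by ring.
- move=> X Y hX hY; apply: (@smooth_ext _ _ (fun p => X p (fun q => al q (Y q)) - Y p (fun q => al q (X q)) - al p (bracket X Y p))).
    apply: smoothB; last by apply: form1_apply_smooth => //; exact: bracket_vfield.
    by apply: smoothB; [apply: hX; exact: form1_apply_smooth|apply: hY; exact: form1_apply_smooth].
  by move=> p; rewrite ext_d1E.
Qed.

Lemma skew_sum0 (I : finType) (c : I -> I -> R) (A B : I -> R) : (forall i j, c i j = - c j i) ->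
  \sum_i \sum_j c i j * (A i * B j + B i * A j) = 0.
Proof.
move=> kc; have : \sum_i \sum_j c i j * (A i * B j + B i * A j) = - \sum_i \sum_j c i j * (A i * B j + B i * A j).
  rewrite [LHS]exchange_big -sumrN; apply: eq_bigr => i _; rewrite -sumrN; apply: eq_bigr => j _.
  by rewrite (kc j i); ring.
by lra.
Qed.

Definition d2_expr (F : form2 M) X Y Z p : R :=
  X p (fun q => F q (Y q) (Z q)) - Y p (fun q => F q (X q) (Z q)) + Z p (fun q => F q (X q) (Y q))
  - F p (bracket X Y p) (Z p) + F p (bracket X Z p) (Y p) - F p (bracket Y Z p) (X p).

Lemma d2_local (I : finType) W (x : I -> M -> R) c (F : form2 M) X Y Z p : is_form2 F -> loc2 W x c F -> W p ->
  is_vfield X -> is_vfield Y -> is_vfield Z ->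
  d2_expr F X Y Z p =
  \sum_i \sum_j (X p (c i j) * (Y p (x i) * Z p (x j)) - Y p (c i j) * (X p (x i) * Z p (x j))
     + Z p (c i j) * (X p (x i) * Y p (x j))).
Proof.
move=> hF [oW sx sc kc e] Wp hX hY hZ; rewrite /d2_expr.
have key X' Y' Z' : is_vfield X' -> is_vfield Y' -> is_vfield Z' ->
    X' p (fun q => F q (Y' q) (Z' q)) = \sum_i \sum_j (c i j p * (Y' p (x i) * X' p (fun q => Z' q (x j))
      + Z' p (x j) * X' p (fun q => Y' q (x i))) + Y' p (x i) * Z' p (x j) * X' p (c i j)).
  move=> hX' hY' hZ'; have sY i : smooth (fun q => Y' q (x i)) by exact: hY'.
  have sZ i : smooth (fun q => Z' q (x i)) by exact: hZ'.
  have sYZ i j : smooth (fun q => Y' q (x i) * Z' q (x j)) by exact: smoothM.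
  have scYZ i j : smooth (fun q => c i j q * (Y' q (x i) * Z' q (x j))) by exact: (smoothM (sc i j)).
  rewrite (tan_local (X' p) oW Wp (form2_apply_smooth hF hY' hZ')
    (g := fun q => \sum_i \sum_j c i j q * (Y' q (x i) * Z' q (x j)))).
  - rewrite tan_sum => [|i _]; last by apply: smooth_sum => j _.
    apply: eq_bigr => i _; rewrite tan_sum //; apply: eq_bigr => j _.
    by rewrite tanM // tanM.
  - by apply: smooth_sum => i _; apply: smooth_sum => j _.
  - by move=> q Wq; rewrite e.
rewrite (form2_skew (bracket X Z p) _ hF) (form2_skew (bracket Y Z p) _ hF) !opprK !key // !e //.
(* What the bracket terms leave over is symmetric in the two indices and contracted with skew
   coefficients; it is added as this zero before the comparison term by term. *)
have zero := @skew_sum0 I (fun i j => c i j p) (fun i => Z p (fun q => X q (x i))) (fun i => Y p (x i))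
  (fun i j => kc i j p Wp).
rewrite -[RHS]addr0 -[X in _ = _ + X]zero -!sumrN -!big_split /=; apply: eq_bigr => i _.
rewrite -!sumrN -!big_split /=; apply: eq_bigr => j _.
by rewrite !bracketE //; ring.
Qed.

Lemma ext_d2_loc (I : finType) W (x : I -> M -> R) c (F : form2 M) p u v w : is_form2 F -> loc2 W x c F -> W p ->
  ext_d2 F p u v w =
  \sum_i \sum_j (u (c i j) * (v (x i) * w (x j)) - v (c i j) * (u (x i) * w (x j))
     + w (c i j) * (u (x i) * v (x j))).
Proof.
move=> hF hl Wp.
have := d2_local hF hl Wp (extend_vfield u) (extend_vfield v) (extend_vfield w).
by rewrite !extendE.
Qed.

Lemma ext_d2E (F : form2 M) X Y Z p : is_form2 F -> is_vfield X -> is_vfield Y -> is_vfield Z ->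
  ext_d2 F p (X p) (Y p) (Z p) = d2_expr F X Y Z p.
Proof.
move=> hF hX hY hZ; have [W [x [c [Wp hl]]]] := form2_local p hF.
by rewrite (ext_d2_loc _ _ _ hF hl Wp) (d2_local hF hl Wp).
Qed.

Lemma closed1E al X Y p : is_form1 al -> closed1 al -> is_vfield X -> is_vfield Y ->
  X p (fun q => al q (Y q)) - Y p (fun q => al q (X q)) = al p (bracket X Y p).
Proof. by move=> hal cal hX hY; have := cal p (X p) (Y p); rewrite ext_d1E // => /eqP; rewrite subr_eq0 => /eqP. Qed.

Lemma ext_d1_closed al : is_form1 al -> closed2 (ext_d1 al).
Proof.
move=> hal p u v w; have [W [x [a [Wp hl]]]] := form1_local p hal.
have [oW sx sa e] := hl; have hF := ext_d1_form2 hal.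
(* The differential is the sum of the da_i wedge dx_i: presented in the functions [a i] and [x i]
   together, its coefficients are constants, and tangent vectors kill constants. *)
pose y (k : 'I_n + 'I_n) := match k with inl i => a i | inr i => x i end.
pose c (k l : 'I_n + 'I_n) : M -> R := fun=> match k, l with
  | inl i, inr j => (i == j)%:R | inr i, inl j => - (i == j)%:R | _, _ => 0 end.
have hl2 : loc2 W y c (ext_d1 al).
  split=> //.
  - by case.
  - by move=> k l; exact: smooth_cst.
  - by move=> [i|i] [j|j] q _ /=; rewrite /c ?oppr0 ?opprK // eq_sym.
  - move=> q u' v' Wq; rewrite (ext_d1_loc _ _ hal hl Wq) big_sumType /= -big_split.
    apply: eq_bigr => i _ /=; rewrite !big_sumType /= /c.
    rewrite [X in _ = (X + _) + _]big1 ?add0r => [|j _]; last by rewrite mul0r.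
    rewrite [X in _ = _ + (_ + X)]big1 ?addr0 => [|j _]; last by rewrite mul0r.
    rewrite (bigD1 i) //= big1 ?addr0 => [|j ji]; last by rewrite eq_sym (negbTE ji) mul0r.
    rewrite (bigD1 i) //= big1 ?addr0 => [|j ji]; last by rewrite eq_sym (negbTE ji) oppr0 mul0r.
    by rewrite eqxx /=; ring.
rewrite (ext_d2_loc _ _ _ hF hl2 Wp) big1 // => k _; rewrite big1 // => l _.
by rewrite !tan_cst !mul0r subr0 addr0.
Qed.

Lemma inv_form_unique (om : form2 M) p (xi : covector p) v : is_form2 om -> Defs.nondegenerate om ->
  (forall w, om p v w = xi w) -> inv_form om p xi = v.
Proof.
move=> hom nd hv; rewrite /inv_form; case: xgetP => [u _ hu|/(_ v)]; last by case.
apply/eqP; rewrite -subr_eq0; apply/eqP/nd => w.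
by rewrite (covB (form2_linl w hom)) hu hv subrr.
Qed.

(** * The inverse of a nondegenerate 2-form *)

Section InverseForm.
Variables (om : form2 M).
Arguments om : clear implicits.
Hypotheses (hom : is_form2 om) (nd : Defs.nondegenerate om).

(** Cramer's rule in a local frame: the matrix of [om] has smooth entries, its adjugate too, and
    [smooth_localV] inverts its determinant near [p]. *)
Lemma inv_form_smooth_aux p : exists W, [/\ open W, W p &
  forall al : form1 M, (forall q, covec_linear (al q)) ->
    exists v : forall q, tangent q, (forall q, W q -> forall w, om q (v q) w = al q w) /\
      (is_form1 al -> is_vfield v)].
Proof.
have [x [E [W [[oW Wp] sx sE hE dE]]]] := local_frame p.
pose A q : 'M[R]_n := \matrix_(i, j) om q (E i q) (E j q).
have omA q (u : 'rV[R]_n) j : W q -> om q (\sum_i u 0 i *: E i q) (E j q) = (u *m A q) 0 j.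
  move=> Wq; rewrite (cov_sum (form2_linl _ hom)) mxE; apply: eq_bigr => i _.
  by rewrite (covZ (form2_linl _ hom)) mxE.
(* A row vector killed by the matrix gives a combination of the frame lying in the kernel of [om],
   hence 0, while the frame is independent. *)
have detp : \det (A p) != 0.
  apply/negP => /det0P [u u0 hu]; case/negP: u0.
  have uE0 : \sum_i u 0 i *: E i p = 0.
    apply: nd => v; rewrite {1}(hE p v Wp) (cov_sum (form2_linr _ hom)) big1 // => j _.
    by rewrite (covZ (form2_linr _ hom)) omA // hu mxE mulr0.
  apply/eqP/rowP => j; rewrite mxE; have := congr1 (fun w : tangent p => w (x j)) uE0.
  rewrite tan_sumE (bigD1 j) //= tan_scaleE dE // eqxx mulr1 big1 ?addr0 ?tan_zeroE //.
  by move=> i ij; rewrite tan_scaleE dE // (negbTE ij) mulr0.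
have sA i j : smooth (fun q => A q i j).
  by apply: smooth_ext (form2_apply_smooth hom (sE i) (sE j)) _ => q; rewrite mxE.
have sdet m (B : M -> 'M[R]_m) : (forall i j, smooth (fun q => B q i j)) -> smooth (fun q => \det (B q)).
  move=> sB; rewrite /determinant; apply: smooth_sum => s _; apply: smoothM; first exact: smooth_cst.
  by apply: smooth_prod => i _; exact: sB.
have [g [V [sg oV Vp hg]]] := smooth_localV (sdet n A sA) detp.
have sadj i j : smooth (fun q => (\adj (A q)) i j).
  apply: (@smooth_ext _ _ (fun q => (-1) ^+ (j + i) * \det (row' j (col' i (A q))))).
    apply: smoothM; first exact: smooth_cst.
    by apply: sdet => k l; apply: smooth_ext (sA (lift j k) (lift i l)) _ => q; rewrite !mxE.
  by move=> q; rewrite [in RHS]mxE.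
exists (W `&` V); split; [exact: openI|by split|move=> al lal].
pose cf i q := \sum_j al q (E j q) * (g q * (\adj (A q)) j i).
exists (fun q => \sum_i cf i q *: E i q); split.
  move=> q [Wq Vq] w.
  have e1 : \sum_i cf i q *: E i q = \sum_i ((\row_j al q (E j q)) *m (g q *: \adj (A q))) 0 i *: E i q.
    apply: eq_bigr => i _; congr (_ *: _); rewrite mxE; apply: eq_bigr => j _.
    have -> : (g q *: \adj (A q)) j i = g q * (\adj (A q)) j i by rewrite [LHS]mxE.
    by congr (_ * _); rewrite mxE.
  rewrite e1 {1}(hE q w Wq) (cov_sum (form2_linr _ hom)) [in RHS](hE q w Wq) cov_sum //.
  apply: eq_bigr => j _; rewrite (covZ (form2_linr _ hom)) (covZ (lal q)) omA //; congr (_ * _).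
  by rewrite -mulmxA -scalemxAl mul_adj_mx scale_scalar_mx mulrC hg // mulmx1 mxE.
move=> hal; apply: vfield_sum => i _; apply: vfieldZ => //; apply: smooth_sum => j _.
apply: smoothM; first exact: form1_apply_smooth.
exact: smoothM.
Qed.

Lemma inv_formP p (xi : covector p) : covec_linear xi -> forall w, om p (inv_form om p xi) w = xi w.
Proof.
move=> lxi; have [al [[lal _] e]] := covector_extend lxi.
have [W [oW Wp h]] := inv_form_smooth_aux p; have [v [hv _]] := h al lal.
have hv' w : om p (v p) w = xi w by rewrite hv.
by move=> w; rewrite (inv_form_unique hom nd hv').
Qed.

Lemma inv_form_linear p (a : R) (xi et : covector p) : covec_linear xi -> covec_linear et ->
  inv_form om p (fun u => a * xi u + et u) = a *: inv_form om p xi + inv_form om p et.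
Proof.
move=> lxi let_; apply: (inv_form_unique hom nd) => w.
by rewrite (form2_linl w hom) !inv_formP.
Qed.

Lemma inv_form_vfield al : is_form1 al -> is_vfield (fun p => inv_form om p (al p)).
Proof.
move=> hal f sf; apply: smooth_local => p.
have [W [oW Wp h]] := inv_form_smooth_aux p; have [v [hv sv]] := h al hal.1.
exists W, (fun q => v q f); split=> //; first exact: sv.
by move=> q Wq; rewrite (inv_form_unique hom nd (hv q Wq)).
Qed.

End InverseForm.

End Forms.

(** * Pullback of forms and its commutation with d *)

Section Pullback.
Variables (R : realType) (M N : manifold R) (phi : M -> N) (sphi : smooth_map phi).
Implicit Types (F : form2 N) (al : form1 N).

Lemma preim_open (W : set N) : open W -> open (phi @^-1` W).
Proof. by move=> oW; apply: open_comp => // x _; apply sphi.1. Qed.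

Lemma pullback1_loc (I : finType) W (x a : I -> N -> R) al : loc1 W x a al ->
  loc1 (phi @^-1` W) (fun i => x i \o phi) (fun i => a i \o phi) (pullback1 phi al).
Proof.
move=> [oW sx sa e]; split; [exact: preim_open|by move=> i; exact: smooth_comp|by move=> i; exact: smooth_comp|].
move=> q u Wq; rewrite /pullback1 e //; apply: eq_bigr => i _; by rewrite pushE.
Qed.

Lemma pullback2_loc (I : finType) W (x : I -> N -> R) c F : loc2 W x c F ->
  loc2 (phi @^-1` W) (fun i => x i \o phi) (fun i j => c i j \o phi) (pullback2 phi F).
Proof.
move=> [oW sx sc kc e]; split; [exact: preim_open|by move=> i; exact: smooth_comp|by move=> i j; exact: smooth_comp| |].
  by move=> i j q Wq; exact: kc.
move=> q u v Wq; rewrite /pullback2 e //; apply: eq_bigr => i _; apply: eq_bigr => j _.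
by rewrite !pushE.
Qed.

Lemma pullback1_form1 al : is_form1 al -> is_form1 (pullback1 phi al).
Proof.
move=> hal; apply: is_form1_local => [p a u v|p].
  by rewrite /pullback1 push_linear // hal.1.
have [W [x [a [Wp hl]]]] := form1_local (phi p) hal.
by eexists _, _, _, _; split; last exact: pullback1_loc hl.
Qed.

Lemma pullback2_form2 F : is_form2 F -> is_form2 (pullback2 phi F).
Proof.
move=> hF; apply: is_form2_local => [p u a v w|p u v|p].
- by rewrite /pullback2 push_linear // (form2_linr _ hF).
- by rewrite /pullback2 (form2_skew _ _ hF).
have [W [x [c [Wp hl]]]] := form2_local (phi p) hF.
by eexists _, _, _, _; split; last exact: pullback2_loc hl.
Qed.

(** A presentation pulls back to a presentation, and the local formula for d involves only values of
    tangent vectors on its functions. *)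
Lemma ext_d1_pullback al p u v : is_form1 al ->
  ext_d1 (pullback1 phi al) p u v = ext_d1 al (phi p) (push phi u) (push phi v).
Proof.
move=> hal; have [W [x [a [Wp hl]]]] := form1_local (phi p) hal.
rewrite (ext_d1_loc _ _ (pullback1_form1 hal) (pullback1_loc hl) Wp) (ext_d1_loc _ _ hal hl Wp).
by case: hl => _ sx sa _; apply: eq_bigr => i _; rewrite !pushE.
Qed.

Lemma ext_d2_pullback F p u v w : is_form2 F ->
  ext_d2 (pullback2 phi F) p u v w = ext_d2 F (phi p) (push phi u) (push phi v) (push phi w).
Proof.
move=> hF; have [W [x [c [Wp hl]]]] := form2_local (phi p) hF.
rewrite (ext_d2_loc _ _ _ (pullback2_form2 hF) (pullback2_loc hl) Wp) (ext_d2_loc _ _ _ hF hl Wp).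
by case: hl => _ sx sc _ _; apply: eq_bigr => i _; apply: eq_bigr => j _; rewrite !pushE.
Qed.

Lemma closed1_pullback al : is_form1 al -> closed1 al -> closed1 (pullback1 phi al).
Proof. by move=> hal cal p u v; rewrite ext_d1_pullback. Qed.

Lemma closed2_pullback F : is_form2 F -> closed2 F -> closed2 (pullback2 phi F).
Proof. by move=> hF cF p u v w; rewrite ext_d2_pullback. Qed.

End Pullback.

(** * Integral curves and completeness *)

Section Curves.
Variables (R : realType) (M : manifold R).
Local Notation n := (mdim M).
Implicit Types (p q : M) (f : M -> R) (X Y : vfield M) (J : set R) (g h : R -> M).

Lemma icurve_derive J X g (t : R) f : integral_curve J X g -> J t -> smooth f ->
  is_derive t 1 (fun s => f (g s)) (X (g t) f : R).
Proof. by move=> hg Jt sf; exact: hg. Qed.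

Lemma icurveI J X g : (forall (t : R) f, J t -> smooth f -> is_derive t 1 (fun s => f (g s)) (X (g t) f : R)) ->
  integral_curve J X g.
Proof. by move=> h t Jt f sf; exact: h. Qed.

Lemma icurve_sub J J' X g : J' `<=` J -> integral_curve J X g -> integral_curve J' X g.
Proof. by move=> s h t /s; exact: h. Qed.

(** [integral_curve] does not mention continuity. It comes from testing a bump function at [g t]:
    its values along the curve are differentiable in time, so they stay positive nearby. *)
Lemma icurve_continuous J X g (t : R) : integral_curve J X g -> J t -> {for t, continuous g}.
Proof.
move=> hg Jt; rewrite /prop_for /continuous_at => A; rewrite nbhsE => -[U [oU Up] sUA].
have [b [K [sb [cK sK] bK bI [W [oW Wp] bW]]]] := bump_manifold oU Up.
have [db _] := icurve_derive hg Jt sb.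
have cb : {for t, continuous (fun s => b (g s))}.
  by apply: differentiable_continuous; apply/derivable1_diffP.
have H : nbhs t [set s | 0 < b (g s)].
  apply: (cb [set y | 0 < y]); rewrite bW //.
  by apply: open_nbhs_nbhs; split; [exact: open_gt|exact: ltr01].
apply: filterS H => s /= bq; apply: sUA; apply: sK.
by apply: contrapT => Kq; move: bq; rewrite bK // ltxx.
Qed.

Section LocalField.
Variables (p : M) (U : set M) (c : chart R M n) (r : R) (b : 'rV[R]_n -> R) (hb : box p U c r b).
Variables (X : vfield M) (hX : is_vfield X).

Definition local_field (k : 'I_n) (y : 'rV[R]_n) : R := b y * X (cinv c y) (chart_coord c b k).

Lemma local_field_ccs k : ccs (local_field k).
Proof.
have sh : smooth_on (cimg c) ((fun q => X q (chart_coord c b k)) \o cinv c).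
  exact: (vfieldP hX (chart_coord_smooth hb k)) (box_chart hb).
exact: (box_cut_ccs hb sh).
Qed.

Lemma local_fieldE k q : boxW p c r q -> local_field k (cmap c q) = X q (chart_coord c b k).
Proof.
move=> [cq hq]; case: (hb) => -[ac cp] _ _ _ b1.
by rewrite /local_field b1 ?mul1r ?cmapK // ltW.
Qed.

Lemma chart_coordE k q : boxW p c r q -> chart_coord c b k q = cmap c q 0 k.
Proof. by move=> Wq; rewrite /chart_coord (bextE hb). Qed.

Lemma boxW_inj q q' : boxW p c r q -> boxW p c r q' ->
  (forall k, chart_coord c b k q = chart_coord c b k q') -> q = q'.
Proof.
move=> Wq Wq' e; have ac := box_chart hb.
rewrite -(cmapK ac (boxW_cdom Wq)) -(cmapK ac (boxW_cdom Wq')); congr (cinv c _).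
by apply/rowP => k; rewrite -!chart_coordE.
Qed.

End LocalField.

Lemma is_derive_shift_arg (w : R -> R) (a t : R) d : is_derive (t + a) 1 w d ->
  is_derive t 1 (fun s => w (s + a)) d.
Proof.
move=> h; have h1 : is_derive t 1 (fun s : R => s + a) 1.
  by apply: is_derive_ext (is_deriveD (is_derive_id t (1 : R)) (is_derive_cst a t (1 : R))) _ _ => //; rewrite addr0.
by have := is_derive1_comp (g := fun s : R => s + a) h h1; rewrite mulr1.
Qed.

Lemma icurve_shift J X g (a : R) : integral_curve J X g ->
  integral_curve [set t | J (t + a)] X (fun t => g (t + a)).
Proof.
move=> hg; apply: icurveI => t f Jt sf.
exact: (is_derive_shift_arg (icurve_derive hg Jt sf)).
Qed.

(** For times close to [t0] both curves stay in one box, where they solve the same compactly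
    supported equation on R^n; [rcurve_unique] applies after a shift of time. *)
Lemma icurve_unique_local J X g h (t0 : R) : is_vfield X -> open J -> integral_curve J X g -> integral_curve J X h ->
  J t0 -> g t0 = h t0 -> \forall t \near t0, g t = h t.
Proof.
move=> hX oJ hg hh Jt0 e.
have [c [r [b hb]]] := @box_exists R M (g t0) setT openT I.
have oW := boxW_open hb; have Wp := boxW_self hb.
have : nbhs t0 [set t | [/\ J t, boxW (g t0) c r (g t) & boxW (g t0) c r (h t)]].
  near=> t; split; near: t; first exact: open_nbhs_nbhs.
    by apply: (icurve_continuous hg Jt0); exact: open_nbhs_nbhs.
  by apply: (icurve_continuous hh Jt0); rewrite -e; exact: open_nbhs_nbhs.
case/nbhs_ballP => d /= d0 hd; apply/nbhs_ballP; exists d => // t.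
rewrite -ball_normE /= distrC => td.
have hd' (s : R) : `|s| <= `|t - t0| -> [/\ J (s + t0), boxW (g t0) c r (g (s + t0)) & boxW (g t0) c r (h (s + t0))].
  move=> st; apply: hd; rewrite -ball_normE /= distrC addrK.
  exact: le_lt_trans st td.
have [Jt Wg Wh] := hd' _ (lexx `|t - t0|).
rewrite subrK in Jt Wg Wh.
apply: (boxW_inj hb Wg Wh) => k.
pose G (w : R -> M) s : 'rV[R]_n := \row_k chart_coord c b k (w (s + t0)).
have GE (w : R -> M) s : boxW (g t0) c r (w (s + t0)) -> G w s = cmap c (w (s + t0)).
  by move=> Ww; apply/rowP => j; rewrite mxE (chart_coordE hb).
have dG (w : R -> M) : integral_curve J X w -> (forall s : R, `|s| <= `|t - t0| -> boxW (g t0) c r (w (s + t0))) ->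
    forall (s : R) j, `|s| <= `|t - t0| -> is_derive s 1 (fun v : R => G w v 0 j) (local_field c b X j (G w s)).
  move=> hw Ww s j st; have [Js _ _] := hd' s st.
  rewrite GE ?(local_fieldE hb) //; try exact: Ww.
  apply: is_derive_ext (is_derive_shift_arg (icurve_derive hw Js (chart_coord_smooth hb j))) _ _ => //.
  by move=> q; rewrite mxE.
have E : G g (t - t0) = G h (t - t0).
  apply: (rcurve_unique (fun j => local_field_ccs hb hX j)).
  - by apply/rowP => j; rewrite !mxE add0r e.
  - by apply: dG => // s st; case: (hd' s st).
  - by apply: dG => // s st; case: (hd' s st).
by have := congr1 (fun w : 'rV_n => w 0 k) E; rewrite /= !mxE subrK.
Unshelve. all: by end_near. Qed.

Lemma points_separated p q : (forall f, smooth f -> f p = f q) -> p = q.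
Proof.
move=> h; apply: contrapT => pq.
have oU : open (~` [set q]).
  apply: closed_openC; apply: compact_closed; [exact: (@mfd_hausdorff R M)|exact: compact_set1].
have [b [K [sb [cK sK] bK bI [W [oW Wp] bW]]]] := bump_manifold oU pq.
have := h b sb; rewrite bW // bK; first by move/eqP; rewrite oner_eq0.
by move=> /sK /=.
Qed.

(** The set of agreement is open by local uniqueness, its complement in [J] is open because smooth
    functions separate points, and [J] is connected. *)
Lemma icurve_unique J X g h (t0 t : R) : is_vfield X -> open J -> is_interval J ->
  integral_curve J X g -> integral_curve J X h -> J t0 -> g t0 = h t0 -> J t -> g t = h t.
Proof.
move=> hX oJ /connected_intervalP cJ hg hh Jt0 e Jt.
pose B := [set s | J s /\ g s = h s].
have oN : open [set s | J s /\ g s <> h s].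
  rewrite openE => s [Js ne]; have [f [sf fne]] : exists f, smooth f /\ f (g s) <> f (h s).
    apply: contrapT => H; apply: ne; apply: points_separated => f sf.
    by apply: contrapT => fne; apply: H; exists f.
  have d1 := icurve_derive hg Js sf; have d2 := icurve_derive hh Js sf.
  have [d3 _] := is_deriveB d1 d2.
  have cb : {for s, continuous (fun s => f (g s) - f (h s))}.
    by apply: differentiable_continuous; apply/derivable1_diffP.
  have H : nbhs s [set s | f (g s) - f (h s) != 0].
    apply: (cb [set y | y != 0]); apply: open_nbhs_nbhs; split; first exact: open_neq.
    by apply/eqP => /eqP; rewrite subr_eq0 => /eqP.
  rewrite /interior; near=> q; split; first by near: q; exact: open_nbhs_nbhs.
  have : f (g q) - f (h q) != 0 by near: q.
  by move=> /eqP ne2 eq; apply: ne2; rewrite eq subrr.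
have oB : open B.
  rewrite openE => s [Js es]; rewrite /interior.
  have h1 := icurve_unique_local hX oJ hg hh Js es.
  near=> q; split; near: q; [exact: open_nbhs_nbhs|exact: h1].
have BJ : B = J.
  apply: cJ; first by exists t0.
    by exists B => //; apply/seteqP; split=> s; [move=> Bs; split=> //; case: Bs|case].
  exists (~` [set s | J s /\ g s <> h s]); first exact: open_closedC.
  apply/seteqP; split=> s; first by move=> [Js es]; split=> // -[].
  by move=> [Js ns]; split=> //; apply: contrapT => ne; apply: ns.
by move: Jt; rewrite -BJ => -[].
Unshelve. all: by end_near. Qed.

End Curves.

(** * Local flows in a chart *)

Section LocalFlow.
Variables (R : realType) (M : manifold R).
Local Notation n := (mdim M).
Variables (p : M) (c : chart R M n) (r : R) (b : 'rV[R]_n -> R) (hb : box p setT c r b).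
Variables (X : vfield M) (hX : is_vfield X).

Lemma chart_near (W : set M) q : open W -> W q -> cdom c q ->
  nbhs (cmap c q) [set x | [/\ cimg c x, W (cinv c x) & cmap c (cinv c x) = x]].
Proof.
move=> oW Wq cq; have ac := box_chart hb; have oV := cinv_preim_open ac oW.
apply: (@filterS _ (nbhs (cmap c q)) _ (cimg c `&` cinv c @^-1` W)).
  by move=> x [cx Wx]; split=> //; have [_ ->] := cinvP ac cx.
by apply: open_nbhs_nbhs; split=> //; split; [exact: cmap_img|rewrite /= cmapK].
Qed.

(** The flow on R^n of the cut-off field, read in the chart. The last clause interchanges space and
    time derivatives at time 0. It speaks of any smooth [G s] that agrees near [q] with the moved
    coordinate, because the latter is under control only locally. *)
Lemma local_flow : exists (W : set M) (th : R -> M -> M) (e : R),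
  [/\ [/\ open W, W p & W `<=` boxW p c r], 0 < e,
      forall q, W q -> th 0 q = q /\ integral_curve [set t | `|t| < e] X (th^~ q),
      forall t f, `|t| < e -> smooth f -> exists2 g, smooth g & forall q, W q -> f (th t q) = g q &
      forall k q (u : tangent q) (G : R -> M -> R), W q ->
        (forall s : R, `|s| < e -> smooth (G s) /\
           exists W', [/\ open W', W' q & forall q', W' q' -> G s q' = chart_coord c b k (th s q')]) ->
        is_derive (0 : R) 1 (fun s : R => u (G s) : R) (u (fun q => X q (chart_coord c b k)) : R)].
Proof.
have ac := box_chart hb; have [_ r0 hr [sb b0 b01] b1] := hb.
have hV j := local_field_ccs hb hX j; have [phi hphi] := rflow_exists hV.
have [K K0 hK] := rflow_bound hV hphi.
pose m : R := 2 * n.+1%:R; have m0 : 0 < m by rewrite mulr_gt0.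
pose W := boxW p c (r / 2).
pose th (t : R) q := cinv c (phi t (cmap c q)).
(* The speed in the chart is at most [K], so before time [e] a point of the half-size box moves by
   at most [r / 2] in the scale [m]; the 1 avoids a zero denominator. *)
pose e := r / 2 / (K * m + 1).
have Km : 0 < K * m + 1 by rewrite ltr_wpDl // mulr_ge0 // ltW.
have e0 : 0 < e by rewrite !divr_gt0.
have hW q (t : R) : W q -> `|t| < e -> `|phi t (cmap c q) - cmap c p| * m < r.
  move=> [cq Wq] te.
  have h1 : `|phi t (cmap c q) - cmap c p| <= K * `|t| + `|cmap c q - cmap c p|.
    apply: le_trans (lerD (hK t (cmap c q)) (lexx _)).
    exact: ler_distD.
  apply: le_lt_trans (ler_wpM2r (ltW m0) h1) _; rewrite mulrDl [r]splitr; apply: ler_ltD => //.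
  have : (K * m + 1) * `|t| <= r / 2.
    by apply: le_trans (ler_wpM2l (ltW Km) (ltW te)) _; rewrite /e mulrC divfK ?gt_eqF.
  by rewrite mulrDl mul1r mulrAC; apply: le_trans; rewrite lerDl.
have hI q (t : R) : W q -> `|t| < e -> [/\ cimg c (phi t (cmap c q)), boxW p c r (th t q) &
    cmap c (th t q) = phi t (cmap c q)].
  move=> Wq te; have h := hW q t Wq te; have [ci _] := hr _ (boxW_norm h).
  have [cd ce] := cinvP ac ci; split=> //; split=> //.
  by rewrite /preimage /= /th ce.
have oW : open W := boxW_open_at p (r / 2) ac.
have Wp : W p.
  by case: hb => -[_ cp] _ _ _ _; split=> //=; rewrite subrr normr0 mul0r divr_gt0.
have WB : W `<=` boxW p c r.
  move=> q [cq Wq]; split=> //; rewrite /preimage /=; apply: lt_le_trans Wq _.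
  by rewrite ler_pdivrMr // ler_peMr ?(ltW r0) // ler1n.
exists W, th, e; split=> //.
- move=> q Wq; split; first by rewrite /th hphi.1 cmapK //; case: Wq.
  apply: icurveI => t f te sf; have [ci Bt ce] := hI q t Wq te.
  have rE (v : 'rV[R]_n) : (\row_j v 0 j) = v by apply/rowP => j; rewrite mxE.
  have := @is_derive_curve R n (cimg c) (f \o cinv c) (fun j s => phi s (cmap c q) 0 j) _ t
    (cimg_open ac) _ (sf c ac 1%N) (fun j => hphi.2 (cmap c q) t j).
  rewrite rE => /(_ ci) h; apply: is_derive_ext h _ _ => [y|]; first by rewrite rE.
  rewrite (chart_expansion hb _ Bt sf) ce; apply: eq_bigr => j _; congr (_ * _).
  by rewrite -ce (local_fieldE hb).
- move=> t f te sf; pose F x := b x * (f \o cinv c) x.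
  have cF : ccs F := box_cut_ccs hb (sf c ac).
  exists (bext c b (F \o phi t)).
    apply: (bext_smooth hb) => k; apply: Ck_on_sub (_ : Ck_on k setT _) => //.
    have -> : F \o phi t = fun x => F (\row_j phi t x 0 j).
      by apply/funext => x /=; congr F; apply/rowP => j; rewrite mxE.
    apply: (Ck_on_comp openT openT) => //; first exact: cF.1.
    by move=> j; exact: (rflow_smooth t j hV hphi).
  move=> q Wq; rewrite (bextE hb) //=; last exact: WB.
  by rewrite /F /= b1 ?mul1r //; apply: ltW; exact: hW.
move=> k q u G Wq hG; have Bq := WB q Wq; have cq := boxW_cdom Bq.
have uE (f : M -> R) (g : 'rV[R]_n -> R) (W' : set M) : smooth f -> open W' -> W' q ->
    (forall q', W' q' -> cdom c q' -> f q' = g (cmap c q')) ->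
    u f = \sum_i u (chart_coord c b i) * 'D_(delta_mx 0 i) g (cmap c q) :> R.
  move=> sf oW' Wq' fg; rewrite (chart_expansion hb u Bq sf); apply: eq_bigr => i _; congr (_ * _).
  apply: near_eq_derive.
  apply: (@filterS _ (nbhs (cmap c q)) _ _ _ _ (chart_near (openI oW' (cdom_open ac)) (conj Wq' cq) cq)) => x [cx [Wx dx] ex].
  by rewrite /= fg // ex.
have -> : (u (fun q => X q (chart_coord c b k)) : R) =
    \sum_i u (chart_coord c b i) * 'D_(delta_mx 0 i) (local_field c b X k) (cmap c q).
  apply: (uE _ _ (boxW p c r)) => //; first exact: (hX (chart_coord_smooth hb k)).
    exact: (boxW_open hb).
  by move=> q' Bq' _; rewrite (local_fieldE hb).
apply: (@near_eq_is_derive _ R R (fun s => \sum_i u (chart_coord c b i) *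
    'D_(delta_mx 0 i) (fun x => phi s x 0 k) (cmap c q))).
  near=> s; have se : `|s| < e.
    by rewrite -[s]subr0; near: s; apply: cvgr_distC_lt => //; exact: cvg_id.
  have [sG [W' [oW' Wq' GE]]] := hG s se; symmetry; apply: (uE _ _ (W' `&` W)) => //.
    exact: openI.
  move=> q' [Wq2 W2] _; rewrite GE //; have [ci Bt ce] := hI q' s W2 se.
  by rewrite (chart_coordE hb) // ce.
have h i : is_derive (0 : R) 1 (fun s => u (chart_coord c b i) * 'D_(delta_mx 0 i) (fun x => phi s x 0 k) (cmap c q) : R)
    (u (chart_coord c b i) * 'D_(delta_mx 0 i) (local_field c b X k) (cmap c q)).
  exact: (is_deriveZ (u (chart_coord c b i) : R) (rflow_derive_derive (cmap c q) i k hV hphi)).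
by apply: is_derive_ext (is_derive_sum h) _ _ => // y; rewrite fct_sumE.
Unshelve. all: by end_near. Qed.

End LocalFlow.

(** * Gluing of integral curves and criteria for completeness *)

Section Completeness.
Variables (R : realType) (M : manifold R).
Local Notation n := (mdim M).
Implicit Types (p q : M) (f : M -> R) (X Y : vfield M) (J : set R) (g h : R -> M).

Definition sball (a : R) : set R := [set t | `|t| < a].

Lemma sball_open (a : R) : open (sball a).
Proof.
apply: (@open_comp _ _ (fun t : R => `|t|) [set y | y < a]); last exact: open_lt.
by move=> x _; exact: norm_continuous.
Qed.

Lemma sball_itv (a : R) : is_interval (sball a).
Proof.
move=> x y; rewrite /sball /= !ltr_norml => /andP[x1 x2] /andP[y1 y2] z /andP[z1 z2].
by rewrite ltr_norml; apply/andP; split; [exact: lt_le_trans x1 z1|exact: le_lt_trans z2 y2].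
Qed.

Lemma sball0 (a : R) : 0 < a -> sball a 0.
Proof. by rewrite /sball /= normr0. Qed.

Lemma shift_open J (a : R) : open J -> open [set t | J (t + a)].
Proof.
move=> oJ; apply: (@open_comp _ _ (fun t : R => t + a)) => // x _.
by apply: (@lip_continuous _ _ _ _ 1) => // y; rewrite mul1r opprD addrACA subrr addr0.
Qed.

Lemma shift_itv J (a : R) : is_interval J -> is_interval [set t | J (t + a)].
Proof.
move=> iJ x y Jx Jy z /andP[z1 z2]; apply: (iJ _ _ Jx Jy).
by rewrite !lerD2r z1.
Qed.

Lemma interval_setI J J' : is_interval J -> is_interval J' -> is_interval (J `&` J').
Proof.
move=> iJ iJ' x y [Jx J'x] [Jy J'y] z hz.
by split; [exact: (iJ _ _ Jx Jy)|exact: (iJ' _ _ J'x J'y)].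
Qed.

Lemma interval_setU J J' (t : R) : J t -> J' t -> is_interval J -> is_interval J' ->
  is_interval (J `|` J').
Proof.
move=> Jt J't /connected_intervalP cJ /connected_intervalP cJ'.
by apply/connected_intervalP; apply: connectedU => //; exists t.
Qed.

Lemma icurve_ext J X g h : open J -> (forall t, J t -> g t = h t) ->
  integral_curve J X g -> integral_curve J X h.
Proof.
move=> oJ gh hg; apply: icurveI => t f Jt sf; rewrite -gh //.
apply: (@near_eq_is_derive _ R R (fun s => f (g s))); last exact: icurve_derive Jt sf.
by apply: (@filterS _ (nbhs t) _ J) => [s /gh -> //|]; exact: open_nbhs_nbhs.
Qed.

Lemma icurve_field J X Y g : (forall t, J t -> X (g t) = Y (g t)) ->
  integral_curve J X g -> integral_curve J Y g.
Proof. by move=> XY hg; apply: icurveI => t f Jt sf; rewrite -XY //; exact: icurve_derive Jt sf. Qed.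

Lemma icurve_cst J X q : X q = 0 -> integral_curve J X (fun=> q).
Proof. by move=> Xq; apply: icurveI => t f Jt sf; rewrite Xq; exact: is_derive_cst. Qed.

Lemma icurve_setU J J' X g : open J -> open J' -> integral_curve J X g -> integral_curve J' X g ->
  integral_curve (J `|` J') X g.
Proof. by move=> oJ oJ' h1 h2; apply: icurveI => t f [] Jt sf; exact: icurve_derive Jt sf. Qed.

Lemma icurve_glue J J' X g h (t0 : R) : is_vfield X -> open J -> open J' -> is_interval J -> is_interval J' ->
  integral_curve J X g -> integral_curve J' X h -> J t0 -> J' t0 -> g t0 = h t0 ->
  exists2 k, integral_curve (J `|` J') X k & forall t, J t -> k t = g t.
Proof.
move=> hX oJ oJ' iJ iJ' hg hh Jt0 J't0 e.
pose k (t : R) := if `[< J t >] then g t else h t.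
have kg t : J t -> k t = g t by move=> Jt; rewrite /k asboolT.
exists k => //; apply: icurve_setU => //.
  by apply: icurve_ext oJ _ hg => t /kg.
have oI := openI oJ oJ'; apply: icurve_ext (oJ') _ (hh) => t J't; rewrite /k; case: asboolP => // Jt; symmetry.
have iI := interval_setI iJ iJ'.
by apply: (@icurve_unique _ _ (J `&` J') X g h t0) => //; [apply: icurve_sub hg|apply: icurve_sub hh] => s [].
Qed.

(** Two members of the family agree where both are defined, since they agree at 0; reading each time
    in a member that reaches it gives one curve. *)
Lemma icurve_family J X p : is_vfield X ->
  (forall t, J t -> exists J' g, [/\ open J', is_interval J', J' 0 /\ J' t, integral_curve J' X g & g 0 = p]) ->
  open J -> J 0 -> exists2 g, integral_curve J X g & g 0 = p.
Proof.
move=> hX H oJ J0; have /choice[F hF] : forall t, exists Jg : set R * (R -> M), J t ->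
    [/\ open Jg.1, is_interval Jg.1, Jg.1 0 /\ Jg.1 t, integral_curve Jg.1 X Jg.2 & Jg.2 0 = p].
  move=> t; have [Jt|nJt] := pselect (J t); last by exists (set0, fun=> p).
  by have [J' [g h]] := H t Jt; exists (J', g).
exists (fun t => (F t).2 t); last by case: (hF 0 J0).
apply: icurveI => t f Jt sf; have [oJt iJt [F0 Ft] cF e] := hF t Jt.
apply: (@near_eq_is_derive _ R R (fun s => f ((F t).2 s))); last exact: icurve_derive cF Ft sf.
apply: (@filterS _ (nbhs t) _ ((F t).1 `&` J)); last by apply: open_nbhs_nbhs; split; [exact: openI|].
move=> s [Fts Js]; have [oJs iJs [Fs0 Fs] cFs es] := hF s Js; congr f.
apply: (@icurve_unique _ _ ((F t).1 `&` (F s).1) X _ _ 0) => //; [exact: openI|exact: interval_setI| | |by rewrite e].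
  by apply: icurve_sub cF => q [].
by apply: icurve_sub cFs => q [].
Qed.

Lemma icurve_exists X p : is_vfield X -> exists2 e : R, 0 < e &
  exists W, [/\ open W, W p & forall q, W q -> exists2 g, integral_curve (sball e) X g & g 0 = q].
Proof.
move=> hX; have [c [r [b hb]]] := @box_exists R M p setT openT I.
have [W [th [e [[oW Wp WB] e0 h _ _]]]] := local_flow hb hX.
by exists e => //; exists W; split=> // q Wq; have [t0 ht] := h q Wq; exists (th^~ q).
Qed.

(** The pieces [h1] and [h2] start inside the interval and run past its right and left ends
    respectively; both are glued at their starting times. *)
Lemma icurve_prolong X p g (a t1 e1 t2 e2 : R) h1 h2 : is_vfield X -> 0 < a ->
  integral_curve (sball a) X g -> g 0 = p ->
  `|t1| < a -> a < t1 + e1 -> integral_curve (sball e1) X h1 -> h1 0 = g t1 ->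
  `|t2| < a -> t2 - e2 < - a -> integral_curve (sball e2) X h2 -> h2 0 = g t2 ->
  exists2 a', a < a' & exists2 k, integral_curve (sball a') X k & k 0 = p.
Proof.
move=> hX a0 hg g0 t1a at1 c1 h10 t2a at2 c2 h20.
have sI t e : open [set s | sball e (s - t)] /\ is_interval [set s | sball e (s - t)].
  by split; [apply: shift_open; exact: sball_open|apply: shift_itv; exact: sball_itv].
have c1' := icurve_shift (a := - t1) c1; have c2' := icurve_shift (a := - t2) c2.
have e10 : 0 < e1 by have := ltr_normlW t1a; lra.
have e20 : 0 < e2 by move: t2a; rewrite ltr_norml => /andP[]; lra.
have [op1 it1] := sI t1 e1; have [op2 it2] := sI t2 e2.
have oa := @sball_open a; have ia := @sball_itv a.
have [|||k hk kg] := icurve_glue (t0 := t1) hX oa op1 ia it1 hg c1'.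
- by [].
- by rewrite /= subrr; exact: sball0.
- by rewrite subrr h10.
have iU : is_interval (sball a `|` [set s | sball e1 (s - t1)]).
  by apply: (interval_setU (t := t1)) => //; rewrite /= subrr; exact: sball0.
have [|||l hl lk] := icurve_glue (t0 := t2) hX (openU oa op1) op2 iU it2 hk c2'.
- by left.
- by rewrite /= subrr; exact: sball0.
- by rewrite subrr h20 kg.
exists (Num.min (t1 + e1) (e2 - t2)); first by rewrite lt_min at1 /=; lra.
have sa0 : sball a 0 := sball0 a0; exists l; last by rewrite lk ?kg //; left.
apply: icurve_sub hl => s; rewrite /sball /= lt_min !ltr_norml => /andP[/andP[s1 s2] /andP[s3 s4]].
move: t1a t2a; rewrite !ltr_norml => /andP[u1 u2] /andP[u3 u4].
have [sa|sa] := ltrP s a; last by left; right; apply/andP; split; lra.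
have [as_|as_] := ltrP (- a) s; first by left; left; apply/andP; split.
by right; apply/andP; split; lra.
Qed.

(** Consider the radii of symmetric intervals carrying a curve through [p]. If they are unbounded,
    the curves glue to the whole line; otherwise they glue up to the supremum, and the hypothesis
    reaches beyond it. *)
Lemma complete_prolong X : is_vfield X ->
  (forall p g (a : R), 0 < a -> integral_curve (sball a) X g -> g 0 = p ->
    exists2 a', a < a' & exists2 k, integral_curve (sball a') X k & k 0 = p) -> complete X.
Proof.
move=> hX H p.
pose S := [set a : R | 0 < a /\ exists2 g, integral_curve (sball a) X g & g 0 = p].
have [e e0 [W [_ Wp /(_ p Wp) he]]] := icurve_exists p hX.
have Se : S e by [].
have fam J : open J -> J 0 -> (forall t, J t -> exists2 a, S a & `|t| < a) -> exists2 g, integral_curve J X g & g 0 = p.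
  move=> oJ J0 hJ; apply: icurve_family => // t /hJ[a [a0 [g hg g0]] ta].
  exists (sball a), g; split=> //; [exact: sball_open|exact: sball_itv|].
  by split=> //; exact: sball0.
have [ub|nub] := pselect (has_ubound S); last first.
  apply: fam => //; first exact: openT.
  move=> t _; apply: contrapT => nt; apply: nub; exists `|t| => a Sa.
  by rewrite leNgt; apply/negP => ta; apply: nt; exists a.
have hS : has_sup S by split=> //; exists e.
have eS : e <= sup S by exact: (sup_upper_bound hS).
have S0 : 0 < sup S by exact: lt_le_trans eS.
have [g hg g0] : exists2 g, integral_curve (sball (sup S)) X g & g 0 = p.
  apply: fam => [||t ts]; [exact: sball_open|exact: sball0|].
  have [|a Sa] := sup_adherent (eps := sup S - `|t|) _ hS; first by rewrite subr_gt0.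
  by rewrite subKr => ta; exists a.
have [a' aa' hk] := H p g _ S0 hg g0.
have : a' <= sup S by apply: (sup_upper_bound hS); split=> //; exact: lt_trans aa'.
by rewrite leNgt aa'.
Qed.

Lemma complete_uniform X (e : R) : is_vfield X -> 0 < e ->
  (forall p, exists2 g, integral_curve (sball e) X g & g 0 = p) -> complete X.
Proof.
move=> hX e0 H; apply: complete_prolong => // p g a a0 hg g0.
(* The curve is restarted at distance [d] from each end: inside the interval as [d < a], and running
   past the end as [d < e]. *)
pose d := Num.min a e / 2.
have [d0 da de] : [/\ 0 < d, d < a & d < e].
  have m0 : 0 < Num.min a e by rewrite lt_min a0.
  have m1 : Num.min a e <= a by rewrite ge_min lexx.
  have m2 : Num.min a e <= e by rewrite ge_min lexx orbT.
  by rewrite /d; split; lra.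
have [h1 c1 h10] := H (g (a - d)); have [h2 c2 h20] := H (g (d - a)).
apply: (icurve_prolong hX a0 hg g0 _ _ c1 h10 _ _ c2 h20).
- by rewrite gtr0_norm; lra.
- lra.
- by rewrite ltr0_norm; lra.
- lra.
Qed.

(** Existence times are locally bounded below, so compactness gives one time for all points of [K];
    elsewhere the constant curve works. *)
Lemma complete_csupp X (K : set M) : is_vfield X -> compact K -> (forall q, ~ K q -> X q = 0) -> complete X.
Proof.
move=> hX /compact_near_coveringP cK X0.
have : \forall e \near (0 : R)^'+, K `<=` [set q | exists2 g, integral_curve (sball e) X g & g 0 = q].
  apply: (cK _ (0^'+) (fun e q => exists2 g, integral_curve (sball e) X g & g 0 = q)) => p Kp.
  have [e e0 [W [oW Wp he]]] := icurve_exists p hX.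
  exists (W, [set s : R | 0 < s < e]) => /=.
    split; first exact: open_nbhs_nbhs.
    near=> s; rewrite /=; apply/andP; split; near: s; first exact: nbhs_right_gt.
    exact: nbhs_right_lt.
  move=> [q s] /= [Wq /andP[s0 se]]; have [g hg g0] := he q Wq; exists g => //.
  by apply: icurve_sub hg => t; rewrite /sball /= => /lt_trans; apply.
move=> H; have : \forall e \near (0 : R)^'+, 0 < e /\ K `<=` [set q | exists2 g, integral_curve (sball e) X g & g 0 = q].
  by near=> e; split; near: e; [exact: nbhs_right_gt|exact: H].
move=> /filter_ex[e [e0 he]]; apply: (complete_uniform hX e0) => p.
have [/he //|Kp] := pselect (K p).
by exists (fun=> p) => //; apply: icurve_cst; exact: X0.
Unshelve. all: by end_near. Qed.

End Completeness.

(** * The fundamental theorem of calculus for oriented integrals *)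

Section Integrals.
Variable R : realType.

Lemma derive_continuous (f : R -> R) (x d : R) : is_derive x 1 f d -> {for x, continuous f}.
Proof. by case=> h _; apply: differentiable_continuous; apply/derivable1_diffP. Qed.

Lemma Rintegral_derive (f df : R -> R) (a b : R) : a <= b -> continuous df ->
  (forall s : R, is_derive s 1 f (df s)) ->
  (\int[lebesgue_measure]_(s in `[a, b]) df s)%R = f b - f a.
Proof.
rewrite le_eqVlt => /predU1P[->|ab] cdf hf.
  by rewrite set_itv1 Rintegral_set1 subrr.
rewrite /Rintegral (continuous_FTC2 (F := f) ab) //.
- exact: continuous_subspaceT.
- split; first by move=> x _; case: (hf x).
    by apply: cvg_at_right_filter; exact: (derive_continuous (hf a)).
  by apply: cvg_at_left_filter; exact: (derive_continuous (hf b)).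
- by move=> x _; rewrite derive1E; case: (hf x).
Qed.

Lemma oriented_integral_derive (J : set R) (f df g : R -> R) (t : R) : is_interval J -> J 0 -> J t ->
  continuous df -> (forall s : R, is_derive s 1 f (df s)) -> (forall s, J s -> g s = df s) ->
  oriented_integral 0 t g = f t - f 0.
Proof.
move=> iJ J0 Jt cdf hf gdf; rewrite /oriented_integral; have [t0|t0] := leP 0 t.
  rewrite -(Rintegral_derive t0 cdf hf); apply: eq_Rintegral => s; rewrite inE /= in_itv /= => hs.
  by apply: gdf; exact: (iJ _ _ J0 Jt).
rewrite -[RHS]opprB -(Rintegral_derive (ltW t0) cdf hf); congr (- _).
apply: eq_Rintegral => s; rewrite inE /= in_itv /= => hs.
by apply: gdf; exact: (iJ _ _ Jt J0).
Qed.

End Integrals.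

(** * Compactly supported local primitives of closed 1-forms *)

Section Primitive.
Variables (R : realType) (M : manifold R).
Local Notation n := (mdim M).

Lemma sum_delta (I : finType) (f g : I -> R) i j :
  \sum_k (f k * (j == k)%:R - g k * (i == k)%:R) = f j - g i.
Proof.
have h (e : I -> R) l : \sum_k e k * (l == k)%:R = e l.
  by rewrite (bigD1 l) //= eqxx mulr1 big1 ?addr0 // => k kl; rewrite eq_sym (negbTE kl) mulr0.
by rewrite sumrB !h.
Qed.

Section InBox.
Variables (p : M) (U : set M) (c : chart R M n) (r : R) (b : 'rV[R]_n -> R) (hb : box p U c r b).

Lemma closed1_box (al : form1 M) i j q : is_form1 al -> closed1 al -> boxW p c r q ->
  chart_field c b j q (fun q => al q (chart_field c b i q)) =
  chart_field c b i q (fun q => al q (chart_field c b j q)) :> R.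
Proof.
move=> hal cal Wq; have := cal q (chart_field c b i q) (chart_field c b j q).
rewrite (ext_d1_loc _ _ hal (form1_box hb hal) Wq).
move=> e; apply/eqP; rewrite eq_sym -subr_eq0; apply/eqP; rewrite -{}e.
rewrite -(sum_delta (fun k => chart_field c b i q (fun q => al q (chart_field c b k q)) : R)
  (fun k => chart_field c b j q (fun q => al q (chart_field c b k q)) : R)).
by apply: eq_bigr => k _; congr (_ * _ - _ * _); symmetry; exact: (chart_frame_coord hb _ _ Wq).
Qed.

End InBox.

(** The Poincaré lemma in a chart followed by a cut-off. Compact support is wanted because it makes
    the Hamiltonian field of [f] complete. *)
Lemma local_primitive (al : form1 M) p : is_form1 al -> closed1 al ->
  exists f (K W : set M), [/\ smooth f, compact K, forall q, ~ K q -> dfun f q = (fun=> 0),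
    open W /\ W p & forall q, W q -> dfun f q = al q].
Proof.
move=> hal cal; have [c [r [b hb]]] := @box_exists R M p setT openT I.
have ac := box_chart hb; have [[_ cp] r0 hr [sb _ _] b1] := hb.
have sE i := chart_field_vfield hb i.
pose A i q := al q (chart_field c b i q).
have sA i : smooth (A i) by apply: hal.2.
(* [poincare] asks for compactly supported coefficients. The cut-off leaves them unchanged, hence
   closed, on the ball of radius [r / m] where [b] is 1. *)
pose a i x := b x * (A i \o cinv c) x.
have ca i : ccs (a i) := box_cut_ccs hb (sA i c ac).
pose m : R := 2 * n.+1%:R; have m0 : 0 < m by rewrite mulr_gt0.
have aE q : boxW p c r q -> forall i, a i (cmap c q) = A i q.
  by move=> [cq Wq] i; rewrite /a /= cmapK // b1 ?mul1r //; apply: ltW.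
have nearW q : boxW p c r q -> nbhs (cmap c q) [set x | [/\ cimg c x, boxW p c r (cinv c x) & cmap c (cinv c x) = x]].
  by move=> Wq; exact: (chart_near hb (boxW_open hb) Wq (boxW_cdom Wq)).
have dE i j q : boxW p c r q -> (chart_field c b j q) (A i) = 'D_(delta_mx 0 j) (a i) (cmap c q) :> R.
  move=> Wq; rewrite (chart_fieldE hb) // (bextE hb) //; apply: near_eq_derive.
  apply: (@filterS _ (nbhs (cmap c q)) _ _ _ _ (nearW q Wq)) => x [cx Wx ex].
  by rewrite /= -{2}ex aE.
have hW x : `|x - cmap c p| < r / m -> cimg c x /\ boxW p c r (cinv c x).
  rewrite ltr_pdivlMr // => hx; have [cx _] := hr _ (boxW_norm hx).
  by have [dx ex] := cinvP ac cx; split=> //; split=> //; rewrite /preimage /= ex.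
have [|F [sF dF]] := poincare (x0 := cmap c p) (r := r / m) ca.
  move=> i j x hx; have [cx Wx] := hW x hx; have [_ ex] := cinvP ac cx.
  have e1 := dE i j _ Wx.
  have e2 := dE j i _ Wx.
  rewrite ex in e1 e2.
  refine (etrans (esym e1) (etrans _ e2)).
  exact: (closed1_box hb i j hal cal Wx).
have sf : smooth (bext c b F) by apply: (bext_smooth hb) => k; apply: Ck_on_sub (sF k).
have [K [cK sK] hK] := box_support hb.
have oB := boxW_open hb.
exists (bext c b F), K, (boxW p c r); split=> //.
- move=> q Kq; apply/funext => u; rewrite /dfun.
  have oK : open (~` K) by apply: closed_openC; apply: compact_closed => //; exact: (@mfd_hausdorff R M).
  rewrite (tan_local (g := fun=> 0) u oK Kq sf) ?tan_cst //; first exact: smooth_cst.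
  by move=> q' Kq'; exact: hK.
- by split=> //; exact: (boxW_self hb).
- move=> q Wq; apply/funext => u; have [_ _ _ ->] := form1_box hb hal; last by [].
  rewrite /dfun (chart_expansion hb u Wq sf); apply: eq_bigr => i _; rewrite mulrC; congr (_ * _).
  rewrite -[RHS]aE // -dF; last by rewrite ltr_pdivlMr //; case: Wq.
  apply: near_eq_derive; apply: (@filterS _ (nbhs (cmap c q)) _ _ _ _ (nearW q Wq)) => x [cx Wx ex].
  by rewrite /= (bextE hb) // ex.
Qed.

End Primitive.

Lemma is_deriveM3 (R : realType) (f g h : R -> R) (x df dg dh : R) : is_derive x 1 f df -> is_derive x 1 g dg ->
  is_derive x 1 h dh ->
  is_derive x 1 (fun s => f s * (g s * h s)) (df * (g x * h x) + f x * (dg * h x + g x * dh)).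
Proof.
move=> hf hg hh; apply: is_derive_ext (is_deriveM hf (is_deriveM hg hh)) _ _ => //.
have -> : (g * h) x = g x * h x by [].
by rewrite /GRing.scale /=; ring.
Qed.

(** * The flow of a complete vector field *)

Section GlobalFlow.
Variables (R : realType) (M : manifold R).
Local Notation n := (mdim M).
Implicit Types (p q : M) (f : M -> R) (J : set R).
Variables (X : vfield M) (hX : is_vfield X).
Variables (eta : R -> M -> M) (eta0 : forall p, eta 0 p = p)
  (heta : forall p, integral_curve setT X (eta^~ p)).

Lemma gflow_unique J (g : R -> M) (t0 t : R) p : open J -> is_interval J -> integral_curve J X g -> J t0 -> J t ->
  g t0 = eta t0 p -> g t = eta t p.
Proof.
move=> oJ iJ hg Jt0 Jt e; have hh : integral_curve J X (eta^~ p) by apply: icurve_sub (heta p).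
exact: (icurve_unique hX oJ iJ hg hh Jt0 e Jt).
Qed.

Lemma gflowD s t p : eta (s + t) p = eta s (eta t p).
Proof.
apply: (@gflow_unique setT (fun s => eta (s + t) p) 0 s) => //; [exact: openT| |by rewrite add0r eta0].
exact: (icurve_shift (a := t) (heta p)).
Qed.

Lemma gflowK t : cancel (eta t) (eta (- t)).
Proof. by move=> p; rewrite -gflowD addNr eta0. Qed.

Lemma gflowNK t : cancel (eta (- t)) (eta t).
Proof. by move=> p; rewrite -gflowD subrr eta0. Qed.

(** A pointwise notion whose test functions are global: in this form smoothness can be propagated in
    time for a fixed starting point. *)
Definition smooth_at (phi : M -> M) p : Prop := forall f, smooth f ->
  exists g U, [/\ open U, U p, smooth g & forall q, U q -> f (phi q) = g q].

(** A neighbourhood of [p] mapped by [phi] into [U1] is needed, and continuity of [phi] is not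
    given. It is found as the set where the smooth function agreeing with [b \o phi] is positive,
    for a bump function [b] in [U1]. *)
Lemma smooth_at_comp phi psi p : smooth_at phi p -> smooth_at psi (phi p) -> smooth_at (psi \o phi) p.
Proof.
move=> h1 h2 f sf; have [g1 [U1 [oU1 U1p sg1 e1]]] := h2 f sf.
have [b [K [sb [cK sK] bK bI [W [oW Wp bW]]]]] := bump_manifold oU1 U1p.
have [gb [Ub [oUb Ubp sgb eb]]] := h1 b sb; have [g2 [U2 [oU2 U2p sg2 e2]]] := h1 g1 sg1.
exists g2, ((Ub `&` U2) `&` [set q | 0 < gb q]); split=> //.
- apply: openI; first exact: openI.
  apply: (@open_comp _ _ gb [set y | 0 < y]); last exact: open_gt.
  by move=> q _; exact: (smooth_continuous sgb).
- by split=> //; rewrite /= -eb // bW.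
- move=> q [[Ubq U2q] /= gbq]; rewrite -e2 // /= e1 //; apply: sK.
  by apply: contrapT => Kq; move: gbq; rewrite -eb // bK // ltxx.
Qed.

Lemma gflow_local p : exists e : R, 0 < e /\ exists W, [/\ open W, W p &
  forall t q, `|t| < e -> W q -> smooth_at (eta t) q].
Proof.
have [c [r [b hb]]] := @box_exists R M p setT openT I.
have [W [th [e [[oW Wp WB] e0 h1 h2 _]]]] := local_flow hb hX.
exists e; split=> //; exists W; split=> // t q te Wq f sf; have [g sg eg] := h2 t f te sf.
exists g, W; split=> // q' Wq'; rewrite -eg //; congr f; symmetry; have [th0 hth] := h1 q' Wq'.
apply: (@gflow_unique (sball e) (th^~ q') 0 t) => //; [exact: sball_open|exact: sball_itv|exact: sball0|].
by rewrite th0 eta0.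
Qed.

(** Two members of the flow at times near [t0] differ by a short-time flow, which is smooth at all
    points close to [eta t0 p]. *)
Lemma gflow_smooth_step p (t0 : R) : exists2 d : R, 0 < d &
  forall t t', `|t - t0| < d -> `|t' - t0| < d -> smooth_at (eta t) p -> smooth_at (eta t') p.
Proof.
have [e [e0 [W [oW Wp hW]]]] := gflow_local (eta t0 p).
have : nbhs t0 [set t | W (eta t p)].
  by apply: (icurve_continuous (heta p) (t := t0) I); exact: open_nbhs_nbhs.
case/nbhs_ballP => d /= d0 hd; exists (Num.min d (e / 2)); first by rewrite lt_min d0 divr_gt0.
move=> t t'; rewrite !lt_min => /andP[td te] /andP[t'd t'e] st.
have -> : eta t' = eta (t' - t) \o eta t by apply/funext => q /=; rewrite -gflowD subrK.
apply: smooth_at_comp => //; apply: hW; last by apply: hd; rewrite -ball_normE /= distrC.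
rewrite (_ : t' - t = (t' - t0) - (t - t0)); last by ring.
by apply: le_lt_trans (ler_normB _ _) _; rewrite [e]splitr; exact: ltrD.
Qed.

(** By [gflow_smooth_step] the set of times at which smoothness holds and its complement are both
    open in the line, and 0 belongs to the former. *)
Lemma gflow_smooth_at t p : smooth_at (eta t) p.
Proof.
pose A := [set t | smooth_at (eta t) p].
have oA (B : set R) : (forall t t', B t -> (A t -> A t') -> (A t' -> A t) -> B t') -> open B.
  move=> hB; rewrite openE => s Bs; have [d d0 hd] := gflow_smooth_step p s.
  apply/nbhs_ballP; exists d => //= s'; rewrite -ball_normE /= distrC => s'd.
  have sd : `|s - s| < d by rewrite subrr normr0.
  by apply: (hB s s' Bs); exact: hd.
have o1 : open A by apply: oA => s s' As h _; exact: h.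
have o2 : open (~` A) by apply: oA => s s' As _ h As'; apply: As; exact: h.
have /connected_intervalP cT : is_interval [set: R] by [].
suff AT : A = setT by have : A t by rewrite AT.
apply: cT.
- exists 0; rewrite /A /= => f sf; exists f, setT; split=> //; first exact: openT.
  by move=> q _; rewrite eta0.
- by exists A => //; rewrite setTI.
- by exists A; rewrite ?setTI // -[A]setCK; exact: open_closedC.
Qed.

Lemma gflow_smooth t : smooth_map (eta t).
Proof.
apply: smooth_mapI => f sf; apply: smooth_local => p.
have [g [U [oU Up sg e]]] := gflow_smooth_at t p sf.
by exists U, g.
Qed.

Lemma gflow_diffeo t : diffeo (eta t).
Proof.
split; first exact: gflow_smooth.
exists (eta (- t)); split; [exact: gflow_smooth|exact: gflowK|exact: gflowNK].
Qed.

Lemma gflow_derive_coord p c r b (hb : box p setT c r b) k (u : tangent p) :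
  is_derive (0 : R) 1 (fun s : R => u (chart_coord c b k \o eta s) : R)
    (u (fun q => X q (chart_coord c b k)) : R).
Proof.
have [W [th [e [[oW Wp WB] e0 h1 _ h2]]]] := local_flow hb hX.
apply: (h2 k p u (fun s => chart_coord c b k \o eta s)) => // s se; split.
  by apply: smooth_comp; [exact: gflow_smooth|exact: (chart_coord_smooth hb)].
exists W; split=> // q Wq /=; congr (chart_coord _ _ _ _); symmetry; have [th0 hth] := h1 q Wq.
apply: (@gflow_unique (sball e) (th^~ q) 0 s) => //; [exact: sball_open|exact: sball_itv|exact: sball0|].
by rewrite th0 eta0.
Qed.

Definition contract (F : form2 M) : form1 M := fun p => F p (X p).

(** The Lie derivative, with Cartan's formula taken as the definition; [lie_form_derive] identifies
    it with the derivative of the pullback along the flow. *)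
Definition lie_form (F : form2 M) : form2 M := fun p u v =>
  ext_d2 F p (X p) u v + ext_d1 (contract F) p u v.

Lemma contract_form1 (F : form2 M) : is_form2 F -> is_form1 (contract F).
Proof. by move=> [lF kF sF]; split=> [p|Y hY]; [exact: lF|exact: sF]. Qed.

Lemma contract_loc (I : finType) W (x : I -> M -> R) c (F : form2 M) : loc2 W x c F ->
  loc1 W x (fun j q => \sum_i c i j q * X q (x i)) (contract F).
Proof.
move=> [oW sx sc kc e]; split=> // [j|q u Wq].
  by apply: smooth_sum => i _; apply: smoothM => //; exact: hX.
rewrite /contract e // exchange_big /=; apply: eq_bigr => j _; rewrite mulr_suml.
by apply: eq_bigr => i _; rewrite mulrA.
Qed.

Lemma lie_form_loc (I : finType) W (x : I -> M -> R) c (F : form2 M) p (u v : tangent p) : is_form2 F ->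
  loc2 W x c F -> W p ->
  lie_form F u v = \sum_i \sum_j (X p (c i j) * (u (x i) * v (x j))
    + c i j p * (u (fun q => X q (x i)) * v (x j) + u (x i) * v (fun q => X q (x j)))).
Proof.
move=> hF hl Wp; rewrite /lie_form (ext_d2_loc _ _ _ hF hl Wp).
rewrite (ext_d1_loc _ _ (contract_form1 hF) (contract_loc hl) Wp).
have [oW sx sc kc _] := hl.
have sX i : smooth (fun q => X q (x i)) by exact: hX.
have E (w : tangent p) j : w (fun q => \sum_i c i j q * X q (x i)) =
    \sum_i (c i j p * w (fun q => X q (x i)) + X p (x i) * w (c i j)) :> R.
  rewrite tan_sum => [|i _]; last exact: smoothM.
  by apply: eq_bigr => i _; rewrite tanM.
under [X in _ + X]eq_bigr => j _ do rewrite !E !mulr_suml -sumrB.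
rewrite [X in _ + X]exchange_big /= -big_split /=.
symmetry; apply/eqP; rewrite -subr_eq0 -sumrB; apply/eqP.
(* The two sides differ by a symmetric expression contracted with the skew coefficients. *)
rewrite -[RHS](skew_sum0 (c := fun i j => c i j p) (fun i => u (x i) : R) (fun i => v (fun q => X q (x i)) : R)) //.
  by apply: eq_bigr => i _; rewrite -big_split /= -sumrB; apply: eq_bigr => j _; ring.
by move=> i j; exact: kc.
Qed.

(** In a box the pullback is a finite sum of products of three functions of time, two of them
    derivatives of moved coordinates, which [gflow_derive_coord] differentiates. *)
Lemma lie_form_derive0 (F : form2 M) p (u v : tangent p) : is_form2 F ->
  is_derive (0 : R) 1 (fun s : R => pullback2 (eta s) F p u v) (lie_form F u v).
Proof.
move=> hF; have [c [r [b hb]]] := @box_exists R M p setT openT I.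
have hl := form2_box hb hF; have Wp := boxW_self hb; rewrite (lie_form_loc _ _ hF hl Wp).
have [oW sx sc kc e] := hl; set C := (fun i j q => F q _ _) in hl sc kc e *.
have ds k (w : tangent p) := gflow_derive_coord hb k w.
have dC i j : is_derive (0 : R) 1 (fun s : R => C i j (eta s p)) (X p (C i j) : R).
  by have := icurve_derive (t := 0) (heta p) I (sc i j); rewrite eta0.
have h i j : is_derive (0 : R) 1 (fun s : R => C i j (eta s p) *
    (u (chart_coord c b i \o eta s) * v (chart_coord c b j \o eta s)) : R)
   (X p (C i j) * (u (chart_coord c b i) * v (chart_coord c b j))
    + C i j p * (u (fun q => X q (chart_coord c b i)) * v (chart_coord c b j)
        + u (chart_coord c b i) * v (fun q => X q (chart_coord c b j)))).
  have e0 f : f \o eta 0 = f by apply/funext => q /=; rewrite eta0.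
  by have := is_deriveM3 (dC i j) (ds i u) (ds j v); rewrite !e0 eta0.
apply: (@near_eq_is_derive _ R R (fun s => \sum_i \sum_j C i j (eta s p) *
    (u (chart_coord c b i \o eta s) * v (chart_coord c b j \o eta s)))).
  have : nbhs (0 : R) [set t | boxW p c r (eta t p)].
    by apply: (icurve_continuous (heta p) (t := 0) I); apply: open_nbhs_nbhs; rewrite eta0.
  apply: filterS => s Ws; rewrite /pullback2 e //.
  apply: eq_bigr => i _; apply: eq_bigr => j _.
  by rewrite !pushE //; exact: gflow_smooth.
have hs i : is_derive (0 : R) 1 (\sum_j (fun s : R => C i j (eta s p) *
    (u (chart_coord c b i \o eta s) * v (chart_coord c b j \o eta s)))) _ := is_derive_sum (h i).
by apply: is_derive_ext (is_derive_sum hs) _ _ => // s; rewrite fct_sumE; apply: eq_bigr => i _; rewrite fct_sumE.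
Qed.

Lemma pullback2_gflowD (F : form2 M) s t p (u v : tangent p) :
  pullback2 (eta (s + t)) F p u v = pullback2 (eta s) F (eta t p) (push (eta t) u) (push (eta t) v).
Proof.
have e : eta (s + t) = eta s \o eta t by apply/funext => q /=; rewrite gflowD.
by rewrite /pullback2 e (push_comp u (gflow_smooth t) (gflow_smooth s)) (push_comp v (gflow_smooth t) (gflow_smooth s)).
Qed.

(** The group law of the flow moves the base time to 0. *)
Lemma lie_form_derive (F : form2 M) (t : R) p (u v : tangent p) : is_form2 F ->
  is_derive t 1 (fun s : R => pullback2 (eta s) F p u v) (pullback2 (eta t) (lie_form F) p u v).
Proof.
move=> hF; have h := lie_form_derive0 (push (eta t) u) (push (eta t) v) hF.
rewrite -{1}(subrr t) in h.
by apply: is_derive_ext (is_derive_shift_arg h) _ (erefl _) => s; rewrite -pullback2_gflowD subrK.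
Qed.

End GlobalFlow.

(** * Diffeomorphisms and complex structures *)

Section Diffeos.
Variables (R : realType).

Lemma push_id (M : manifold R) (p : M) (u : tangent p) : push (fun q : M => q) u = u.
Proof.
have sid : smooth_map (fun q : M => q) by apply: smooth_mapI.
by apply: tan_eq => g sg; rewrite pushE.
Qed.

Lemma icurve_push (M N : manifold R) (phi : M -> N) (X : vfield M) (Y : vfield N) J (g : R -> M) :
  smooth_map phi -> (forall t, J t -> push phi (X (g t)) = Y (phi (g t))) ->
  integral_curve J X g -> integral_curve J Y (phi \o g).
Proof.
move=> sphi XY hg; apply: icurveI => t f Jt sf; rewrite /= -XY // pushE //.
exact: (icurve_derive hg Jt (smooth_comp sphi sf)).
Qed.

Lemma pullback2_comp (M N P : manifold R) (phi : M -> N) (psi : N -> P) (F : form2 P) :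
  smooth_map phi -> smooth_map psi -> pullback2 phi (pullback2 psi F) = pullback2 (psi \o phi) F.
Proof.
move=> s1 s2; apply: functional_extensionality_dep => p; apply/funext => u; apply/funext => v.
by rewrite /pullback2 (push_comp u s1 s2) (push_comp v s1 s2).
Qed.

Lemma pullback2_id (M : manifold R) (phi : M -> M) (F : form2 M) : (forall p, phi p = p) ->
  pullback2 phi F = F.
Proof.
move=> /funext ->; apply: functional_extensionality_dep => p; apply/funext => u; apply/funext => v.
by rewrite /pullback2 !push_id.
Qed.

Section RelatedBivectors.
Variables (M N P : manifold R) (phi : M -> N) (psi : N -> P).
Variables (Q1 : bivector M) (Q2 : bivector N) (Q3 : bivector P).
Hypotheses (sphi : smooth_map phi) (spsi : smooth_map psi).

Lemma cov_push p (xi : covector (phi p)) : covec_linear xi -> covec_linear (fun u : tangent p => xi (push phi u)).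
Proof. by move=> lxi a u v; rewrite push_linear // lxi. Qed.

Lemma related_comp : related_bivectors phi Q1 Q2 -> related_bivectors psi Q2 Q3 ->
  related_bivectors (psi \o phi) Q1 Q3.
Proof.
move=> h1 h2 p xi lxi; rewrite (push_comp _ sphi spsi).
have -> : (fun u : tangent p => xi (push (psi \o phi) u)) = fun u : tangent p => (fun w => xi (push psi w)) (push phi u).
  by apply/funext => u; rewrite (push_comp u sphi spsi).
rewrite (h1 p (fun w => xi (push psi w))); first exact: h2.
by move=> a u v; rewrite push_linear // lxi.
Qed.

(** A covector downstairs pulls back to a point above, where both hypotheses apply; surjectivity on
    points is what allows the descent. *)
Lemma related_factor : (forall q, exists p, phi p = q) -> related_bivectors phi Q1 Q2 ->
  related_bivectors (psi \o phi) Q1 Q3 -> related_bivectors psi Q2 Q3.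
Proof.
move=> surj h1 h2 q; have [p <-] := surj q => xi lxi.
rewrite -(h1 p (fun w => xi (push psi w))); last by move=> a u v; rewrite push_linear // lxi.
rewrite -(push_comp _ sphi spsi) -[RHS](h2 p xi lxi); congr (push _ (Q1 _)).
by apply/funext => u; rewrite (push_comp u sphi spsi).
Qed.

End RelatedBivectors.

Section Inverse.
Variables (M N : manifold R) (phi : M -> N) (psi : N -> M).
Hypotheses (sphi : smooth_map phi) (spsi : smooth_map psi) (K : cancel phi psi) (K' : cancel psi phi).

Lemma push_inj p : injective (@push R M N phi p).
Proof.
move=> u v e; apply: tan_eq => f sf.
have E w : push phi w (f \o psi) = (w : tangent p) f.
  rewrite pushE //; last exact: smooth_comp.
  by congr (tan_val w _); apply/funext => q /=; rewrite K.
by rewrite -!E e.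
Qed.

Lemma push_surj p (w : tangent (phi p)) : exists u, push phi u = w.
Proof.
have h : derivation_at p (fun f => if `[< smooth f >] then w (f \o psi) else 0).
  split.
  - move=> a f g sf sg; rewrite !asboolT //; last by apply: smoothD => //; exact: smoothZ.
    have := tanD w (smoothZ a (smooth_comp spsi sf)) (smooth_comp spsi sg).
    by rewrite tanZ //; exact: smooth_comp.
  - move=> f g sf sg; rewrite !asboolT //; last exact: smoothM.
    by have := tanM w (smooth_comp spsi sf) (smooth_comp spsi sg); rewrite /= K.
  - by move=> f nf; rewrite asboolF.
exists (insubd (0 : tangent p) (fun f => if `[< smooth f >] then w (f \o psi) else 0)).
apply: tan_eq => f sf; rewrite pushE // tanE // asboolT; last exact: smooth_comp.
by congr (tan_val w _); apply/funext => q /=; rewrite K'.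
Qed.

Lemma covector_push p (xi : covector p) : covec_linear xi ->
  exists2 et : covector (phi p), covec_linear et & forall u, xi u = et (push phi u).
Proof.
move=> lxi; have /choice[F hF] := @push_surj p.
exists (fun w => xi (F w)) => [a u v|u]; last by congr xi; apply: push_inj; rewrite hF.
by rewrite -lxi; congr xi; apply: push_inj; rewrite push_linear // !hF.
Qed.

Lemma related_inverse (Q1 : bivector M) (Q2 : bivector N) : related_bivectors phi Q1 Q2 -> related_bivectors psi Q2 Q1.
Proof.
move=> h; apply: (related_factor sphi spsi _ h); first by move=> q; exists (psi q).
have -> : psi \o phi = fun q => q by apply/funext => q /=; rewrite K.
move=> p xi lxi; rewrite push_id; congr (Q1 _).
by apply/funext => u; rewrite push_id.
Qed.

Lemma intertwine_inverse (A : endo M) (J : endo N) : (forall p u, push phi (A p u) = J (phi p) (push phi u)) ->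
  forall q w, push psi (J q w) = A (psi q) (push psi w).
Proof.
move=> h q; rewrite -(K' q); move: (psi q) => p w; have [u <-] := push_surj w.
rewrite -h -!(push_comp _ sphi spsi).
(* [psi (phi p)] and [p] are equal points with different tangent types; stating the claim for any
   map equal to the identity avoids a cast. *)
suff H (chi : M -> M) : (fun q => q) = chi -> push chi (A p u) = A (chi p) (push chi u).
  by apply: H; apply/funext => x /=; rewrite K.
by move=> <-; rewrite !push_id.
Qed.

Lemma pullback_endoE (J : endo N) p u : push phi (pullback_endo phi J p u) = J (phi p) (push phi u).
Proof.
rewrite /pullback_endo; case: xgetP => [x _ //|h].
by have [w hw] := push_surj (J (phi p) (push phi u)); case: (h w).
Qed.

End Inverse.

End Diffeos.

(** * Integrability and the operator d^c *)

Section ComplexStructures.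
Variables (R : realType) (M : manifold R).
Implicit Types (J : endo M) (f : M -> R) (X Y : vfield M) (al : form1 M).

Definition twist J al : form1 M := fun p u => al p (J p u).
Arguments twist J al p u : clear implicits.

Lemma endoD J p u v : is_endo J -> J p (u + v) = J p u + J p v.
Proof. by move=> [l _]; have := l p 1 u v; rewrite !scale1r. Qed.

Lemma endo0 J p : is_endo J -> J p 0 = 0.
Proof. by move=> [l _]; have := l p (-1) 0 0; rewrite scaler0 addr0 scaleN1r addNr. Qed.

Lemma endoN J p u : is_endo J -> J p (- u) = - J p u.
Proof. by move=> h; have [l _] := h; have := l p (-1) u 0; rewrite !scaleN1r !addr0 endo0 // addr0. Qed.

Lemma endoB J p u v : is_endo J -> J p (u - v) = J p u - J p v.
Proof. by move=> h; rewrite endoD // endoN. Qed.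

Lemma endo_vfield J X : is_endo J -> is_vfield X -> is_vfield (fun q => J q (X q)).
Proof. by case=> _; apply. Qed.

Lemma twist_form1 J al : is_endo J -> is_form1 al -> is_form1 (twist J al).
Proof.
move=> [lJ sJ] [la sa]; split=> [p a u v|X hX]; first by rewrite /twist lJ la.
by apply: (sa (fun q => J q (X q))); exact: sJ.
Qed.

(** Since J^2 = -1, fields to which [J] is applied twice contribute plain derivatives of [f], and
    the Nijenhuis tensor tested on [f] becomes the obstruction for d(df o J) to be of type (1,1). *)
Lemma nijenhuisE J X Y f p : is_endo J -> (forall q u, J q (J q u) = - u) -> is_vfield X -> is_vfield Y -> smooth f ->
  (bracket (fun q => J q (X q)) (fun q => J q (Y q)) p
     - J p (bracket (fun q => J q (X q)) Y p) - J p (bracket X (fun q => J q (Y q)) p) - bracket X Y p) f =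
  ext_d1 (twist J (dfun f)) p (J p (X p)) (Y p) + ext_d1 (twist J (dfun f)) p (X p) (J p (Y p)) :> R.
Proof.
move=> hJ JJ hX hY sf; have hJX := endo_vfield hJ hX; have hJY := endo_vfield hJ hY.
have hg := twist_form1 hJ (dfun_form1 sf).
rewrite !tan_subE (bracketE _ hJX hJY sf) (bracketE _ hX hY sf).
rewrite (ext_d1E p hg hJX hY) (ext_d1E p hg hX hJY).
have e (Z : vfield M) : is_vfield Z -> (fun q => twist J (dfun f) q (J q (Z q))) = fun q => - Z q f.
  by move=> _; apply/funext => q; rewrite /twist /dfun JJ tan_oppE.
rewrite (e X hX) (e Y hY) !tanN; [|exact: hY|exact: hX].
rewrite /twist /dfun.
move: (J p (X p) _) (J p (Y p) _) (J p (bracket _ Y p) f) (J p (bracket X _ p) f) (X p _) (Y p _) => a b c d e' g.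
ring.
Qed.

(** Integrability is rephrased through 1-forms because these pull back along maps; it serves to
    transport complex structures by a diffeomorphism. *)
Lemma complex_structureP J : complex_structure J <->
  [/\ is_endo J, (forall p u, J p (J p u) = - u) &
      forall f, smooth f -> forall p u v,
        ext_d1 (twist J (dfun f)) p (J p u) v + ext_d1 (twist J (dfun f)) p u (J p v) = 0].
Proof.
split=> -[hJ JJ h]; split=> //.
  move=> f sf p u v; rewrite -{1 2}(extendE u) -{1 2}(extendE v).
  by rewrite -(nijenhuisE _ hJ JJ (extend_vfield u) (extend_vfield v) sf) h // ?tan_zeroE; exact: extend_vfield.
by move=> X Y hX hY p; apply: tan_eq => f sf; rewrite nijenhuisE // h.
Qed.

(** The 1-form [twist J al] is applied to the Nijenhuis tensor, and closedness of [al] on (JX, Y)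
    and (X, JY) removes the mixed brackets. The resulting invariance says that the differential is
    of type (1,1). *)
Lemma ext_d1_twist J al p u v : complex_structure J -> is_form1 al -> closed1 al ->
  ext_d1 (twist J al) p (J p u) (J p v) = ext_d1 (twist J al) p u v.
Proof.
move=> [hJ JJ nij] hal cal; have hg := twist_form1 hJ hal.
rewrite -{1 2}(extendE u) -{1 2}(extendE v).
have hX := extend_vfield u; have hY := extend_vfield v; set X := extend u in hX *; set Y := extend v in hY *.
have hJX := endo_vfield hJ hX; have hJY := endo_vfield hJ hY.
rewrite (ext_d1E p hg hX hY) (ext_d1E p hg hJX hJY).
have c1 := closed1E p hal cal hJX hY; have c2 := closed1E p hal cal hX hJY.
have sa := fun Z hZ => @form1_apply_smooth R M al Z hal hZ.
have e (Z : vfield M) : (fun q => twist J al q (J q (Z q))) = fun q => - al q (Z q).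
  by apply/funext => q; rewrite /twist JJ (covN (hal.1 q)).
rewrite !e !tanN; [|exact: sa|exact: sa].
have := nij X Y hX hY p; move/(congr1 (fun w => al p (J p w))).
rewrite !endoB // !JJ endo0 // !(covB (hal.1 p)) !(covN (hal.1 p)) (cov0 (hal.1 p)) -c1 -c2 /twist.
move: (J p (X p) _) (J p (Y p) _) (X p _) (Y p _) (al p _) (al p _) => a1 a2 a3 a4 a5 a6.
lra.
Qed.

Lemma dc1E J al : complex_structure J -> is_form1 al -> closed1 al -> dc1 J al = ext_d1 (twist J al).
Proof.
move=> cJ hal cal; apply: functional_extensionality_dep => p; apply/funext => u; apply/funext => v.
exact: ext_d1_twist.
Qed.

End ComplexStructures.

Section LieBracket.
Variables (R : realType) (M : manifold R).
Implicit Types (F G : form2 M) (X Y Z : vfield M).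

Lemma lie_formE X F Y Z p : is_vfield X -> is_vfield Y -> is_vfield Z -> is_form2 F ->
  lie_form X F (Y p) (Z p) =
  X p (fun q => F q (Y q) (Z q)) - F p (bracket X Y p) (Z p) - F p (Y p) (bracket X Z p) :> R.
Proof.
move=> hX hY hZ hF; rewrite /lie_form ext_d2E // (ext_d1E p (contract_form1 hX hF) hY hZ) /d2_expr /contract.
rewrite (form2_skew (bracket X Z p) (Y p) hF) (form2_skew (bracket Y Z p) (X p) hF).
move: (X p _) (Y p _) (Z p _) (F p (bracket X Y p) _) (F p (Y p) _) (F p (X p) _) => a b c d e f.
ring.
Qed.

Lemma form2D F G : is_form2 F -> is_form2 G -> is_form2 (fun p u v => F p u v + G p u v).
Proof.
move=> [lF kF sF] [lG kG sG]; split.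
- by move=> p u a v w; rewrite lF lG; ring.
- by move=> p u v; rewrite kF kG; ring.
- by move=> X Y hX hY; apply: smoothD; [exact: sF|exact: sG].
Qed.

Lemma form2B F G : is_form2 F -> is_form2 G -> is_form2 (fun p u v => F p u v - G p u v).
Proof.
move=> [lF kF sF] [lG kG sG]; split.
- by move=> p u a v w; rewrite lF lG; ring.
- by move=> p u v; rewrite kF kG; ring.
- by move=> X Y hX hY; apply: smoothB; [exact: sF|exact: sG].
Qed.

Lemma closed2D F G : is_form2 F -> is_form2 G -> closed2 F -> closed2 G ->
  closed2 (fun p u v => F p u v + G p u v).
Proof.
move=> hF hG cF cG p u v w; have := cF p u v w; have := cG p u v w; rewrite /ext_d2.
have sF X Y hX hY := form2_apply_smooth (X := X) (Y := Y) hF hX hY.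
have sG X Y hX hY := form2_apply_smooth (X := X) (Y := Y) hG hX hY.
have [hu hv hw] : [/\ is_vfield (extend u), is_vfield (extend v) & is_vfield (extend w)] by split; exact: extend_vfield.
rewrite !tanD; try by [exact: sF|exact: sG].
lra.
Qed.

Lemma closed2B F G : is_form2 F -> is_form2 G -> closed2 F -> closed2 G ->
  closed2 (fun p u v => F p u v - G p u v).
Proof.
move=> hF hG cF cG p u v w; have := cF p u v w; have := cG p u v w; rewrite /ext_d2.
have sF X Y hX hY := form2_apply_smooth (X := X) (Y := Y) hF hX hY.
have sG X Y hX hY := form2_apply_smooth (X := X) (Y := Y) hG hX hY.
have [hu hv hw] : [/\ is_vfield (extend u), is_vfield (extend v) & is_vfield (extend w)] by split; exact: extend_vfield.
rewrite !tanB; try by [exact: sF|exact: sG].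
lra.
Qed.

End LieBracket.

Section ComplexFunctions.
Variables (R : realType) (M : manifold R).
Implicit Types (F G : M -> R[i]).

Lemma csmoothD F G : csmooth F -> csmooth G -> csmooth (fun q => F q + G q).
Proof.
move=> [F1 F2] [G1 G2]; split.
  by apply: smooth_ext (smoothD F1 G1) _ => q; case: (F q) (G q) => [a b] [].
by apply: smooth_ext (smoothD F2 G2) _ => q; case: (F q) (G q) => [a b] [].
Qed.

Lemma csmoothN F : csmooth F -> csmooth (fun q => - F q).
Proof.
move=> [F1 F2]; split.
  by apply: smooth_ext (smoothN F1) _ => q; case: (F q).
by apply: smooth_ext (smoothN F2) _ => q; case: (F q).
Qed.

Lemma csmooth_mul_i F : csmooth F -> csmooth (fun q => 'i * F q).
Proof.
move=> [F1 F2]; split.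
  by apply: smooth_ext (smoothN F2) _ => q; case: (F q) => a b /=; rewrite mul0r sub0r mul1r.
by apply: smooth_ext F1 _ => q; case: (F q) => a b /=; rewrite mul0r add0r mul1r.
Qed.

Lemma csmooth_sigma_bracket (I : endo M) (Q : bivector M) F G : is_bivector Q -> is_bivector (sigma_re I Q) ->
  csmooth F -> csmooth G -> csmooth (sigma_bracket I Q F G).
Proof.
move=> [_ _ sQ] [_ _ sI] [F1 F2] [G1 G2].
have rr (f g : M -> R) : smooth f -> smooth g -> csmooth (sigma_rr I Q f g).
  move=> sf sg; split; first exact: (sI _ (dfun_form1 sf)).
  apply: smoothN; apply: (smoothZ (4%:R^-1)); exact: (sQ _ (dfun_form1 sf)).
apply: csmoothD; first by apply: csmoothD; [exact: rr|apply: csmoothN; exact: rr].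
by apply: csmooth_mul_i; apply: csmoothD; exact: rr.
Qed.

End ComplexFunctions.

(** * Transport of holomorphic Poisson structures along a diffeomorphism *)

Section Transport.
Variables (R : realType) (M N : manifold R) (phi : M -> N) (psi : N -> M).
Hypotheses (sphi : smooth_map phi) (spsi : smooth_map psi) (K : cancel phi psi) (K' : cancel psi phi).
Variables (I : endo M) (J : endo N).
Arguments I : clear implicits.
Arguments J : clear implicits.
Hypothesis (IJ : forall p u, push phi (I p u) = J (phi p) (push phi u)).

Lemma push_value p (w : tangent p) (f : M -> R) : smooth f -> w f = push phi w (f \o psi) :> R.
Proof.
move=> sf; rewrite pushE //; last exact: smooth_comp.
by congr (tan_val w _); apply/funext => q /=; rewrite K.
Qed.

Lemma twist_pullback f : smooth f ->
  twist I (dfun f) = pullback1 phi (twist J (dfun (f \o psi))).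
Proof.
move=> sf; apply: functional_extensionality_dep => p; apply/funext => u.
by rewrite /twist /pullback1 -IJ /dfun push_value.
Qed.

(** Smoothness of [I X] is tested on functions [f]: the value on [f] is the evaluation on [X] of a
    pulled back 1-form. *)
Lemma transport_endo : is_endo J -> is_endo I.
Proof.
move=> hJ; split=> [p a u v|X hX f sf].
  by apply: (push_inj sphi spsi K); rewrite ?push_linear // !IJ push_linear // hJ.1.
have hg := pullback1_form1 sphi (twist_form1 hJ (dfun_form1 (smooth_comp spsi sf))).
by have := hg.2 X hX; rewrite -twist_pullback.
Qed.

Lemma transport_complex_structure : complex_structure J -> complex_structure I.
Proof.
move/complex_structureP => [hJ JJ h]; apply/complex_structureP; split.
- exact: transport_endo.
- by move=> p u; apply: (push_inj sphi spsi K) => //; rewrite !IJ JJ pushN.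
move=> f sf p u v; rewrite twist_pullback // !ext_d1_pullback ?IJ ?h //.
- exact: smooth_comp.
- by apply: twist_form1 => //; apply: dfun_form1; exact: smooth_comp.
- by apply: twist_form1 => //; apply: dfun_form1; exact: smooth_comp.
Qed.

Variables (Q : bivector M) (Q' : bivector N).
Arguments Q : clear implicits.
Arguments Q' : clear implicits.
Hypotheses (hQ : is_bivector Q) (QQ' : related_bivectors phi Q Q').

Lemma related_sigma_re : related_bivectors phi (sigma_re I Q) (sigma_re J Q').
Proof. by move=> p xi lxi; rewrite /sigma_re pushN // pushZ // IJ QQ'. Qed.

Lemma related_sigma_im : related_bivectors phi (sigma_im Q) (sigma_im Q').
Proof. by move=> p xi lxi; rewrite /sigma_im pushN // pushZ // QQ'. Qed.

Lemma related_dfun (P : bivector M) (P' : bivector N) (F G : N -> R) p : related_bivectors phi P P' ->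
  smooth F -> smooth G -> P p (dfun (F \o phi) p) (G \o phi) = P' (phi p) (dfun F (phi p)) G :> R.
Proof.
move=> h sF sG; rewrite -h; last exact: dfun_linear.
rewrite pushE //; congr (tan_val (P p _) _); apply/funext => u.
by rewrite /dfun pushE.
Qed.

Lemma csmooth_comp (F : M -> R[i]) : csmooth F -> csmooth (F \o psi).
Proof. by move=> [h1 h2]; split; [exact: (smooth_comp spsi h1)|exact: (smooth_comp spsi h2)]. Qed.

Lemma sigma_bracket_comp (F G : N -> R[i]) : csmooth F -> csmooth G ->
  sigma_bracket I Q (F \o phi) (G \o phi) = sigma_bracket J Q' F G \o phi.
Proof.
move=> [F1 F2] [G1 G2]; apply/funext => p; rewrite /sigma_bracket /sigma_rr /=.
have re := fun f g sf sg => related_dfun (F := f) (G := g) p related_sigma_re sf sg.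
have im := fun f g sf sg => related_dfun (F := f) (G := g) p related_sigma_im sf sg.
by rewrite -!re -?im.
Qed.

Lemma holomorphic_on_comp (U : set N) (F : N -> R[i]) : holomorphic_on J U F -> csmooth (F \o phi) ->
  holomorphic_on I (phi @^-1` U) (F \o phi).
Proof.
move=> [[F1 F2] h] cF; split=> // p Up u; have := h _ Up (push phi u).
by rewrite -IJ /cdfun !pushE.
Qed.

End Transport.

Section TransportPoisson.
Variables (R : realType) (M N : manifold R) (phi : M -> N) (psi : N -> M).
Hypotheses (sphi : smooth_map phi) (spsi : smooth_map psi) (K : cancel phi psi) (K' : cancel psi phi).
Variables (I : endo M) (J : endo N).
Arguments I : clear implicits.
Arguments J : clear implicits.
Hypothesis (IJ : forall p u, push phi (I p u) = J (phi p) (push phi u)).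
Variables (Q : bivector M) (Q' : bivector N).
Arguments Q : clear implicits.
Arguments Q' : clear implicits.
Hypotheses (hQ : is_bivector Q) (QQ' : related_bivectors phi Q Q').

Lemma transport_sigma_re : is_endo J -> is_bivector (sigma_re J Q') -> is_bivector (sigma_re I Q).
Proof.
move=> hJ [l1 k1 s1]; have hI := transport_endo sphi spsi K IJ hJ; have [l2 k2 s2] := hQ; split.
- move=> p a xi et lxi let_; rewrite /sigma_re l2 // hI.1 scalerDr opprD; congr (_ - _).
  by rewrite !scalerA mulrC -scalerA scalerN.
- move=> p xi et lxi let_.
  have [xi' lxi' exi] := covector_push sphi spsi K K' lxi.
  have [et' let' eet] := covector_push sphi spsi K K' let_.
  have fxi : xi = fun u => xi' (push phi u) by apply/funext.
  have fet : et = fun u => et' (push phi u) by apply/funext.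
  have hs := related_sigma_re sphi IJ QQ'.
  by rewrite {1}fxi {2}fet eet exi !hs // k1.
- move=> al hal; apply: vfieldN; apply: (@vfieldZ _ _ (fun=> 4%:R^-1)); first exact: smooth_cst.
  by apply: endo_vfield => //; exact: s2.
Qed.

(** A bracket on [M] is the bracket on [N] of the functions composed with [psi], so holomorphy and
    the Jacobi identity are read off on [N]. *)
Lemma transport_holomorphic_poisson : holomorphic_poisson J Q' -> holomorphic_poisson I Q.
Proof.
move=> [cJ bJ bQ' hol jac]; have [hJ _ _] := cJ.
have cpsi (F : M -> R[i]) : F = (F \o psi) \o phi by apply/funext => p /=; rewrite K.
have cphi (F : N -> R[i]) : F = (F \o phi) \o psi by apply/funext => p /=; rewrite K'.
have cs := csmooth_comp spsi.
have sb (F G : M -> R[i]) : csmooth F -> csmooth G -> sigma_bracket I Q F G = sigma_bracket J Q' (F \o psi) (G \o psi) \o phi.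
  move=> sF sG; rewrite {1}(cpsi F) {1}(cpsi G).
  exact: (sigma_bracket_comp sphi IJ QQ' (cs _ sF) (cs _ sG)).
have cI := transport_complex_structure sphi spsi K IJ cJ.
have sbI (F G : M -> R[i]) : csmooth F -> csmooth G -> csmooth (sigma_bracket I Q F G).
exact: (csmooth_sigma_bracket hQ (transport_sigma_re hJ bJ)).
split=> //; first exact: transport_sigma_re.
- move=> U f g oU hf hg; have [sf _] := hf; have [sg _] := hg.
  have T (h : M -> R[i]) : holomorphic_on I U h -> holomorphic_on J (psi @^-1` U) (h \o psi).
    move=> hh; apply: (holomorphic_on_comp spsi (intertwine_inverse sphi spsi K K' IJ) hh).
    by apply: cs; case: hh.
  rewrite sb //.
  have -> : U = phi @^-1` (psi @^-1` U) by apply/seteqP; split=> p; rewrite /preimage /= K.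
  apply: (holomorphic_on_comp sphi IJ) => //; first by apply: hol; [exact: preim_open|exact: T|exact: T].
  by rewrite -sb //; exact: sbI.
- move=> f g h sf sg sh p.
  have e (F G H : M -> R[i]) : csmooth F -> csmooth G -> csmooth H ->
      sigma_bracket I Q F (sigma_bracket I Q G H) p =
      sigma_bracket J Q' (F \o psi) (sigma_bracket J Q' (G \o psi) (H \o psi)) (phi p).
    move=> sF sG sH; rewrite sb //; last exact: sbI.
    by rewrite /= (sb G H) // -cphi.
  by rewrite !e // jac //; exact: cs.
Qed.

End TransportPoisson.

Arguments twist {R M} J al p u.

(** The gauged structure, contracted with [om], gives [B + G], which is the pullback of [B] by
    [phi]. As [phi] preserves [om], nondegeneracy identifies the two sides. *)
Lemma symplectic_gauge (R : realType) (Z : manifold R) (om B G : form2 Z) (I : endo Z) (phi : Z -> Z) :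
  is_form2 om -> Defs.nondegenerate om -> is_form2 G -> (forall z (u v : tangent z), om z (I z u) v = B z u v) ->
  (forall z (w : tangent (phi z)), exists u, push phi u = w) ->
  (forall z (u v : tangent z), om (phi z) (push phi u) (push phi v) = om z u v) ->
  (forall z (u v : tangent z), B (phi z) (push phi u) (push phi v) = B z u v + G z u v) ->
  forall z (u : tangent z), push phi (gauge I (inv_form om) G z u) = I (phi z) (push phi u).
Proof.
move=> hom nd hG omI surj ho hb z u; apply/eqP; rewrite -subr_eq0; apply/eqP; apply: (nd) => w.
have [v <-] := surj z w.
rewrite (covB (form2_linl _ hom)) ho omI hb (covD (form2_linl _ hom)) omI.
by rewrite (inv_formP hom nd (form2_linr u hG)) subrr.
Qed.

(** * The lifted flow *)

Section BraneFlow.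
Variables (R : realType) (Z N : manifold R) (pr : Z -> N) (om B : form2 Z) (I : endo Z) (J : endo N) (Q : bivector N).
Arguments om : clear implicits.
Arguments B : clear implicits.
Arguments I : clear implicits.
Arguments J : clear implicits.
Arguments Q : clear implicits.
Hypotheses (hom : is_form2 om) (com : closed2 om) (nd : Defs.nondegenerate om).
Hypotheses (hB : is_form2 B) (cB : closed2 B) (cI : complex_structure I).
Hypotheses (omI : forall z (u v : tangent z), om z (I z u) v = B z u v).
Hypotheses (cJ : complex_structure J) (hQ : is_bivector Q).
Hypotheses (spr : smooth_map pr) (surj : forall q, exists z, pr z = q)
  (dsurj : forall z (w : tangent (pr z)), exists u : tangent z, push pr u = w)
  (hol : forall z (u : tangent z), push pr (I z u) = J (pr z) (push pr u)).
Hypothesis rel : related_bivectors pr (inv_form om) Q.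
Variables (alpha : form1 N) (hal : is_form1 alpha) (cal : closed1 alpha).
Arguments alpha : clear implicits.

Local Notation P := (inv_form om).
Local Notation V := (fun p => Q p (alpha p)).
Local Notation VZ := (fun z => P z (pullback1 pr alpha z)).

Lemma V_vfield : is_vfield V. Proof. by case: hQ => _ _; apply. Qed.

Lemma pal_form1 : is_form1 (pullback1 pr alpha). Proof. exact: pullback1_form1. Qed.

Lemma VZ_vfield : is_vfield VZ. Proof. exact: (inv_form_vfield hom nd pal_form1). Qed.

Lemma push_VZ z : push pr (VZ z) = V (pr z).
Proof. exact: (rel (hal.1 (pr z))). Qed.

Lemma omVZ z w : om z (VZ z) w = alpha (pr z) (push pr w).
Proof. by rewrite inv_formP //; exact: pal_form1.1. Qed.

Lemma ham_vfield f : smooth f -> is_vfield (hamiltonian P f).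
Proof. by move=> sf; apply: (inv_form_vfield hom nd); exact: dfun_form1. Qed.

Lemma om_ham f z w : smooth f -> om z (hamiltonian P f z) w = w f.
Proof. by move=> sf; rewrite inv_formP //; exact: dfun_linear. Qed.

Lemma push_ham f z : smooth f -> push pr (hamiltonian P (f \o pr) z) = hamiltonian Q f (pr z).
Proof.
move=> sf; rewrite /hamiltonian -rel; last exact: dfun_linear.
congr (push _ (P z _)); apply/funext => u; by rewrite /dfun pushE.
Qed.

(** A flow on an open set of times around 0 moves all points for a common positive time, and a
    uniform existence time can be iterated. *)
Lemma V_complete (T : set R) (psi : R -> N -> N) : open T -> T 0 -> is_flow T V psi -> complete V.
Proof.
move=> oT T0 [psi0 _ cpsi]; have /nbhs_ballP[e /= e0 he] : nbhs (0 : R) T by exact: open_nbhs_nbhs.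
apply: (complete_uniform V_vfield e0) => p; exists (fun t => psi t p) => //.
by apply: icurve_sub (cpsi p) => t te; apply: he; rewrite -ball_normE /= sub0r normrN.
Qed.

Hypothesis cmp : complete_map P Q pr.

(* Near the point [c 0] of the base, [alpha] is the differential of a compactly supported function f,
   and the Hamiltonian field of [f \o pr] is complete and coincides with [VZ] over that neighbourhood. *)
Lemma VZ_escape (c : R -> N) : integral_curve setT V c -> exists2 e : R, 0 < e &
  forall (t0 : R) z, `|t0| < e -> pr z = c t0 ->
    exists2 h, integral_curve [set t | `|t + t0| < e] VZ h & h 0 = z.
Proof.
move=> hc; have [f [K [W [sf cK f0 [oW Wc] fW]]]] := local_primitive (c 0) hal cal.
have : nbhs (0 : R) [set t | W (c t)].
  by apply: (icurve_continuous hc (t := 0) Logic.I); exact: open_nbhs_nbhs.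
case/nbhs_ballP => e /= e0 he; exists e => // t0 z t0e ez.
have he' (t : R) : `|t| < e -> W (c t) by move=> te; apply: he; rewrite -ball_normE /= sub0r normrN.
have hf : is_vfield (hamiltonian Q f) by case: hQ => _ _ sQ; apply: sQ; exact: dfun_form1.
have cf : complete (hamiltonian Q f).
  apply: (complete_csupp hf cK) => q Kq; rewrite /hamiltonian f0 //.
  have [l _ _] := hQ; have := l q (-1) (fun=> 0) (fun=> 0).
  rewrite (_ : (fun u : tangent q => -1 * 0 + 0) = fun=> 0); last by apply/funext => u; rewrite mulr0 addr0.
  by rewrite scaleN1r addNr => -> // a u v; rewrite mulr0 addr0.
have [h hh h0] := cmp sf cf z; exists h => //.
pose S := [set t : R | `|t + t0| < e].
have oS : open S := shift_open (a := t0) (@sball_open R e).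
have iS : is_interval S := shift_itv (a := t0) (@sball_itv R e).
have S0 : S 0 by rewrite /S /= add0r.
have hp : integral_curve S (hamiltonian Q f) (pr \o h).
  by apply: (icurve_push spr (X := hamiltonian P (f \o pr))) => [t _|]; [exact: push_ham|apply: icurve_sub hh].
have hc' : integral_curve S (hamiltonian Q f) (fun t => c (t + t0)).
  apply: icurve_field (icurve_sub _ (icurve_shift (a := t0) hc)) => // t St.
  by rewrite /hamiltonian fW //; exact: he'.
(* Both curves solve the Hamiltonian equation of [f]: [pr \o h] because [pr] relates the bivectors,
   the shifted [c] because it stays in [W], where Q(df) is [V]. Hence [pr \o h] stays in [W] too,
   and [h] follows [VZ] there. *)
have E t : S t -> pr (h t) = c (t + t0).
  by apply: (icurve_unique hf oS iS hp hc' S0) => /=; rewrite h0 add0r.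
apply: icurve_field (icurve_sub _ hh) => // t St; rewrite /hamiltonian; congr (P _ _).
apply/funext => u; rewrite /pullback1 -fW; last by rewrite E //; exact: he'.
by rewrite /dfun pushE.
Qed.

(** The time granted by [VZ_escape] depends on the base curve alone, not on the point of the fibre.
    It is used at both ends of the interval of existence, beyond which the base curve is known since
    [V] is complete. *)
Lemma VZ_complete : complete V -> complete VZ.
Proof.
move=> cV; apply: (complete_prolong VZ_vfield) => z g a a0 hg g0.
have [c hc c0] := cV (pr z).
have hpg : integral_curve (sball a) V (pr \o g).
  by apply: (icurve_push spr _ hg) => t _; exact: push_VZ.
have E t : sball a t -> pr (g t) = c t.
  apply: (icurve_unique V_vfield (sball_open (a := a)) (sball_itv (a := a)) hpg _ (sball0 a0)).
    by apply: icurve_sub hc.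
  by rewrite /= g0 c0.
have H (b : R) : `|b| = a -> exists (t e : R) h, [/\ `|t| < a, `|b - t| < e, integral_curve (sball e) VZ h & h 0 = g t].
  move=> ba; have [e e0 he] := VZ_escape (icurve_shift (J := setT) (a := b) hc).
  pose d := Num.min (e / 2) a; have d0 : 0 < d by rewrite lt_min divr_gt0.
  have de : d <= e / 2 by rewrite ge_min lexx.
  have da : d <= a by rewrite ge_min lexx orbT.
  (* The restarting time [b + t0] is the end [b] moved inwards by [d / 2]. The piece found there
     lives for [e - d / 2], more than the [d / 2] needed to pass [b]. *)
  pose t0 := - (d / a / 2 * b).
  have nt0 : `|t0| = d / 2.
    rewrite normrN normrM ba ger0_norm ?divr_ge0 // ?(ltW d0) ?(ltW a0) //.
    by rewrite mulrAC divfK ?gt_eqF.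
  have nbt : `|b + t0| < a.
    have -> : b + t0 = (1 - d / a / 2) * b by rewrite /t0; ring.
    have da1 : d / a <= 1 by rewrite ler_pdivrMr // mul1r.
    have da0 : 0 < d / a by rewrite divr_gt0.
    rewrite normrM ba ger0_norm; last by lra.
    by rewrite -[X in _ < X]mul1r ltr_pM2r //; lra.
  have t0e : `|t0| < e by rewrite nt0; lra.
  have et0 : pr (g (b + t0)) = c (t0 + b) by rewrite E // addrC.
  have [h hh h0] := he _ _ t0e et0.
  exists (b + t0), (e - d / 2), h; split=> //.
    by rewrite opprD addNKr normrN nt0; lra.
  apply: icurve_sub hh => t; rewrite /sball /= => te.
  by apply: le_lt_trans (ler_normD _ _) _; rewrite nt0; lra.
have [|t1 [e1 [h1 [t1a be1 c1 h10]]]] := H a; first by rewrite gtr0_norm.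
have [|t2 [e2 [h2 [t2a be2 c2 h20]]]] := H (- a); first by rewrite normrN gtr0_norm.
apply: (icurve_prolong VZ_vfield a0 hg g0 t1a _ c1 h10 t2a _ c2 h20).
  by move: be1; rewrite ltr_norml => /andP[]; lra.
by move: be2; rewrite ltr_norml => /andP[]; lra.
Qed.

(** Contracting [om] with [VZ] gives the pullback of [alpha], which is closed, and [om] is closed as
    well: both terms of Cartan's formula vanish. *)
Lemma om_preserved z (u v : tangent z) : lie_form VZ om u v = 0.
Proof.
rewrite /lie_form com add0r (_ : contract VZ om = pullback1 pr alpha); first exact: closed1_pullback.
by apply: functional_extensionality_dep => q; apply/funext => w; exact: omVZ.
Qed.

Lemma B_I z (u v : tangent z) : B z (I z u) v = - om z u v.
Proof. by case: cI => _ II _; rewrite -omI II (covN (form2_linl v hom)). Qed.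

Lemma om_Ir z (u v : tangent z) : om z u (I z v) = B z u v.
Proof. by rewrite (form2_skew _ _ hom) omI -(form2_skew _ _ hB). Qed.

(** As [B(VZ, w) = om(VZ, I w)] and [pr] is holomorphic, contracting [B] with [VZ] gives the
    pullback of [twist J alpha]; the differential of the latter is d^c alpha by [dc1E]. *)
Lemma lie_B : lie_form VZ B = pullback2 pr (dc1 J alpha).
Proof.
have hJ : is_endo J by case: cJ.
have ht := twist_form1 hJ hal.
apply: functional_extensionality_dep => z; apply/funext => u; apply/funext => v.
rewrite /lie_form cB add0r (dc1E cJ hal cal) /pullback2 -ext_d1_pullback //.
congr (ext_d1 _ z u v); apply: functional_extensionality_dep => q; apply/funext => w.
by rewrite /contract -om_Ir omVZ /pullback1 /twist hol.
Qed.

Lemma dc_form2 : is_form2 (dc1 J alpha).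
Proof. by rewrite (dc1E cJ hal cal); apply: ext_d1_form2; apply: twist_form1 => //; case: cJ. Qed.

Lemma dc_closed2 : closed2 (dc1 J alpha).
Proof. by rewrite (dc1E cJ hal cal); apply: ext_d1_closed; apply: twist_form1 => //; case: cJ. Qed.

Lemma dc_type11 p (u v : tangent p) : dc1 J alpha p (J p u) v + dc1 J alpha p u (J p v) = 0.
Proof.
rewrite (dc1E cJ hal cal); have [hJ JJ _] := cJ.
rewrite -(ext_d1_twist (J p u) v cJ hal cal) JJ (covN (form2_linl _ (ext_d1_form2 (twist_form1 hJ hal)))).
by rewrite addNr.
Qed.

(** Evaluate d om = 0 on the Hamiltonian fields of two pulled back functions and on [VZ]: with the
    closedness of the pullback of [alpha] this is the derivation rule on [Z], and it descends along
    [pr]. *)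
Lemma V_preserves : preserves_bivector V Q.
Proof.
move=> f g sf sg p; have [z <-] := surj p.
pose F := f \o pr; pose G := g \o pr.
have sF : smooth F := smooth_comp spr sf; have sG : smooth G := smooth_comp spr sg.
have [_ _ vQ] := hQ; have sV := V_vfield.
have eX k h q : smooth k -> smooth h -> Q (pr q) (dfun k (pr q)) h = hamiltonian P (k \o pr) q (h \o pr) :> R.
  by move=> sk sh; rewrite -[Q _ _]/(hamiltonian Q k (pr q)) -push_ham // pushE.
have eV h : smooth h -> (fun q => VZ q (h \o pr)) = (fun p => V p h) \o pr.
  by move=> sh; apply/funext => q; rewrite -pushE // push_VZ.
have sVf : smooth (fun p => V p f) := sV f sf; have sVg : smooth (fun p => V p g) := sV g sg.
rewrite !eX // -!eV // -push_VZ pushE //; last exact: (vQ _ (dfun_form1 sf)).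
have -> : (fun q => Q q (dfun f q) g) \o pr = fun q => hamiltonian P F q G.
  by apply/funext => q; rewrite /= eX.
have sVZ := VZ_vfield; have hF := ham_vfield sF; have hG := ham_vfield sG.
have sVF : smooth (fun q => VZ q F) := sVZ F sF; have sVG : smooth (fun q => VZ q G) := sVZ G sG.
have skew (h k : Z -> R) q : smooth h -> smooth k -> hamiltonian P h q k = - hamiltonian P k q h.
  by move=> sh sk; rewrite -(om_ham (hamiltonian P h q) sk) (form2_skew _ _ hom) om_ham.
have aE (h : Z -> R) q : smooth h -> pullback1 pr alpha q (hamiltonian P h q) = - VZ q h.
  by move=> sh; rewrite /pullback1 -omVZ (form2_skew _ _ hom) om_ham.
have e1 := com (hamiltonian P F z) (hamiltonian P G z) (VZ z).
rewrite (ext_d2E z hom hF hG sVZ) /d2_expr in e1.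
have f1 : (fun q => om q (hamiltonian P G q) (VZ q)) = fun q => VZ q G by apply/funext => q; rewrite om_ham.
have f2 : (fun q => om q (hamiltonian P F q) (VZ q)) = fun q => VZ q F by apply/funext => q; rewrite om_ham.
have f3 : (fun q => om q (hamiltonian P F q) (hamiltonian P G q)) = fun q => - hamiltonian P F q G.
  by apply/funext => q; rewrite om_ham // skew.
have sFG : smooth (fun q => hamiltonian P F q G) by exact: hF.
rewrite f1 f2 f3 tanN // in e1.
have a1 : om z (bracket (hamiltonian P F) (hamiltonian P G) z) (VZ z) =
    hamiltonian P F z (fun q => VZ q G) - hamiltonian P G z (fun q => VZ q F) :> R.
  rewrite (form2_skew _ _ hom) omVZ -[alpha _ _]/(pullback1 pr alpha z _).
  rewrite -(closed1E z pal_form1 (closed1_pullback spr hal cal) hF hG).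
  have -> : (fun q => pullback1 pr alpha q (hamiltonian P G q)) = fun q => - VZ q G by apply/funext => q; rewrite aE.
  have -> : (fun q => pullback1 pr alpha q (hamiltonian P F q)) = fun q => - VZ q F by apply/funext => q; rewrite aE.
  by rewrite !tanN //; ring.
have a2 : om z (bracket (hamiltonian P F) VZ z) (hamiltonian P G z) =
    VZ z (fun q => hamiltonian P F q G) - hamiltonian P F z (fun q => VZ q G) :> R.
  by rewrite (form2_skew _ _ hom) om_ham // bracketE // opprB.
have a3 : om z (bracket (hamiltonian P G) VZ z) (hamiltonian P F z) =
    VZ z (fun q => hamiltonian P G q F) - hamiltonian P G z (fun q => VZ q F) :> R.
  by rewrite (form2_skew _ _ hom) om_ham // bracketE // opprB.
have a4 : VZ z (fun q => hamiltonian P G q F) = - VZ z (fun q => hamiltonian P F q G) :> R.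
  by rewrite -tanN //; congr (tan_val (VZ z) _); apply/funext => q; rewrite skew.
rewrite a1 a2 a3 a4 in e1.
rewrite (skew _ _ z sVF sG).
move: e1; move: (VZ z _) (hamiltonian P F z _) (hamiltonian P G z _) => a b c.
lra.
Qed.

(** The left side is the Lie derivative of [I] along [VZ], applied to [u] and tested on [F], but
    written without brackets so as to be tensorial in [u]. The identity follows from the invariance
    of [om], because [B] is [om] composed with [I]. *)
Lemma lie_I z (u : tangent z) (F : Z -> R) : smooth F ->
  ext_d1 (twist I (dfun F)) z (VZ z) u + u (fun q => twist I (dfun F) q (VZ q)) - I z u (fun q => VZ q F)
  = lie_form VZ B (hamiltonian P F z) u :> R.
Proof.
move=> sF; rewrite -(extendE u); have hU := extend_vfield u; set U := extend u in hU *.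
have hI : is_endo I by case: cI.
have sVZ := VZ_vfield; have hF := ham_vfield sF; have hIU := endo_vfield hI hU.
rewrite (ext_d1E z (twist_form1 hI (dfun_form1 sF)) sVZ hU).
rewrite (lie_formE z sVZ hF hU hB).
have := om_preserved (hamiltonian P F z) (I z (U z)).
rewrite (lie_formE z sVZ hF hIU hom).
have -> : (fun q => om q (hamiltonian P F q) (I q (U q))) = fun q => I q (U q) F.
  by apply/funext => q; rewrite om_ham.
have -> : (fun q => B q (hamiltonian P F q) (U q)) = fun q => I q (U q) F.
  by apply/funext => q; rewrite -om_Ir om_ham.
rewrite -!om_Ir !om_ham // bracketE // /twist /dfun => e.
move: e; move: (VZ z _) (I z (U z) _) (U z _) (om z _ _) (I z _ F) => a b c d e.
lra.
Qed.

(** A field [X] on the base comes with no lift to [Z]. The claim is therefore reduced to an identity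
    that is tensorial in one tangent vector; that vector is lifted, and [lie_I] applies to it. *)
Lemma lie_J X p : is_vfield X ->
  bracket V (fun q => J q (X q)) p - J p (bracket V X p) = Q p (dc1 J alpha p (X p)).
Proof.
move=> hX; have hJ : is_endo J by case: cJ.
have sV := V_vfield; have hJX := endo_vfield hJ hX.
apply: tan_eq => f sf; have hg := twist_form1 hJ (dfun_form1 sf).
have [_ kQ vQ] := hQ.
have -> : Q p (dc1 J alpha p (X p)) f = - dc1 J alpha p (X p) (Q p (dfun f p)) :> R.
  by rewrite -(kQ p (dc1 J alpha p (X p)) (dfun f p) (form2_linr _ dc_form2) (@dfun_linear _ _ f p)).
rewrite tan_subE bracketE //.
suff H q (x : tangent q) : ext_d1 (twist J (dfun f)) q (V q) x + x (fun q => twist J (dfun f) q (V q))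
    - J q x (fun q => V q f) = - dc1 J alpha q x (Q q (dfun f q)) :> R.
  rewrite -H (ext_d1E p hg sV hX) /twist /dfun.
  move: (V p _) (J p (X p) _) (J p _ f) (X p _) => a b c d.
  by ring.
case: (surj q) x => z <- x; have [u <-] := dsurj x.
have sF : smooth (f \o pr) := smooth_comp spr sf.
have sVf : smooth (fun q => V q f) := sV f sf.
have tw : twist I (dfun (f \o pr)) = pullback1 pr (twist J (dfun f)).
  apply: functional_extensionality_dep => y; apply/funext => w.
  by rewrite /twist /pullback1 -hol /dfun pushE.
have := lie_I u sF; rewrite lie_B tw ext_d1_pullback // push_VZ.
have -> : (fun q => pullback1 pr (twist J (dfun f)) q (VZ q)) = (fun q => twist J (dfun f) q (V q)) \o pr.
  by apply/funext => y; rewrite /pullback1 push_VZ.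
have -> : (fun q => VZ q (f \o pr)) = (fun q => V q f) \o pr.
  by apply/funext => y; rewrite -pushE // push_VZ.
have sgV : smooth (fun q => twist J (dfun f) q (V q)) by apply: form1_apply_smooth.
rewrite -!(pushE _ spr) // hol => ->.
by rewrite /pullback2 push_ham // (form2_skew _ _ dc_form2).
Qed.

Lemma V_aut_C_alg : aut_C_alg J Q V (dc1 J alpha).
Proof.
split.
- by split; [exact: V_vfield|exact: V_preserves].
- by split; [exact: dc_form2|exact: dc_closed2].
- exact: dc_type11.
- by move=> X hX p; exact: lie_J.
Qed.

(** * The lifted flow at finite time and the Courant automorphisms below it *)

Section Flow.
Variables (eta : R -> Z -> Z) (eta0 : forall z, eta 0 z = z)
  (heta : forall z, integral_curve setT VZ (eta^~ z)).
Variables (T : set R) (oT : open T) (iT : is_interval T) (T0 : T 0).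
Variables (psi : R -> N -> N) (hpsi : is_flow T V psi).
Variables (s : N -> Z) (ss : smooth_map s) (prs : forall x, pr (s x) = x).

Local Notation Ft := (flow_form psi (dc1 J alpha)).

Lemma eta_smooth t : smooth_map (eta t).
Proof. exact: (gflow_smooth VZ_vfield eta0 heta). Qed.

Lemma etaK t : cancel (eta t) (eta (- t)).
Proof. exact: (gflowK VZ_vfield eta0 heta). Qed.

Lemma etaNK t : cancel (eta (- t)) (eta t).
Proof. exact: (gflowNK VZ_vfield eta0 heta). Qed.

Lemma psi_smooth t : T t -> smooth_map (psi t).
Proof. by case: hpsi => _ h _ /h[]. Qed.

Lemma eta_om t z (u v : tangent z) : om (eta t z) (push (eta t) u) (push (eta t) v) = om z u v.
Proof.
have -> : om z u v = pullback2 (eta 0) om z u v by rewrite pullback2_id.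
apply: (@derive0_cst R (fun r => pullback2 (eta r) om z u v) t) => r _.
have := lie_form_derive VZ_vfield eta0 heta r u v hom.
by rewrite {2}/pullback2 om_preserved.
Qed.

Lemma eta_pr t : T t -> psi t \o pr = pr \o eta t.
Proof.
move=> Tt; apply/funext => z /=; have [psi0 _ cpsi] := hpsi.
have h : integral_curve T V (pr \o eta^~ z).
  by apply: (icurve_push spr (X := VZ)) => [r _|]; [exact: push_VZ|apply: icurve_sub (heta z)].
have e0 : psi 0 (pr z) = (pr \o eta^~ z) 0 by rewrite /= psi0 eta0.
exact: (icurve_unique V_vfield oT iT (cpsi (pr z)) h T0 e0 Tt).
Qed.

(** The derivative of the pullback of [B] by [eta r] is the pullback of d^c alpha by [pr \o eta r],
    which is [psi r \o pr] for [r] in [T]; integrating gives [Ft]. The integrand is continuous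
    because it is itself differentiable in time. *)
Lemma eta_B t : T t -> pullback2 pr (Ft t) = fun z u v => pullback2 (eta t) B z u v - B z u v.
Proof.
move=> Tt; apply: functional_extensionality_dep => z; apply/funext => u; apply/funext => v.
have -> : B z u v = pullback2 (eta 0) B z u v by rewrite pullback2_id.
have hD := pullback2_form2 spr dc_form2.
apply: (@oriented_integral_derive R T (fun r => pullback2 (eta r) B z u v)
  (fun r => pullback2 (eta r) (pullback2 pr (dc1 J alpha)) z u v) _ t iT T0 Tt).
- by move=> r; exact: (derive_continuous (lie_form_derive VZ_vfield eta0 heta r u v hD)).
- by move=> r; have := lie_form_derive VZ_vfield eta0 heta r u v hB; rewrite lie_B.
- move=> r Tr; rewrite (pullback2_comp _ (eta_smooth r) spr) -eta_pr //.
  by rewrite -(pullback2_comp _ spr (psi_smooth Tr)).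
Qed.

(** Pulling [eta_B] back along a section of [pr] removes [pr]. Smoothness and closedness of [Ft]
    come from this formula rather than from the integral. *)
Lemma Ft_section t : T t -> Ft t = pullback2 s (fun z u v => pullback2 (eta t) B z u v - B z u v).
Proof. by move=> Tt; rewrite -eta_B // (pullback2_comp _ ss spr) pullback2_id. Qed.

Lemma Ft_form2 t : T t -> is_form2 (Ft t).
Proof.
move=> Tt; rewrite Ft_section //; apply: (pullback2_form2 ss).
by apply: form2B => //; apply: pullback2_form2 => //; exact: eta_smooth.
Qed.

Lemma Ft_closed2 t : T t -> closed2 (Ft t).
Proof.
move=> Tt; have h := pullback2_form2 (eta_smooth t) hB.
rewrite Ft_section //; apply: (closed2_pullback ss); first exact: form2B.
by apply: closed2B => //; exact: (closed2_pullback (eta_smooth t)).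
Qed.

Lemma eta_push_surj t z (w : tangent (eta t z)) : exists u, push (eta t) u = w.
Proof. exact: (push_surj (eta_smooth t) (eta_smooth (- t)) (@etaK t) (@etaNK t)). Qed.

Lemma eta_P t : related_bivectors (eta t) P P.
Proof.
move=> z xi lxi; symmetry; apply: (inv_form_unique hom nd) => w.
have [u <-] := eta_push_surj w; rewrite eta_om inv_formP //.
exact: (cov_push (eta_smooth t)).
Qed.

Lemma eta_gauge t z (u : tangent z) : T t ->
  push (eta t) (gauge I P (pullback2 pr (Ft t)) z u) = I (eta t z) (push (eta t) u).
Proof.
move=> Tt; apply: (symplectic_gauge hom nd (pullback2_form2 spr (Ft_form2 Tt)) omI).
- by move=> q w; exact: eta_push_surj.
- by move=> q a b; exact: eta_om.
- by move=> q a b; rewrite eta_B // addrC subrK.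
Qed.

Lemma psi_preserves t : T t -> preserves Q (psi t).
Proof.
move=> Tt; apply: (related_factor spr (psi_smooth Tt) surj rel); rewrite eta_pr //.
exact: (related_comp (eta_smooth t) spr (@eta_P t) rel).
Qed.

Lemma pr_gauge t z (u : tangent z) : T t ->
  push pr (gauge I P (pullback2 pr (Ft t)) z u) = gauge J Q (Ft t) (pr z) (push pr u).
Proof.
move=> Tt; rewrite /gauge pushD // hol -rel //.
exact: (form2_linr _ (Ft_form2 Tt)).
Qed.

(** The identity holds on [Z] for [eta t] by [eta_gauge], and both of its sides project along [pr],
    whose differential is onto. *)
Lemma psi_gauge t p (u : tangent p) : T t ->
  push (psi t) (gauge J Q (Ft t) p u) = J (psi t p) (push (psi t) u).
Proof.
move=> Tt; case: (surj p) u => z <- u; have [w <-] := dsurj u.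
rewrite -pr_gauge // -!(push_comp _ spr (psi_smooth Tt)) -[psi t (pr z)]/((psi t \o pr) z).
rewrite eta_pr // !(push_comp _ (eta_smooth t) spr) eta_gauge //.
exact: hol.
Qed.

(** On [Z] the sum is [G(gx, y) + G(x, I y)], where [G] is the pullback of [B] by [eta t] minus [B],
    and [gx] is the gauge transform of [I] applied to [x]. Each of the two forms in [G] contributes
    [om(gx, I y) - om(x, y)], so they cancel. *)
Lemma Ft_type t p (u v : tangent p) : T t ->
  Ft t p (J p u) v + Ft t p u (J p v) + Ft t p (Q p (Ft t p u)) v = 0.
Proof.
move=> Tt; case: (surj p) u v => z <- u v; have [x <-] := dsurj u; have [y <-] := dsurj v.
have hF := Ft_form2 Tt; have hG := pullback2_form2 spr hF.
have lg a : Ft t (pr z) (gauge J Q (Ft t) (pr z) (push pr x)) a =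
    Ft t (pr z) (J (pr z) (push pr x)) a + Ft t (pr z) (Q (pr z) (Ft t (pr z) (push pr x))) a.
  by rewrite /gauge (covD (form2_linl _ hF)).
rewrite addrAC -lg -pr_gauge // -hol.
rewrite -[X in X + _]/(pullback2 pr (Ft t) z _ y) -[X in _ + X]/(pullback2 pr (Ft t) z x _).
set gx := gauge I P _ z x.
have B1 : pullback2 (eta t) B z gx y = - om z x y by rewrite /pullback2 eta_gauge // B_I eta_om.
have B2 : pullback2 (eta t) B z x (I z y) = om z gx (I z y).
  by rewrite /pullback2 -[RHS](eta_om t) eta_gauge // omI.
rewrite eta_B // B1 B2 om_Ir -(omI x (I z y)) om_Ir B_I.
by ring.
Qed.

Lemma psi_Aut_C t : T t -> Aut_C J Q (psi t) (Ft t).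
Proof.
move=> Tt; split.
- by split; [case: hpsi => _ h _; exact: h|exact: psi_preserves].
- by split; [exact: Ft_form2|exact: Ft_closed2].
- by move=> p u v; exact: Ft_type.
- by move=> p u; exact: psi_gauge.
Qed.

End Flow.

End BraneFlow.

(** * The action on branes *)

Section Action.
Variables (R : realType) (Xm M : manifold R) (Jm : endo Xm) (Qm : bivector Xm) (Jp : endo M) (Q : bivector M).
Variable (D : brane_data Xm M).
Arguments Jm : clear implicits.
Arguments Qm : clear implicits.
Arguments Jp : clear implicits.
Arguments Q : clear implicits.
Local Notation om := (imF (Omega D)).
Local Notation B := (reF (Omega D)).
Local Notation P := (inv_form (imF (Omega D))).
Local Notation I := (cplx_of (Omega D)).
Hypotheses (mD : morita Jm Qm Jp Q D) (bD : brane_bisection D).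

Lemma complex_ext (a b : R[i]) : complex.Re a = complex.Re b -> complex.Im a = complex.Im b -> a = b.
Proof. by case: a b => [a1 a2] [b1 b2] /= -> ->. Qed.

Lemma Omega_symplectic : holomorphic_symplectic (Omega D). Proof. by case: mD. Qed.

Lemma om_form2 : is_form2 om. Proof. by case: Omega_symplectic => _ []. Qed.
Lemma om_closed2 : closed2 om. Proof. by case: Omega_symplectic => _ []. Qed.
Lemma B_form2 : is_form2 B. Proof. by case: Omega_symplectic => -[]. Qed.
Lemma B_closed2 : closed2 B. Proof. by case: Omega_symplectic => -[]. Qed.
Lemma om_nondegenerate : Defs.nondegenerate om. Proof. by case: Omega_symplectic. Qed.
Lemma I_complex : complex_structure I. Proof. by case: Omega_symplectic. Qed.

Lemma om_I z (u v : tangent z) : om z (I z u) v = B z u v.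
Proof. exact: (inv_formP om_form2 om_nondegenerate (form2_linr u B_form2)). Qed.

Lemma B_om z (u v : tangent z) : B z u v = om z u (I z v).
Proof. by rewrite (form2_skew _ _ om_form2) om_I -(form2_skew _ _ B_form2). Qed.

Lemma pim_smooth : smooth_map (pim D). Proof. by case: mD => _ _ [_ []]. Qed.
Lemma pip_smooth : smooth_map (pip D). Proof. by case: mD => _ _ _ [_ []]. Qed.

Lemma pip_surj q : exists z, pip D z = q.
Proof. by case: mD => _ _ _ [_ _ /(_ q Logic.I)[z _ h] _ _] _; exists z. Qed.

Lemma pip_push_surj z (w : tangent (pip D z)) : exists u : tangent z, push (pip D) u = w.
Proof. by case: mD => _ _ _ [_ [_ h] _ _ _] _; exact: h. Qed.

Lemma pip_hol z (u : tangent z) : push (pip D) (I z u) = Jp (pip D z) (push (pip D) u).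
Proof. by case: mD => _ _ _ [[_ h] _ _ _ _] _; exact: h. Qed.

Lemma pim_hol z (u : tangent z) : push (pim D) (I z u) = Jm (pim D z) (push (pim D) u).
Proof. by case: mD => _ _ [[_ h] _ _ _ _] _ _; exact: h. Qed.

Lemma pip_related : related_bivectors (pip D) P Q.
Proof.
case: mD => _ _ _ [_ _ _ _ [[_ h] _]] _ p xi lxi.
have := h p xi lxi; rewrite /sigma_im pushN ?pushZ //; try exact: pip_smooth.
by move/oppr_inj/scalerI; apply; rewrite invr_eq0 pnatr_eq0.
Qed.

(** Orthogonality in [morita] is for the complex form. The real part at (u, v) is the imaginary part
    at (u, I v), and the kernel of d pi_+ is stable under [I], so orthogonality for the imaginary
    part is enough. *)
Lemma pim_ker z (u : tangent z) : (forall v : tangent z, push (pip D) v = 0 -> om z u v = 0) -> push (pim D) u = 0.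
Proof.
move=> h; case: mD => _ _ _ _ /(_ z u)[_ ->] v v0.
apply: complex_ext; last exact: h.
rewrite -[LHS]/(B z u v) B_om; apply: h; rewrite pip_hol v0.
by apply: endo0; case: mD => -[_ [[]]].
Qed.

Lemma pip_ker z (u : tangent z) : (forall v : tangent z, push (pim D) v = 0 -> om z u v = 0) -> push (pip D) u = 0.
Proof.
move=> h; case: mD => _ _ _ _ /(_ z u)[-> _] v v0.
apply: complex_ext; last exact: h.
rewrite -[LHS]/(B z u v) B_om; apply: h; rewrite pim_hol v0.
by apply: endo0; case: mD => -[[[]]].
Qed.

(** Pairing such a vector under [om] with a vertical vector of pi_+ evaluates [xi] at 0. It is
    applied both to the lifted field and to the correction term of the gauged complex structure. *)
Lemma push_pim_lift z (xi : covector (pip D z)) : covec_linear xi ->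
  push (pim D) (P z (fun u => xi (push (pip D) u))) = 0.
Proof.
move=> lxi; apply: pim_ker => v v0; rewrite (inv_formP om_form2 om_nondegenerate); first by rewrite v0 cov0.
exact: (cov_push pip_smooth).
Qed.

(** * One Courant automorphism covered by a diffeomorphism of Z *)

Section OneMap.
Variables (phi phi' : tot D -> tot D) (psi psi' : M -> M) (F : form2 M).
Arguments F : clear implicits.
Hypotheses (sphi : smooth_map phi) (sphi' : smooth_map phi') (K : cancel phi phi') (K' : cancel phi' phi).
Hypotheses (spsi : smooth_map psi) (spsi' : smooth_map psi') (L : cancel psi psi') (L' : cancel psi' psi).
Hypotheses (phi_om : forall z (u v : tangent z), om (phi z) (push phi u) (push phi v) = om z u v)
  (phi_B : forall z (u v : tangent z),
     B (phi z) (push phi u) (push phi v) = B z u v + pullback2 (pip D) F z u v)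
  (phi_pip : pip D \o phi = psi \o pip D) (phi_pim : pim D \o phi = pim D)
  (psi_C : Aut_C Jp Q psi F).

Local Notation D1 := (act psi F D).
Local Notation I1 := (gauge I P (pullback2 (pip D) F)).

Lemma F_form2 : is_form2 F. Proof. by case: psi_C => _ []. Qed.

Lemma Q_preserved : related_bivectors psi Q Q. Proof. by case: psi_C => -[]. Qed.

Lemma im_act : imF (Omega D1) = om :> form2 (tot D).
Proof.
apply: functional_extensionality_dep => z; apply/funext => u; apply/funext => v.
by rewrite /imF /=; case: (Omega D z u v) => a b /=; rewrite addr0.
Qed.

Lemma re_act : reF (Omega D1) = pullback2 phi B :> form2 (tot D).
Proof.
apply: functional_extensionality_dep => z; apply/funext => u; apply/funext => v.
by rewrite /pullback2 phi_B /reF /=; case: (Omega D z u v).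
Qed.

Lemma Omega_phi z (u v : tangent z) : Omega D (phi z) (push phi u) (push phi v) = Omega D1 z u v.
Proof.
apply: complex_ext; first by rewrite -[LHS]/(pullback2 phi B z u v) -re_act.
by rewrite -[LHS]/(om (phi z) _ _) phi_om -im_act.
Qed.

Lemma act_Omega0 z (u v : tangent z) : pullback2 (pip D) F z u v = 0 -> Omega D1 z u v = Omega D z u v.
Proof. by rewrite /= => ->; case: (Omega D z u v) => a b; apply: complex_ext => /=; rewrite addr0. Qed.

(** The real form added to Omega leaves the imaginary part unchanged and is added to the real part,
    and inversion of [om] is linear. *)
Lemma cplx_act : cplx_of (Omega D1) = I1 :> endo (tot D).
Proof.
apply: functional_extensionality_dep => z; apply/funext => u.
rewrite /cplx_of im_act re_act /gauge -[RHS](scale1r) scalerDr scale1r.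
have hG := pullback2_form2 pip_smooth F_form2.
have := inv_form_linear om_form2 om_nondegenerate 1 (form2_linr u B_form2) (form2_linr u hG).
rewrite !scale1r => <-; congr (P z _); apply/funext => v.
by rewrite /pullback2 phi_B mul1r.
Qed.

Lemma phi_I z (u : tangent z) : push phi (I1 z u) = I (phi z) (push phi u).
Proof.
apply: (symplectic_gauge om_form2 om_nondegenerate (pullback2_form2 pip_smooth F_form2) om_I _ phi_om phi_B).
by move=> q w; exact: (push_surj sphi sphi' K K').
Qed.

Lemma phi_P : related_bivectors phi P P.
Proof.
move=> z xi lxi; symmetry; apply: (inv_form_unique om_form2 om_nondegenerate) => w.
have [u <-] := push_surj sphi sphi' K K' w; rewrite phi_om (inv_formP om_form2 om_nondegenerate) //.
exact: (cov_push sphi).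
Qed.

Lemma pim_I1 z (u : tangent z) : push (pim D) (I1 z u) = Jm (pim D z) (push (pim D) u).
Proof.
rewrite /gauge pushD ?pim_hol; last exact: pim_smooth.
by rewrite push_pim_lift ?addr0 //; exact: (form2_linr _ F_form2).
Qed.

Lemma pip_I1 z (u : tangent z) : push (psi \o pip D) (I1 z u) = Jp (psi (pip D z)) (push (psi \o pip D) u).
Proof.
rewrite -[psi _]/((psi \o pip D) z) -phi_pip !(push_comp _ sphi pip_smooth) phi_I.
exact: pip_hol.
Qed.

Lemma act_symplectic : holomorphic_symplectic (Omega D1).
Proof.
split.
- by rewrite re_act; split; [exact: (pullback2_form2 sphi B_form2)|exact: (closed2_pullback sphi B_form2 B_closed2)].
- by rewrite im_act; split; [exact: om_form2|exact: om_closed2].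
- by rewrite im_act; exact: om_nondegenerate.
- by rewrite cplx_act; exact: (transport_complex_structure sphi sphi' K phi_I I_complex).
- move=> z u v; rewrite cplx_act -!Omega_phi phi_I.
  by case: Omega_symplectic => _ _ _ _; exact.
Qed.

(** [phi] preserves the Poisson structure, so [phi'] carries integral curves of one Hamiltonian
    field to those of the other. *)
Lemma complete_phi (f : tot D -> R) : smooth f -> complete (hamiltonian P f) -> complete (hamiltonian P (f \o phi)).
Proof.
move=> sf cf z; have [g hg g0] := cf (phi z).
exists (phi' \o g); last by rewrite /= g0 K.
apply: (icurve_push sphi' _ hg) => t _; rewrite /hamiltonian.
rewrite -(related_inverse sphi sphi' K K' phi_P); last exact: dfun_linear.
congr (push _ (P _ _)); apply/funext => u; rewrite /dfun pushE //; last exact: smooth_comp.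
by congr (tan_val u _); apply/funext => q /=; rewrite K'.
Qed.

Lemma morita_act : morita Jm Qm Jp Q D1.
Proof.
have [hol _ [h1 h2 h3 h4 [[h5 h6] h7]] [k1 k2 k3 k4 [[k5 k6] k7]] orth] := mD.
split=> //; first exact: act_symplectic.
- rewrite im_act cplx_act; split=> //; first by split; [exact: pim_smooth|exact: pim_I1].
  split=> //; split=> // z xi lxi.
  by have := h5 z xi lxi; rewrite /sigma_re !pushN ?pushZ ?pim_hol ?pim_I1 //; exact: pim_smooth.
- have sc : smooth_map (psi \o pip D) := smooth_map_comp pip_smooth spsi.
  have rc : related_bivectors (psi \o pip D) P Q := related_comp pip_smooth spsi pip_related Q_preserved.
  rewrite im_act cplx_act; split=> //.
  + by split; [exact: sc|exact: pip_I1].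
  + split=> // z w; have [x hx] := push_surj spsi spsi' L L' w; have [u hu] := pip_push_surj x.
    by exists u; rewrite (push_comp u pip_smooth spsi) hu.
  + by move=> q _; have [z hz] := pip_surj (psi' q); exists z => //=; rewrite hz L'.
  + move=> x; have -> : (psi \o pip D) @^-1` [set x] = pip D @^-1` [set psi' x].
      by apply/seteqP; split=> z; rewrite /preimage /=; [move=> <-; rewrite L|move=> ->; rewrite L'].
    exact: k4.
  + split.
      by split; [exact: (related_sigma_re sc pip_I1 rc)|exact: (related_sigma_im sc rc)].
    (* The new projection is also [pip D \o phi], so completeness reduces to that of [pip D]. *)
    move=> f sf cf; have -> : f \o (pip D1) = (f \o pip D) \o phi.
      by apply/funext => z; have := congr1 (fun h => f (h z)) phi_pip.
    by apply: complete_phi; [exact: (smooth_comp pip_smooth sf)|exact: k7].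
(* The added term vanishes as soon as one argument is vertical for pi_+. The converse implications
   use only the imaginary part, which is unchanged, through [pip_ker] and [pim_ker]. *)
- have inj z (u : tangent z) : push (psi \o pip D) u = 0 <-> push (pip D) u = 0.
    rewrite (push_comp u pip_smooth spsi); split=> [e|->]; last by rewrite push0.
    by apply: (push_inj spsi spsi' L); rewrite e push0.
  move=> z u; have [orp orm] := orth z u; split.
    split=> [/inj u0 v v0|h].
      rewrite act_Omega0; first exact: orp.1.
      by rewrite /pullback2 u0 (cov0 (form2_linl _ F_form2)).
    apply/inj; apply: pip_ker => v v0; have := congr1 (fun a => complex.Im a) (h v v0).
    by rewrite -[LHS]/(imF (Omega D1) z u v) im_act.
  split=> [u0 v /inj v0|h].
    rewrite act_Omega0; first exact: orm.1.
    by rewrite /pullback2 v0 (cov0 (form2_linr _ F_form2)).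
  apply: pim_ker => v v0; have /inj v1 := v0; have := congr1 (fun a => complex.Im a) (h v v1).
  by rewrite -[LHS]/(imF (Omega D1) z u v) im_act.
Qed.

Local Notation D2 := (with_brane D (phi @` brane D)).

Lemma act_isomorphic : isomorphic D1 D2.
Proof.
exists phi; split=> //.
- split; first by split=> //; exists phi'.
  by split=> // z u; rewrite cplx_act; exact: phi_I.
- by move=> z u v; exact: Omega_phi.
- by move=> z; have := congr1 (fun h => h z) phi_pim.
- by move=> z; have := congr1 (fun h => h z) phi_pip.
Qed.

Lemma section_act s : section_onto (pip D) (brane D) s -> section_onto (psi \o pip D) (brane D) (s \o psi').
Proof.
move=> [ss sL sK sK']; split.
- exact: (smooth_map_comp spsi' ss).
- by move=> x; exact: sL.
- by move=> x /=; rewrite sK L'.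
- by move=> z Lz /=; rewrite L sK'.
Qed.

Lemma brane_act : brane_bisection D1.
Proof.
have [h1 h2 h3 [s hs]] := bD; split=> //; first by rewrite im_act.
by exists (s \o psi'); exact: section_act.
Qed.

Lemma tangent_phi z (u : tangent z) : tangent_to (phi @` brane D) (push phi u) <-> tangent_to (brane D) u.
Proof.
split=> h f sf f0; last by rewrite pushE //; apply: h; [exact: smooth_comp|move=> q Lq; apply: f0; exists q].
rewrite (push_value sphi sphi' K u sf); apply: h; first exact: smooth_comp.
by move=> _ [q Lq <-] /=; rewrite K; exact: f0.
Qed.

Lemma section_phi s : section_onto (pip D) (brane D) s ->
  section_onto (pip D) (phi @` brane D) (phi \o s \o psi').
Proof.
move=> [ss sL sK sK']; have e z : pip D (phi z) = psi (pip D z) := congr1 (fun h => h z) phi_pip.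
split.
- by apply: smooth_map_comp => //; exact: smooth_map_comp.
- by move=> x /=; exists (s (psi' x)).
- by move=> x; rewrite /= e sK L'.
- by move=> _ [q Lq <-]; rewrite /= e L sK'.
Qed.

Lemma brane_with : brane_bisection D2.
Proof.
have [h1 h2 [sm [ssm smL smK smK']] [s hs]] := bD; split.
- have [m hm] := h1; exists m => _ [q Lq <-]; have [U [f [oU Uq sf df Uf]]] := hm q Lq.
  exists (phi' @^-1` U), (fun i => f i \o phi'); split.
  + exact: (preim_open sphi').
  + by rewrite /preimage /= K.
  + by move=> i; exact: smooth_comp.
  + move=> c; have [u hu] := df c; exists (push phi u) => i; rewrite -hu.
    by symmetry; exact: (push_value sphi sphi' K u (sf i)).
  + move=> x Ux; rewrite -Uf //; split=> [[y Ly <-]|Lx]; first by rewrite K.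
    by exists (phi' x) => //; rewrite K'.
- move=> _ [q Lq <-] w; have [u <-] := push_surj sphi sphi' K K' w.
  rewrite tangent_phi (h2 q Lq); split=> h v tv.
    have [v' e] := push_surj sphi sphi' K K' v; rewrite -e phi_om; apply: h.
    by apply/tangent_phi; rewrite e.
  by rewrite -phi_om; apply: h; apply/tangent_phi.
- have e z : pim D (phi z) = pim D z := congr1 (fun h => h z) phi_pim.
  exists (phi \o sm); split.
  + exact: smooth_map_comp.
  + by move=> x /=; exists (sm x).
  + by move=> x; rewrite /= e smK.
  + by move=> _ [q Lq <-]; rewrite /= e smK'.
- by exists (phi \o s \o psi'); exact: section_phi.
Qed.

(** * The induced degenerate generalized Kähler structure on the base *)

Section Induced.
Variable (s : M -> tot D).
Hypotheses (hs : section_onto (pip D) (brane D) s) (rel_chi : related_bivectors (pim D \o s) Q Qm)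
  (gk0 : degenerate_gk Jp (pullback_endo (pim D \o s) Jm) Q (pullback2 s B)).

Local Notation chi := (pim D \o s).
Local Notation Jt := (pullback_endo (pim D \o s \o psi') Jm).
Local Notation Gt := (pullback2 (s \o psi') (pullback2 phi B)).

Lemma s_smooth : smooth_map s. Proof. by case: hs. Qed.

Lemma chi_smooth : smooth_map chi. Proof. exact: smooth_map_comp s_smooth pim_smooth. Qed.

(** Both projections restrict to diffeomorphisms of the brane: lift by the section of pi_-, then
    project by pi_+. *)
Lemma chi_inverse : exists chi', [/\ smooth_map chi', cancel chi chi' & cancel chi' chi].
Proof.
have [_ _ [sm [ssm smL smK smK']] _] := bD; have [ss sL sK sK'] := hs.
exists (pip D \o sm); split.
- exact: smooth_map_comp ssm pip_smooth.
- by move=> x /=; rewrite smK' // sK.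
- by move=> y /=; rewrite sK' // smK.
Qed.

Lemma chi_endo p (u : tangent p) :
  push chi (pullback_endo chi Jm p u) = Jm (chi p) (push chi u).
Proof. by have [c [sc cK cK']] := chi_inverse; exact: (pullback_endoE chi_smooth sc cK cK'). Qed.

Lemma kappa_endo p (u : tangent p) :
  push (chi \o psi') (Jt p u) = Jm (chi (psi' p)) (push (chi \o psi') u).
Proof.
have [c [sc cK cK']] := chi_inverse.
apply: (@pullback_endoE _ _ _ (chi \o psi') (psi \o c)).
- exact: smooth_map_comp spsi' chi_smooth.
- exact: smooth_map_comp sc spsi.
- by move=> x /=; rewrite [c _]cK L'.
- by move=> x /=; rewrite L; exact: cK'.
Qed.

Lemma push_psi'_Jt p (u : tangent p) :
  push psi' (Jt p u) = pullback_endo chi Jm (psi' p) (push psi' u).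
Proof.
have [c [sc cK _]] := chi_inverse; apply: (push_inj chi_smooth sc cK).
by rewrite chi_endo -!(push_comp _ spsi' chi_smooth); exact: kappa_endo.
Qed.

Lemma push_psi'_Jp p (u : tangent p) :
  push psi' (Jp p u) = gauge Jp Q F (psi' p) (push psi' u).
Proof. by apply: (intertwine_inverse spsi spsi' L L'); case: psi_C. Qed.

(** [Gt] is the form induced by the acted data and by the moved brane alike: pulling the acted form
    back by [s \o psi'] is pulling the original one back by [phi \o s \o psi']. *)
Lemma Gt_pullback : Gt = pullback2 psi' (fun p u v => pullback2 s B p u v + F p u v).
Proof.
have [ss _ sK _] := hs.
rewrite -(pullback2_comp _ spsi' ss); congr (pullback2 psi' _).
have -> : F = pullback2 s (pullback2 (pip D) F).
  by rewrite (pullback2_comp _ ss pip_smooth) pullback2_id.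
apply: functional_extensionality_dep => p; apply/funext => u; apply/funext => v.
by rewrite /pullback2 phi_B.
Qed.

(** Seen through [psi'], the tuple becomes [Jp + Q F], the old second structure, [Q] and [F0 + F],
    with [F0] the old form. The first equation gains [Q F] on both sides; the second gains the
    quadratic relation of [F], and the cross terms cancel because [Q] and the forms are skew. *)
Lemma gk_act : degenerate_gk Jp Jt Q Gt.
Proof.
have [hp hm [f0 c0] e0 t0] := gk0; have [_ _ hQ _ _] := hp; have hF := F_form2.
have cF : closed2 F by case: psi_C => _ [].
have [c [sc cK cK']] := chi_inverse; have [lQ kQ _] := hQ.
have rQ := related_inverse spsi spsi' L L' Q_preserved.
split=> //.
- apply: (@transport_holomorphic_poisson _ _ _ (chi \o psi') (psi \o c) _ _ _ _ _ Jm _ Q Qm) => //.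
  + exact: smooth_map_comp spsi' chi_smooth.
  + exact: smooth_map_comp sc spsi.
  + by move=> x /=; rewrite [c _]cK L'.
  + by move=> x /=; rewrite L; exact: cK'.
  + exact: kappa_endo.
  + exact: related_comp spsi' chi_smooth rQ rel_chi.
  + by case: mD => -[].
- rewrite Gt_pullback; have hG := form2D f0 hF.
  by split; [exact: (pullback2_form2 spsi' hG)|exact: (closed2_pullback spsi' hG (closed2D f0 hF c0 cF))].
- move=> p u; apply: (push_inj spsi' spsi L').
  rewrite pushD // pushN // push_psi'_Jt push_psi'_Jp /gauge Gt_pullback.
  rewrite [LHS]addrAC e0 (rQ p (fun w => pullback2 s B (psi' p) (push psi' u) w + F (psi' p) (push psi' u) w)); last exact: (form2_linr _ (form2D f0 hF)).
  have := lQ (psi' p) 1 _ _ (form2_linr (push psi' u) f0) (form2_linr (push psi' u) hF).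
  rewrite !scale1r => <-; congr (Q _ _); apply/funext => w; by rewrite mul1r.
- move=> p u v; rewrite Gt_pullback /pullback2 push_psi'_Jt push_psi'_Jp.
  move: (push psi' u) (push psi' v); move: (psi' p) => q {}u {}v.
  have eJ : pullback_endo chi Jm q v = Jp q v - Q q (pullback2 s B q v) by rewrite -e0 opprB addrCA subrr addr0.
  have t1 := t0 q u v; have t2 : F q (Jp q u) v + F q u (Jp q v) + F q (Q q (F q u)) v = 0 by case: psi_C.
  rewrite /gauge -/(pullback2 s B q _ _) -/(pullback2 s B q _ _).
  rewrite (covD (form2_linl v f0)) (covD (form2_linl v hF)) {2}eJ (covB (form2_linr u hF)).
  have e : pullback2 s B q (Q q (F q u)) v = F q u (Q q (pullback2 s B q v)).
    rewrite (form2_skew _ _ f0) (kQ q (F q u) (pullback2 s B q v)) ?opprK //; exact: form2_linr.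
  rewrite e; move: t1 t2.
  move: (F q u _) (F q u _) (F q _ v) (F q _ v) (pullback2 s B q _ _) (pullback2 s B q _ _) => a1 a2 a3 a4 a5 a6.
  lra.
Qed.

Lemma act_gk_data : degenerate_gk_data Jm Qm Jp Q D1.
Proof.
have rQ := related_inverse spsi spsi' L L' Q_preserved.
split; [exact: morita_act|exact: brane_act|exists (s \o psi'); split].
- exact: section_act.
- exact: related_comp spsi' chi_smooth rQ rel_chi.
- by rewrite re_act; exact: gk_act.
Qed.

Lemma brane_gk_data : degenerate_gk_data Jm Qm Jp Q D2.
Proof.
have rQ := related_inverse spsi spsi' L L' Q_preserved.
have e : pim D2 \o (phi \o s \o psi') = chi \o psi'.
  by apply/funext => x; have := congr1 (fun h => h (s (psi' x))) phi_pim.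
split; [exact: mD|exact: brane_with|exists (phi \o s \o psi'); split].
- exact: section_phi.
- by rewrite e; exact: related_comp spsi' chi_smooth rQ rel_chi.
- rewrite e -[phi \o s \o psi']/(phi \o (s \o psi')) -(pullback2_comp _ (smooth_map_comp spsi' s_smooth) sphi).
  exact: gk_act.
Qed.

End Induced.

End OneMap.

End Action.

(** The lifted field is tangent to the fibres of pi_-, so every smooth function on the base is
    constant along the projected curve, and smooth functions separate points. *)
Lemma pim_flow (R : realType) (Xm M : manifold R) (Jm : endo Xm) (Qm : bivector Xm) (Jp : endo M) (Q : bivector M)
    (D : brane_data Xm M) (alpha : form1 M) (eta : R -> tot D -> tot D) (t : R) :
  morita Jm Qm Jp Q D -> is_form1 alpha -> (forall z, eta 0 z = z) ->
  (forall z, integral_curve setT (fun z => inv_form (imF (Omega D)) z (pullback1 (pip D) alpha z)) (eta^~ z)) ->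
  pim D \o eta t = pim D.
Proof.
move=> mD hal eta0 heta; apply/funext => z; apply: points_separated => f sf.
have spm := pim_smooth mD; rewrite /= -[in RHS](eta0 z).
apply: (@derive0_cst R (fun r => f (pim D (eta r z))) t) => r _.
have := icurve_derive (t := r) (heta z) Logic.I (smooth_comp spm sf).
by rewrite -pushE // (push_pim_lift mD (hal.1 _)).
Qed.

Theorem proposition7p3 (R : realType) (Xm M : manifold R)
    (Jm : endo Xm) (Qm : bivector Xm) (Jp : endo M) (Q : bivector M)
    (D : brane_data Xm M) (hD : gk_data Jm Qm Jp Q D)
    (alpha : form1 M) (halpha : is_form1 alpha) (dalpha : closed1 alpha)
    (T : set R) (T_open : open T) (T_itv : is_interval T) (T0 : T 0)
    (psi : R -> M -> M) (hpsi : is_flow T (fun p => Q p (alpha p)) psi) :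
  let F : R -> form2 M := flow_form psi (dc1 Jp alpha) in
  aut_C_alg Jp Q (fun p => Q p (alpha p)) (dc1 Jp alpha) /\
  (forall t, T t -> Aut_C Jp Q (psi t) (F t)) /\
  exists eta : R -> tot D -> tot D,
    is_flow T (fun z => inv_form (imF (Omega D)) z (pullback1 (pip D) alpha z)) eta /\
    forall t, T t ->
      [/\ degenerate_gk_data Jm Qm Jp Q (act (psi t) (F t) D),
          degenerate_gk_data Jm Qm Jp Q (with_brane D (eta t @` brane D)) &
          isomorphic (act (psi t) (F t) D) (with_brane D (eta t @` brane D))].
Proof.
case: hD => mD bD [s [hs rel_chi [gk0 _]]]; have [ss _ prs _] := hs.
have [cJ _ hQ _ _] : holomorphic_poisson Jp Q by case: mD => -[].
have hom := om_form2 mD; have com := om_closed2 mD; have nd := om_nondegenerate mD.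
have hB := B_form2 mD; have cB := B_closed2 mD; have cI := I_complex mD; have omI := om_I mD.
have spr := pip_smooth mD; have surj := pip_surj mD; have dsurj := pip_push_surj mD.
have hol := pip_hol mD; have rel := pip_related mD.
have cmp : complete_map (inv_form (imF (Omega D))) Q (pip D) by case: mD => _ _ _ [_ _ _ _ []].
have cV := V_complete hQ halpha T_open T0 hpsi.
have /choice[g hg] : forall z, exists g : R -> tot D, integral_curve setT
    (fun z => inv_form (imF (Omega D)) z (pullback1 (pip D) alpha z)) g /\ g 0 = z.
  by move=> z; have [g h1 h2] := VZ_complete hom nd hQ spr rel halpha dalpha cmp cV z; exists g.
(* Completeness gives [eta] at all times, whatever [T] is, so [eta (- t)] is available as the
   inverse of [eta t]. *)
pose eta t z := g z t.
have eta0 z : eta 0 z = z by case: (hg z).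
have heta z : integral_curve setT (fun z => inv_form (imF (Omega D)) z (pullback1 (pip D) alpha z)) (eta^~ z).
  by case: (hg z).
have psiC := psi_Aut_C hom com nd hB cB cI omI cJ hQ spr surj dsurj hol rel halpha dalpha
  eta0 heta T_open T_itv T0 hpsi ss prs.
split; first exact: (V_aut_C_alg hom com nd hB cB cI omI cJ hQ spr surj dsurj hol rel halpha dalpha).
split=> //; exists eta.
have sV := VZ_vfield hom nd spr halpha.
split; first split=> [//|t _|z].
- exact: (gflow_diffeo sV eta0 heta).
- by apply: icurve_sub (heta z).
move=> t Tt; have seta r : smooth_map (eta r) := gflow_smooth sV eta0 heta r.
(* [- t] may lie outside [T], so the inverse of [psi t] is taken from [is_flow] and not from a group
   law. *)
have [_ /(_ t Tt)[spsi [psi' [spsi' L L']]] _] := hpsi.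
have phi_om := eta_om hom com nd spr halpha dalpha eta0 heta t.
have phi_B z (u v : tangent z) : reF (Omega D) (eta t z) (push (eta t) u) (push (eta t) v) =
    reF (Omega D) z u v + pullback2 (pip D) (flow_form psi (dc1 Jp alpha) t) z u v.
  rewrite (eta_B hom nd hB cB omI cJ hQ spr hol rel halpha dalpha eta0 heta T_open T_itv T0 hpsi Tt).
  by rewrite addrC subrK.
have phi_pip := esym (eta_pr hQ spr rel halpha eta0 heta T_open T_itv T0 hpsi Tt).
have phi_pim := pim_flow t mD halpha eta0 heta.
have K := gflowK sV eta0 heta t; have K' := gflowNK sV eta0 heta t.
split.
- exact: (act_gk_data mD bD (seta t) (seta (- t)) K K' spsi spsi' L L' phi_om phi_B phi_pip (psiC t Tt) hs rel_chi gk0).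
- exact: (brane_gk_data mD bD (seta t) (seta (- t)) K K' spsi spsi' L L' phi_om phi_B phi_pip phi_pim (psiC t Tt) hs rel_chi gk0).
- exact: (act_isomorphic mD (seta t) (seta (- t)) K K' phi_om phi_B phi_pip phi_pim (psiC t Tt)).
Qed.
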